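(* Let $f:\mathbb{R}\to[-\infty,\infty)$ be upper semi-continuous and monotonically decreasing (i.e. $f(s)\geq f(t)$ whenever $s\leq t$), such that $f(0)=0$ and $f(t)<0$ for all $t>0$. Let $X\subset\mathbb{C}^n$ be a non-empty closed set and let $\mathrm{dist}_X$ be the Euclidean distance to $X$. Given any integer $q\geq 0$, the following statements (1) and (2) are equivalent, and, under the extra condition $1\leq q<n$, all of the statements (1), (2), (3) are equivalent: (1) The characteristic function $\chi:\mathbb{C}^n\to[-\infty,\infty)$ defined by $\chi(y)=0$ if $y\in X$ and $\chi(y)=-\infty$ otherwise lies in $\mathit{PSH}_q(\mathbb{C}^n)$. (2) The composition $f\circ\mathrm{dist}_X$ lies in $\mathit{PSH}_q(\mathbb{C}^n)$. (3) The open set $\mathbb{C}^n\setminus X$ is $(q-1)$-pseudoconvex, i.e. $-\ln\mathrm{dist}_X$ lies in $\mathit{PSH}_{q-1}(\mathbb{C}^n\setminus X)$.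
   Context: Definitions. Let $U\subset\mathbb{C}^n$ be open and $u:U\to[-\infty,\infty)$ upper semi-continuous. (i) $u$ is subpluriharmonic on $U$ if either $u\equiv-\infty$ on $U$, or for every compact ball $\overline{B}\subset U$ and every continuous plurisubharmonic function $h$ defined in a neighborhood of $\overline{B}$, the restriction of $u+h$ to $\overline{B}$ attains its maximum on the boundary $bB$. (ii) For an integer $0\leq q<n$, $u$ is $q$-plurisubharmonic on $U$ if it is subpluriharmonic on $U\cap\pi$ for every $(q+1)$-dimensional complex affine subspace $\pi$ of $\mathbb{C}^n$ (where $\pi$ is identified with $\mathbb{C}^{q+1}$). For integers $q\geq n$, by convention every upper semi-continuous function is $q$-plurisubharmonic. $\mathit{PSH}_q(U)$ denotes the set of all $q$-plurisubharmonic functions on $U$. (iii) For an integer $r\geq 0$, an open set $D\subset\mathbb{C}^n$ with non-empty complement is $r$-pseudoconvex if $-\ln\mathrm{dist}_{\mathbb{C}^n\setminus D}$ lies in $\mathit{PSH}_r(D)$, where $\mathrm{dist}_{\mathbb{C}^n\setminus D}$ is the Euclidean distance to $\mathbb{C}^n\setminus D$ (the condition being vacuous if $D=\emptyset$). *)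

(* Defs.v *)
From HB Require Import structures.
From mathcomp Require Import all_boot all_order all_algebra.
From mathcomp Require Import all_classical all_reals all_analysis.
From mathcomp Require Import complex.

Set Implicit Arguments.
Unset Strict Implicit.
Unset Printing Implicit Defensive.

Import Order.TTheory GRing.Theory Num.Theory.
Import numFieldNormedType.Exports.

Local Open Scope classical_set_scope.
Local Open Scope ring_scope.
Local Open Scope complex_scope.

(* R[i] gets the topology of its modulus; 'rV[R[i]]_n then carries the product
   topology, which is the Euclidean topology of C^n. *)
HB.instance Definition _ (R : realType) := NormedModule.copy R[i] (R[i])^o.

(* The norm MathComp-Analysis puts on row vectors is the sup norm, hence this
   separate Euclidean norm. *)
Definition enorm (R : realType) (n : nat) (z : 'rV[R[i]]_n) : R :=
  Num.sqrt (\sum_(i < n) (complex.Re (z 0 i) ^+ 2 + complex.Im (z 0 i) ^+ 2)).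

Definition eucl_dist (R : realType) (n : nat) (X : set 'rV[R[i]]_n)
    (z : 'rV[R[i]]_n) : R :=
  inf [set enorm (z - x) | x in X].

Definition closed_eball (R : realType) (n : nat) (a : 'rV[R[i]]_n) (r : R) :
    set 'rV[R[i]]_n :=
  [set z | enorm (z - a) <= r].

Definition esphere (R : realType) (n : nat) (a : 'rV[R[i]]_n) (r : R) :
    set 'rV[R[i]]_n :=
  [set z | enorm (z - a) = r].

(* Functions on an open set U are total functions of which only the values
   on U matter; here u restricted to U is upper semi-continuous with values
   in [-oo, +oo[. *)
Definition usc_on (R : realType) (T : topologicalType) (U : set T)
    (u : T -> \bar R) : Prop :=
  forall x, U x ->
    (u x < +oo)%E /\
    forall a : R, (u x < a%:E)%E -> \forall y \near within U (nbhs x),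
      (u y < a%:E)%E.

Definition circle_mean (R : realType) (v : R[i] -> \bar R) (c : R[i]) (r : R) :
    \bar R :=
  (((2 * pi)^-1)%:E *
   \int[lebesgue_measure]_(t in `[0%R, (2 * pi)%R])
      v (c + ((r * cos t) +i* (r * sin t)))%R)%E.

(* The function -oo counts as subharmonic. *)
Definition subharmonic (R : realType) (W : set R[i]) (v : R[i] -> \bar R) :
    Prop :=
  usc_on W v /\
  forall (c : R[i]) (r : R), 0 < r ->
    [set z : R[i] | `|z - c| <= r%:C] `<=` W ->
    (v c <= circle_mean v c r)%E.

Definition plurisubharmonic (R : realType) (n : nat) (V : set 'rV[R[i]]_n)
    (v : 'rV[R[i]]_n -> \bar R) : Prop :=
  usc_on V v /\
  forall a b : 'rV[R[i]]_n,
    subharmonic [set z : R[i] | V (a + z *: b)] (fun z => v (a + z *: b)).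

Definition subpluriharmonic (R : realType) (n : nat) (U : set 'rV[R[i]]_n)
    (u : 'rV[R[i]]_n -> \bar R) : Prop :=
  usc_on U u /\
  ((forall z, U z -> u z = -oo%E) \/
   forall (a : 'rV[R[i]]_n) (r : R), 0 < r -> closed_eball a r `<=` U ->
   forall (V : set 'rV[R[i]]_n) (h : 'rV[R[i]]_n -> R),
     open V -> closed_eball a r `<=` V ->
     {within V, continuous h} -> plurisubharmonic V (fun z => (h z)%:E) ->
     exists2 z, esphere a r z &
       forall w, closed_eball a r w -> (u w + (h w)%:E <= u z + (h z)%:E)%E).

(* The (q+1)-dimensional affine subspaces are the images of the maps
   z |-> a + z A where the q+1 rows of A are orthonormal (unitarymx allows
   rectangular matrices); such a map identifies C^(q+1) with the subspace
   isometrically, so that balls in the subspace are balls in C^(q+1). *)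
Definition PSH (R : realType) (n q : nat) (U : set 'rV[R[i]]_n)
    (u : 'rV[R[i]]_n -> \bar R) : Prop :=
  usc_on U u /\
  ((q < n)%N ->
   forall (a : 'rV[R[i]]_n) (A : 'M[R[i]]_(q.+1, n)), A \is unitarymx ->
     subpluriharmonic [set z : 'rV[R[i]]_q.+1 | U (a + z *m A)]
                      (fun z => u (a + z *m A))).

Definition pseudoconvex (R : realType) (n r : nat) (D : set 'rV[R[i]]_n) :
    Prop :=
  [/\ open D, ~` D !=set0 & PSH r D (fun z => (- ln (eucl_dist (~` D) z))%:E)].

Definition char_fun (R : realType) (n : nat) (X : set 'rV[R[i]]_n)
    (y : 'rV[R[i]]_n) : \bar R :=
  if y \in X then 0%E else -oo%E.

(* Main.v *)
Require Import Defs.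
From mathcomp Require Import all_boot all_order all_algebra.
From mathcomp Require Import all_classical all_reals all_analysis.
From mathcomp Require Import complex ring lra zify.
From mathcomp Require finmap.

Set Implicit Arguments.
Unset Strict Implicit.
Unset Printing Implicit Defensive.

Import Order.TTheory GRing.Theory Num.Theory.
Import numFieldNormedType.Exports.

Local Open Scope classical_set_scope.
Local Open Scope ring_scope.
Local Open Scope complex_scope.
Local Open Scope sesquilinear_scope.

(** Every statement is compared with one local maximum principle for [X],
[max_prop q X]: on a ball in a (q+1)-dimensional affine slice, a continuous
plurisubharmonic test function [h] takes at a point [w] of [X] at most the value
that it takes at some point of [X] on the sphere.

The first statement is this principle read through the characteristic function:
off [X] the sum [char_fun X + h] is -oo, so its maximum over a ball lives on [X]
([PSH_char_max_prop]).

First to second. Let [x] be a point of [X] nearest to the point [w] of the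
slice. The slice translated by [x - w] meets [X] at [x]; the sphere point that
the principle gives there lies within [|x - w|] of the original sphere, and [f]
is decreasing ([max_prop_fdist]).

Second to first. If the principle failed, then [f o dist] would be bounded away
from 0 on the compact set of sphere points where [h >= h w], and a small
multiple of [h] would contradict the second statement ([fdist_max_prop]).

First to third is an argument of Hartogs type. If [h - ln dist] is larger at [w]
than on the sphere of a q-dimensional slice, add to the slice the direction from
[w] to a nearest point of [X], with complex coordinate [y_0]. In this
(q+1)-dimensional slice, [|y_0|] at a point of [X] over [z] bounds the distance
from [z] to [X] from above up to a factor, so that [h(z) - ln |y_0|] has an
interior strict maximum over the points of [X]. Since [ln |y_0|] is
pluriharmonic where [y_0 <> 0], replacing it by its second order Taylor
polynomial contradicts the principle ([log_coord_max], [log_dist_max]).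

Third to first. Assume that the principle fails on a slice with orthonormal
frame [A]. A test function can be smoothed so that at each point its graph lies,
up to a cubic error, above that of a pluriharmonic quadratic polynomial
([psh_smoothing]). Maximise over [X] the smoothed function plus a small multiple
of the square of the distance to the centre minus a large multiple of the square
of the distance to the slice. At the maximum point [x0], the points [x0 + xi] of
[X] near [x0] satisfy [l(xi) + b(t, t) + ep |t|^2 <= K |xi_perp|^2], where [t]
and [xi_perp] are the components of [xi] along and across the slice, [l] is real
linear and [b] is the real part of a complex quadratic form. If [l] is the inner
product with [N <> 0], then [X] curves away from [x0 + tau N] in the q
directions of the slice that are orthogonal to [N]; there [- ln dist] lies below
a pluriharmonic function on a small sphere but not at its centre, against
pseudoconvexity ([no_quadratic_barrier]). If [l = 0], the same form centred at a
point slightly off [x0] has a maximum point on [X] where the linear part does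
not vanish ([no_barrier]).

The smoothing needs a translation invariant functional on bounded functions of
[C^m], obtained as an ultrafilter limit of averages along translates
([invariant_mean]) and made local by reduction modulo the lattice [Z[i]^m]
([bump_functional]). Such a functional commutes with finite sums only; hence the
mean values over circles are replaced by finite sums over equidistant points. *)

(** * The real inner product of C^n *)

(** The real part of the hermitian product: the inner product of C^n seen as
R^(2n), for which [enorm] is the norm. *)
Definition rdot (R : realType) (n : nat) (x y : 'rV[R[i]]_n) : R :=
  \sum_(i < n) (complex.Re (x 0 i) * complex.Re (y 0 i) +
                complex.Im (x 0 i) * complex.Im (y 0 i)).

Section InnerProduct.
Variable R : realType.
Implicit Types n m : nat.
Implicit Types (s t : R).

Lemma cReD (a b : R[i]) : complex.Re (a + b) = complex.Re a + complex.Re b.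
Proof. by case: a b => [? ?] [? ?]. Qed.
Lemma cImD (a b : R[i]) : complex.Im (a + b) = complex.Im a + complex.Im b.
Proof. by case: a b => [? ?] [? ?]. Qed.
Lemma cReN (a : R[i]) : complex.Re (- a) = - complex.Re a.
Proof. by case: a. Qed.
Lemma cImN (a : R[i]) : complex.Im (- a) = - complex.Im a.
Proof. by case: a. Qed.
Lemma cReM (a b : R[i]) : complex.Re (a * b) =
  complex.Re a * complex.Re b - complex.Im a * complex.Im b.
Proof. by case: a b => [? ?] [? ?]. Qed.
Lemma cImM (a b : R[i]) : complex.Im (a * b) =
  complex.Re a * complex.Im b + complex.Im a * complex.Re b.
Proof. by case: a b => [? ?] [? ?]. Qed.

Lemma rdotC n (x y : 'rV[R[i]]_n) : rdot x y = rdot y x.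
Proof. by apply: eq_bigr => i _; ring. Qed.

Lemma rdotDl n (x y z : 'rV[R[i]]_n) : rdot (x + y) z = rdot x z + rdot y z.
Proof.
by rewrite -big_split; apply: eq_bigr => i _; rewrite /= !mxE cReD cImD; ring.
Qed.

Lemma rdotDr n (x y z : 'rV[R[i]]_n) : rdot z (x + y) = rdot z x + rdot z y.
Proof. by rewrite rdotC rdotDl !(rdotC z). Qed.

Lemma rdotNl n (x z : 'rV[R[i]]_n) : rdot (- x) z = - rdot x z.
Proof.
by rewrite -sumrN; apply: eq_bigr => i _; rewrite /= !mxE cReN cImN; ring.
Qed.

Lemma rdotNr n (x z : 'rV[R[i]]_n) : rdot z (- x) = - rdot z x.
Proof. by rewrite rdotC rdotNl rdotC. Qed.

Lemma rdotBl n (x y z : 'rV[R[i]]_n) : rdot (x - y) z = rdot x z - rdot y z.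
Proof. by rewrite rdotDl rdotNl. Qed.

Lemma rdotBr n (x y z : 'rV[R[i]]_n) : rdot z (x - y) = rdot z x - rdot z y.
Proof. by rewrite rdotDr rdotNr. Qed.

Lemma rdot_realZl n s (x z : 'rV[R[i]]_n) : rdot (s%:C *: x) z = s * rdot x z.
Proof.
by rewrite mulr_sumr; apply: eq_bigr => i _; rewrite /= !mxE cReM cImM /=; ring.
Qed.

Lemma rdot_realZr n s (x z : 'rV[R[i]]_n) : rdot z (s%:C *: x) = s * rdot z x.
Proof. by rewrite rdotC rdot_realZl rdotC. Qed.

Lemma rdot_iZl n (x z : 'rV[R[i]]_n) : rdot ('i *: x) z = - rdot x ('i *: z).
Proof.
by rewrite -sumrN; apply: eq_bigr => i _; rewrite /= !mxE !cReM !cImM /=; ring.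
Qed.

Lemma scaler_ii n (x : 'rV[R[i]]_n) : 'i *: ('i *: x) = - x :> 'rV[R[i]]_n.
Proof. by rewrite scalerA -expr2 sqr_i scaleN1r. Qed.

Lemma rdot_ii n (x z : 'rV[R[i]]_n) : rdot ('i *: x) ('i *: z) = rdot x z.
Proof. by rewrite rdot_iZl scaler_ii rdotNr opprK. Qed.

Lemma rdot_i_eq0 n (x : 'rV[R[i]]_n) : rdot x ('i *: x) = 0.
Proof. by have := rdot_iZl x x; rewrite rdotC; lra. Qed.

(** Splits a complex scalar into two real ones, so that real linear maps can be
evaluated on complex multiples. *)
Lemma complexZE n (z : R[i]) (x : 'rV[R[i]]_n) :
  z *: x = (complex.Re z)%:C *: x + (complex.Im z)%:C *: ('i *: x).
Proof.
rewrite scalerA -scalerDl; congr (_ *: _); case: z => a b /=.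
by apply/eqP; rewrite eq_complex !cReD !cImD !cReM !cImM /=; apply/andP; split;
   apply/eqP; ring.
Qed.

Lemma rdot0l n (z : 'rV[R[i]]_n) : rdot 0 z = 0.
Proof. by have := rdotBl z z z; rewrite !subrr. Qed.

Lemma rdot0r n (z : 'rV[R[i]]_n) : rdot z 0 = 0.
Proof. by rewrite rdotC rdot0l. Qed.

Lemma enormE n (x : 'rV[R[i]]_n) : enorm x = Num.sqrt (rdot x x).
Proof. by []. Qed.

Lemma rdot_ge0 n (x : 'rV[R[i]]_n) : 0 <= rdot x x.
Proof. by apply: sumr_ge0 => i _; rewrite addr_ge0 // -expr2 sqr_ge0. Qed.

Lemma enorm_ge0 n (x : 'rV[R[i]]_n) : 0 <= enorm x.
Proof. exact: sqrtr_ge0. Qed.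

Lemma sqr_enorm n (x : 'rV[R[i]]_n) : enorm x ^+ 2 = rdot x x.
Proof. by rewrite enormE sqr_sqrtr // rdot_ge0. Qed.

(** The discriminant of [t |-> |x - t y|^2 >= 0]. *)
Lemma rdot_CS n (x y : 'rV[R[i]]_n) : `|rdot x y| <= enorm x * enorm y.
Proof.
rewrite -(@ler_pXn2r _ 2) ?nnegrE ?mulr_ge0 ?enorm_ge0 ?normr_ge0 //.
rewrite exprMn !sqr_enorm -normrX ger0_norm ?sqr_ge0 //.
have H t : 0 <= rdot x x - 2 * t * rdot x y + t ^+ 2 * rdot y y.
  have := rdot_ge0 (x - t%:C *: y).
  by rewrite rdotBl !rdotBr !rdot_realZl !rdot_realZr (rdotC y x); lra.
have [y0|y0] := eqVneq (rdot y y) 0.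
  suff -> : rdot x y = 0 by rewrite y0; lra.
  apply/eqP/negP => /negP xy0.
  have := H ((rdot x x + 1) / (2 * rdot x y)).
  rewrite y0 (_ : 2 * (_ / _) * _ = rdot x x + 1); first lra.
  by field.
have yp : 0 < rdot y y by rewrite lt_neqAle eq_sym y0 rdot_ge0.
have := H (rdot x y / rdot y y).
rewrite (_ : _ + _ = (rdot x x * rdot y y - rdot x y ^+ 2) / rdot y y); last by field.
by rewrite pmulr_lge0 ?invr_gt0 //; lra.
Qed.

Lemma ler_rdot n (x y : 'rV[R[i]]_n) : rdot x y <= enorm x * enorm y.
Proof. exact: le_trans (ler_norm _) (rdot_CS x y). Qed.

Lemma ler_enormD n (x y : 'rV[R[i]]_n) : enorm (x + y) <= enorm x + enorm y.
Proof.
rewrite -(@ler_pXn2r _ 2) ?nnegrE ?addr_ge0 ?enorm_ge0 //.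
rewrite sqr_enorm rdotDl !rdotDr -!sqr_enorm (rdotC y x).
by have := ler_rdot x y; nra.
Qed.

Lemma enormN n (x : 'rV[R[i]]_n) : enorm (- x) = enorm x.
Proof. by rewrite !enormE rdotNl rdotNr opprK. Qed.

Lemma enorm_distC n (x y : 'rV[R[i]]_n) : enorm (x - y) = enorm (y - x).
Proof. by rewrite -enormN opprB. Qed.

Lemma ler_enormB n (x y z : 'rV[R[i]]_n) :
  enorm (x - z) <= enorm (x - y) + enorm (y - z).
Proof. by apply: le_trans (ler_enormD _ _); rewrite addrA subrK. Qed.

Lemma enorm0 n : enorm (0 : 'rV[R[i]]_n) = 0.
Proof. by rewrite enormE rdot0l sqrtr0. Qed.

Lemma enorm_eq0 n (x : 'rV[R[i]]_n) : enorm x = 0 -> x = 0.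
Proof.
move=> x0; apply/rowP => j; rewrite mxE.
have : rdot x x = 0 by rewrite -sqr_enorm x0 expr0n.
move/eqP; rewrite psumr_eq0 => [|i _]; last by rewrite addr_ge0 // -expr2 sqr_ge0.
move=> /allP /(_ j); rewrite mem_index_enum => /(_ isT) /=.
rewrite -!expr2 paddr_eq0 ?sqr_ge0 // !sqrf_eq0.
by case: (x 0 j) => a b /= /andP[/eqP -> /eqP ->].
Qed.

Lemma enorm_gt0 n (x : 'rV[R[i]]_n) : x != 0 -> 0 < enorm x.
Proof.
by move=> x0; rewrite lt_neqAle enorm_ge0 eq_sym andbT; apply: contra x0 => /eqP /enorm_eq0 ->.
Qed.

Lemma enorm_realZ n s (x : 'rV[R[i]]_n) : enorm (s%:C *: x) = `|s| * enorm x.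
Proof.
rewrite !enormE rdot_realZl rdot_realZr mulrA -expr2 sqrtrM ?sqr_ge0 //.
by rewrite sqrtr_sqr.
Qed.

Lemma enorm_iZ n (x : 'rV[R[i]]_n) : enorm ('i *: x) = enorm x.
Proof. by rewrite !enormE rdot_ii. Qed.

Lemma sqr_enormZ n (z : R[i]) (x : 'rV[R[i]]_n) :
  enorm (z *: x) ^+ 2 = (complex.Re z ^+ 2 + complex.Im z ^+ 2) * enorm x ^+ 2.
Proof.
rewrite !sqr_enorm complexZE !rdotDl !rdotDr !rdot_realZl !rdot_realZr.
by rewrite rdot_ii (rdotC ('i *: x)) rdot_i_eq0; ring.
Qed.

Lemma rdot_mxE n (x y : 'rV[R[i]]_n) :
  rdot x y = complex.Re ((x *m y ^t*) 0 0).
Proof.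
rewrite mxE (big_morph _ cReD (erefl : complex.Re 0 = 0)); apply: eq_bigr => i _.
rewrite !mxE; case: (x 0 i) (y 0 i) => [a b] [c d] /=.
by rewrite mulrN opprK.
Qed.

(** The real part of the adjunction between [A] and its conjugate transpose. *)
Lemma rdot_adj n m (x : 'rV[R[i]]_m) (y : 'rV[R[i]]_n) (A : 'M[R[i]]_(m, n)) :
  rdot (x *m A) y = rdot x (y *m A ^t*).
Proof. by rewrite !rdot_mxE trmx_mul map_mxM /= trmxCK mulmxA. Qed.

Lemma rdot_unitary n m (x y : 'rV[R[i]]_m) (A : 'M[R[i]]_(m, n)) :
  A \is unitarymx -> rdot (x *m A) (y *m A) = rdot x y.
Proof. by move=> uA; rewrite rdot_adj mulmxtVK. Qed.

Lemma enorm_unitary n m (x : 'rV[R[i]]_m) (A : 'M[R[i]]_(m, n)) :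
  A \is unitarymx -> enorm (x *m A) = enorm x.
Proof. by move=> uA; rewrite !enormE rdot_unitary. Qed.

(** The projection to the row space of [A] shortens vectors:
[|x A^*|^2 = <x A^* A, x> <= |x A^*| |x|]. *)
Lemma enorm_adj_le n m (x : 'rV[R[i]]_n) (A : 'M[R[i]]_(m, n)) :
  A \is unitarymx -> enorm (x *m A ^t*) <= enorm x.
Proof.
move=> uA; have := ler_rdot (x *m A ^t* *m A) x.
rewrite rdot_adj -sqr_enorm (enorm_unitary _ uA) => H.
have := enorm_ge0 (x *m A ^t*); rewrite le_eqVlt => /orP[/eqP <-|p].
  exact: enorm_ge0.
by rewrite -(ler_pM2l p) -expr2.
Qed.

End InnerProduct.

(** * Topology of C^n in terms of the Euclidean norm *)

Section Topology.
Variable R : realType.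

(** The superlevel sets of the values of [u] on [K] form a filter base; a cluster
point of it is a maximum point. *)
Lemma usc_max (T : topologicalType) (K : set T) (u : T -> \bar R) :
  compact K -> K !=set0 ->
  (forall x, K x -> (u x < +oo)%E /\
     forall a : R, (u x < a%:E)%E -> \forall y \near within K (nbhs x),
      (u y < a%:E)%E) ->
  exists2 z, K z & forall w, K w -> (u w <= u z)%E.
Proof.
move=> cK [x0 Kx0] uscu.
pose B (z : T) := [set w | K w /\ (u z <= u w)%E].
have FF : ProperFilter (filter_from K B).
  apply: filter_from_proper; last by move=> z Kz; exists z.
  apply: filter_from_filter; first by exists x0.
  move=> a b Ka Kb; have /orP[ab|ba] := le_total (u a) (u b).
    by exists b => // w [Kw uw]; split; split => //; exact: le_trans ab uw.
  by exists a => // w [Kw uw]; split; split => //; exact: le_trans ba uw.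
have [|p [Kp clp]] := cK _ FF; first by exists x0 => // w [].
exists p => // z Kz; rewrite leNgt; apply/negP => upz.
have [uzoo _] := uscu z Kz.
have [a az] : exists a : R, u z = a%:E.
  by move: uzoo upz; case: (u z) => [r _ _|//|]; [exists r | case: (u p)].
have [_ /(_ a)] := uscu p Kp; rewrite -az => /(_ upz) nu.
have [w [[Kw uzw] nw]] := clp (B z) _ (ex_intro2 _ _ z Kz (@subset_refl _ _)) nu.
by have := nw Kw; rewrite ltNge uzw.
Qed.

Lemma ball_mx n (x y : 'rV[R[i]]_n) (e : R) : 0 < e ->
  ball x e%:C y <-> forall j, Num.sqrt (complex.Re (y 0 j - x 0 j) ^+ 2 +
    complex.Im (y 0 j - x 0 j) ^+ 2) < e.
Proof.
move=> e0; split => [[_ H] j|H].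
  have := H 0 j; rewrite /ball /= normc_def ltcR.
  by rewrite -(opprB (y 0 j)) cReN cImN !sqrrN.
split; first by rewrite ltcR.
move=> i j; rewrite (ord1 i) /ball /= normc_def ltcR.
by rewrite -(opprB (y 0 j)) cReN cImN !sqrrN.
Qed.

(** The topology of row vectors is that of the sup norm of the moduli, which is at
most the Euclidean norm and at least 1/(n+1) times it. *)
Lemma nbhs_enormP n (x : 'rV[R[i]]_n) (A : set 'rV[R[i]]_n) :
  nbhs x A <-> exists2 e : R, 0 < e & forall y, enorm (y - x) < e -> A y.
Proof.
rewrite nbhs_ballP; split.
  move=> [e /= e0 H].
  have [e' e'0 ee'] : exists2 e' : R, 0 < e' & e = e'%:C.
    exists (complex.Re e); first by move: e0; rewrite ltcE => /andP[].
    by move: e0; rewrite ltcE => /andP[/eqP ]; case: (e) => ? ? /= ->.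
  exists e' => // y xy; apply: H; rewrite ee'; apply/ball_mx => // j.
  apply: le_lt_trans xy; rewrite ler_sqrt ?rdot_ge0 //.
  rewrite (bigD1 j) //= !mxE lerDl sumr_ge0 // => i _.
  by rewrite addr_ge0 // sqr_ge0.
move=> [e e0 H]; exists (e / n.+1%:R)%:C => /=; first by rewrite ltcR divr_gt0.
move=> y xy; apply: H.
have e'0 : 0 < e / n.+1%:R by rewrite divr_gt0.
have {}xy := (ball_mx _ _ e'0).1 xy.
rewrite -(@ltr_pXn2r _ 2) ?nnegrE ?enorm_ge0 ?(ltW e0) // sqr_enorm.
apply: (@le_lt_trans _ _ (\sum_(i < n) (e / n.+1%:R) ^+ 2)).
  apply: ler_sum => i _; have {}xy := ltW (xy i); rewrite -!expr2 !mxE.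
  set a := _ - _ in xy *; have a0 : 0 <= complex.Re a ^+ 2 + complex.Im a ^+ 2.
    by rewrite addr_ge0 // sqr_ge0.
  by rewrite -(sqr_sqrtr a0) ler_pXn2r ?nnegrE ?sqrtr_ge0 ?(ltW e'0).
rewrite sumr_const card_ord -[X in X < _]mulr_natl expr_div_n.
have n1 : (0 : R) < n.+1%:R by [].
rewrite mulrA ltr_pdivrMr ?exprn_gt0 // [ltRHS]mulrC ltr_pM2r ?exprn_gt0 //.
by rewrite -natrX ltr_nat -mulnn (leq_trans (ltnSn n)) // leq_pmulr.
Qed.

Lemma nbhs_normcP (x : R[i]) (A : set R[i]) :
  nbhs x A <-> exists2 e : R, 0 < e & forall y, ComplexField.Normc.normc (y - x) < e -> A y.
Proof.
rewrite nbhs_ballP; split.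
  move=> [e /= e0 H].
  have [e' e'0 ee'] : exists2 e' : R, 0 < e' & e = e'%:C.
    exists (complex.Re e); first by move: e0; rewrite ltcE => /andP[].
    by move: e0; rewrite ltcE => /andP[/eqP ]; case: (e) => ? ? /= ->.
  exists e' => // y xy; apply: H; rewrite ee' /ball /= distrC.
  by rewrite [ `|_|]/(_%:C) ltcR.
move=> [e e0 H]; exists e%:C => /=; first by rewrite ltcR.
by move=> y; rewrite /ball /= distrC [ `|_|]/(_%:C) ltcR; exact: H.
Qed.

Lemma compact_boxc (M : R) : compact [set z : R[i] |
  (- M <= complex.Re z <= M) && (- M <= complex.Im z <= M)].
Proof.
have -> : [set z : R[i] |
  (- M <= complex.Re z <= M) && (- M <= complex.Im z <= M)] =
  (fun p : R * R => (p.1 +i* p.2 : R[i])) @` (`[- M, M] `*` `[- M, M]).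
  apply/seteqP; split => [z /= /andP[H1 H2]|z [[a b] /= [H1 H2] <- /=]].
    by exists (complex.Re z, complex.Im z); [split; rewrite /= in_itv|case: z {H1 H2}].
  by move: H1 H2; rewrite !in_itv /= => -> ->.
apply: continuous_compact; last by apply: compact_setX; exact: segment_compact.
apply: continuous_subspaceT => -[a b] A /nbhs_normcP [e e0 H].
have e20 : 0 < e / 2 by rewrite divr_gt0.
exists (ball a (e / 2), ball b (e / 2)); first by split; apply: nbhsx_ballx.
move=> [c d] [/= ac bd]; apply: H => /=.
rewrite -[ltRHS](ger0_norm (ltW e0)) -sqrtr_sqr ltr_sqrt; last by rewrite exprn_gt0.
move: ac bd; rewrite /ball /= distrC (distrC b) !ltr_norml.
by move=> /andP[? ?] /andP[? ?]; nra.
Qed.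

Lemma normc_le_enorm n (x : 'rV[R[i]]_n) j :
  ComplexField.Normc.normc (x 0 j) <= enorm x.
Proof.
have -> : ComplexField.Normc.normc (x 0 j) = Num.sqrt (complex.Re (x 0 j) ^+ 2 + complex.Im (x 0 j) ^+ 2).
  by case: (x 0 j).
rewrite ler_sqrt ?rdot_ge0 // (bigD1 j) //= lerDl sumr_ge0 // => i _.
by rewrite addr_ge0 // sqr_ge0.
Qed.

Lemma norm_Re_le n (x : 'rV[R[i]]_n) j : `|complex.Re (x 0 j)| <= enorm x.
Proof.
apply: le_trans (normc_le_enorm _ j).
by case: (x 0 j) => b c /=; rewrite -sqrtr_sqr ler_sqrt ?lerDl ?addr_ge0 ?sqr_ge0.
Qed.

Lemma norm_Im_le n (x : 'rV[R[i]]_n) j : `|complex.Im (x 0 j)| <= enorm x.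
Proof.
apply: le_trans (normc_le_enorm _ j).
by case: (x 0 j) => b c /=; rewrite -sqrtr_sqr ler_sqrt ?lerDr ?addr_ge0 ?sqr_ge0.
Qed.

Lemma closed_enormP n (A : set 'rV[R[i]]_n) :
  closed A <-> forall x, (forall e : R, 0 < e -> exists2 y, A y & enorm (y - x) < e) -> A x.
Proof.
split => [cA x H|H x clx].
  apply: cA => B /nbhs_enormP [e e0 HB]; have [y Ay yx] := H e e0.
  by exists y; split => //; apply: HB.
apply: H => e e0; have [|y [Ay By]] := clx [set y | enorm (y - x) < e].
  by apply/nbhs_enormP; exists e.
by exists y.
Qed.

Lemma open_enormP n (A : set 'rV[R[i]]_n) :
  open A <-> forall x, A x -> exists2 e : R, 0 < e & forall y, enorm (y - x) < e -> A y.
Proof.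
rewrite openE; split => [oA x Ax|H x Ax]; last exact/nbhs_enormP/H.
exact/nbhs_enormP/oA.
Qed.

Lemma closed_closed_eball n (a : 'rV[R[i]]_n) r : closed (closed_eball a r).
Proof.
apply/closed_enormP => x H; rewrite /closed_eball /= leNgt; apply/negP => ax.
have [|y /= ya yx] := H (enorm (x - a) - r); first by rewrite subr_gt0.
rewrite /closed_eball /= in ya; have := ler_enormB x y a.
by rewrite (enorm_distC x y); lra.
Qed.

Lemma closed_esphere n (a : 'rV[R[i]]_n) r : closed (esphere a r).
Proof.
apply/closed_enormP => x H; apply/eqP/negP => /negP ax.
have [|y /= ya yx] := H `|enorm (x - a) - r|; first by rewrite normr_gt0 subr_eq0.
rewrite /esphere /= in ya; have := ler_enormB x y a; have := ler_enormB y x a.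
rewrite (enorm_distC x y) ya; move: yx; by case: (ger0P (enorm (x - a) - r)); lra.
Qed.

Lemma compact_closed_eball n (a : 'rV[R[i]]_n) r : compact (closed_eball a r).
Proof.
pose M := enorm a + r.
apply: (@subclosed_compact _ _ [set v : 'rV[R[i]]_n | forall j,
   (- M <= complex.Re (v 0 j) <= M) && (- M <= complex.Im (v 0 j) <= M)]).
- exact: closed_closed_eball.
- exact: (@rV_compact R[i] n (fun=> _) (fun=> @compact_boxc M)).
- move=> x /= ax j; rewrite -!ler_norml.
  have xM : enorm x <= M.
    have := ler_enormD (x - a) a; rewrite subrK /M; move: ax; rewrite /closed_eball /=; lra.
  by apply/andP; split; apply: le_trans xM; [exact: norm_Re_le|exact: norm_Im_le].
Qed.

Lemma compact_esphere n (a : 'rV[R[i]]_n) r : compact (esphere a r).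
Proof.
apply: (subclosed_compact _ (@compact_closed_eball n a r)); first exact: closed_esphere.
by move=> x; rewrite /esphere /closed_eball /= => ->.
Qed.

(** Continuity at a point in epsilon-delta form for the Euclidean norm, which is
what all estimates below use; [econtP] compares it with the topology. *)
Definition econt n (f : 'rV[R[i]]_n -> R) (x : 'rV[R[i]]_n) := forall e : R, 0 < e ->
  exists2 d : R, 0 < d & forall y, enorm (y - x) < d -> `|f y - f x| < e.

Lemma econtP n (f : 'rV[R[i]]_n -> R) (x : 'rV[R[i]]_n) :
  {for x, continuous f} <-> econt f x.
Proof.
split => [cf e e0|H A [e /= e0 HA]].
  have /nbhs_enormP[d d0 H] : nbhs x (f @^-1` ball (f x) e) by apply: cf; exact: nbhsx_ballx.
  by exists d => // y /H; rewrite /ball /= distrC.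
have [d d0 Hd] := H e e0; apply/nbhs_enormP; exists d => // y /Hd; rewrite distrC.
exact: HA.
Qed.

Lemma within_econtP n (V : set 'rV[R[i]]_n) (h : 'rV[R[i]]_n -> R) : open V ->
  {within V, continuous h} <-> forall x, V x -> econt h x.
Proof.
move=> oV; rewrite continuous_open_subspace //; split => [H x Vx|H x].
  by apply/econtP/H; rewrite inE.
by rewrite inE => Vx; apply/econtP/H.
Qed.

Lemma real_max n (K : set 'rV[R[i]]_n) (f : 'rV[R[i]]_n -> R) :
  compact K -> K !=set0 -> (forall x, K x -> econt f x) ->
  exists2 z, K z & forall w, K w -> f w <= f z.
Proof.
move=> cK K0 cf.
have [x Kx|z Kz H] := @usc_max _ K (EFin \o f) cK K0.
  split => [|a]; first by rewrite /= ltry.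
  rewrite /= lte_fin => fxa; apply: cvg_within.
  have [|d d0 Hd] := cf x Kx (a - f x); first by rewrite subr_gt0.
  apply/nbhs_enormP; exists d => // y /Hd; rewrite lte_fin => /ltr_normlW; lra.
by exists z => // w /H; rewrite lee_fin.
Qed.

(** The points of the compact set are fixed but their neighbours [y] may leave it:
this is what makes it possible to shift a function by small vectors. *)
Lemma unif_cont n (K : set 'rV[R[i]]_n) (f : 'rV[R[i]]_n -> R) :
  compact K -> (forall x, K x -> econt f x) -> forall e : R, 0 < e ->
  exists2 d : R, 0 < d & forall x y, K x -> enorm (y - x) < d -> `|f y - f x| < e.
Proof.
move=> cK cf e e0.
pose P (d : R) (x : 'rV[R[i]]_n) := forall y, enorm (y - x) < d -> `|f y - f x| < e.
have /compact_near_coveringP /(_ _ (0^'+) P) := cK.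
case=> [x Kx|].
  have e20 : 0 < e / 2 by rewrite divr_gt0.
  have [d d0 Hd] := cf x Kx _ e20.
  have d20 : 0 < d / 2 by rewrite divr_gt0.
  exists ([set x' | enorm (x' - x) < d / 2], [set i | i < d / 2]).
    split; first by apply/nbhs_enormP; exists (d / 2).
    exact: nbhs_right_lt.
  move=> [x' i] [/= xx' id] y yx'.
  have := Hd x'; have := Hd y; have := ler_enormB y x' x.
  move=> H1 H2 H3.
  have {}H2 : `|f y - f x| < e / 2 by apply: H2; lra.
  have {}H3 : `|f x' - f x| < e / 2 by apply: H3; lra.
  by move: H2 H3; rewrite !ltr_norml => /andP[? ?] /andP[? ?]; apply/andP; lra.
move=> d /= d0 H; exists (d / 2); first by rewrite divr_gt0.
move=> x y Kx; apply: (H (d / 2)); rewrite //= ?sub0r ?normrN ?divr_gt0 //.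
by rewrite gtr0_norm ?divr_gt0 //; lra.
Qed.

Lemma closed_superlevel n (D : set 'rV[R[i]]_n) (f : 'rV[R[i]]_n -> R) s :
  closed D -> (forall x, D x -> econt f x) -> closed (D `&` [set x | s <= f x]).
Proof.
move=> /closed_enormP cD cf; apply/closed_enormP => x H.
have Dx : D x by apply: cD => e e0; have [y [Dy _] yx] := H e e0; exists y.
split => //=; rewrite leNgt; apply/negP => fs.
have [|d d0 Hd] := cf x Dx (s - f x); first by rewrite subr_gt0.
by have [y [_ /= sy] /Hd] := H d d0; rewrite ltr_norml => /andP[]; lra.
Qed.

End Topology.

(** * Means over circles *)

Section Mean.
Variable R : realType.
Implicit Types (f g : R -> R).
Notation mu := (@lebesgue_measure R).

Definition rmean g : R := (2 * pi)^-1 * \int[mu]_(t in `[0, 2 * pi]) g t.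

Let pi2 : (0 : R) < 2 * pi.
Proof. by rewrite mulr_gt0 // pi_gt0. Qed.

Lemma integrable_itv g (i : interval R) (a b : R) : continuous g -> [set` i] `<=` `[a, b] ->
  mu.-integrable [set` i] (EFin \o g).
Proof.
move=> cg iab; have itg : mu.-integrable `[a, b] (EFin \o g).
  apply: continuous_compact_integrable; first exact: segment_compact.
  exact: continuous_subspaceT.
by apply: integrableS itg.
Qed.

Let itg g : continuous g -> mu.-integrable `[0, 2 * pi] (EFin \o g).
Proof. by move=> cg; apply: (@integrable_itv _ _ 0 (2 * pi)). Qed.

(** For continuous functions the extended integral is finite, so the submean value
inequality becomes an inequality between real integrals. *)
Lemma circle_meanE (v : R[i] -> R) c r :
  continuous (fun t => v (c + (r * cos t +i* (r * sin t)))) ->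
  circle_mean (fun z => (v z)%:E) c r =
  (rmean (fun t => v (c + (r * cos t +i* (r * sin t)))))%:E.
Proof.
move=> cv; rewrite /circle_mean /rmean EFinM; congr (_ * _)%E.
have := itg cv => H; rewrite /Rintegral fineK //; exact: (integrable_fin_num _ H).
Qed.

Lemma rmeanD f g : continuous f -> continuous g ->
  rmean (fun t => f t + g t) = rmean f + rmean g.
Proof.
move=> cf cg; rewrite /rmean RintegralD; first by rewrite mulrDr.
- exact: measurable_itv.
- exact: itg.
- exact: itg.
Qed.

Lemma rmeanZ a f : continuous f -> rmean (fun t => a * f t) = a * rmean f.
Proof.
move=> cf; rewrite /rmean RintegralZl; first by rewrite mulrCA.
- exact: measurable_itv.
- exact: itg.
Qed.

Lemma rmean_cst a : rmean (fun=> a) = a.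
Proof.
rewrite /rmean Rintegral_cst //= lebesgue_measure_itv /= lte_fin pi2 /=.
by rewrite subr0 mulrCA mulVf ?mulr1 // gt_eqF.
Qed.

(** These four functions span the restrictions to a circle about 0 of the real parts
of complex polynomials of degree 2 without constant term. *)
Lemma rmean_trig a b c d :
  rmean (fun t => a * cos t + b * sin t + c * (cos t * cos t - sin t * sin t)
    + d * (cos t * sin t)) = 0.
Proof.
set f := fun t => _.
pose F t : R := a * sin t - b * cos t + c * (sin t * cos t) + d / 2 * (sin t * sin t).
have dF (t : R) : is_derive t (1 : R) F (f t).
  apply: is_derive_eq; rewrite /f /GRing.scale /=; lra.
have cf : continuous f.
  move=> t; apply: cvgD; first apply: cvgD; first apply: cvgD.
  - by apply: cvgM; [exact: cvg_cst|exact: continuous_cos].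
  - by apply: cvgM; [exact: cvg_cst|exact: continuous_sin].
  - apply: cvgM; first exact: cvg_cst.
    by apply: cvgB; apply: cvgM; (exact: continuous_cos || exact: continuous_sin).
  - by apply: cvgM; [exact: cvg_cst|apply: cvgM;[exact: continuous_cos|exact: continuous_sin]].
have cF : continuous F.
  by move=> t; apply: differentiable_continuous; apply/derivable1_diffP; apply: ex_derive.
rewrite /rmean /Rintegral (@continuous_FTC2 _ f F) //.
- rewrite /F (_ : 2 * pi = pi *+ 2) ?mulr_natl // cos2pi sin2pi cos0 sin0 /=; lra.
- exact: continuous_subspaceT.
- by split => [t _||]; [exact: ex_derive|apply: cvg_at_right_filter; exact: cF|apply: cvg_at_left_filter; exact: cF].
- by move=> t _; rewrite derive1E derive_val.
Qed.

(** A left Riemann sum with oscillation at most [e] on each of the [N] intervals. *)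
Lemma rmean_le_sum g N e : continuous g -> (0 < N)%N ->
  (forall j t, (j < N)%N -> j%:R * (2 * pi / N%:R) <= t <= j.+1%:R * (2 * pi / N%:R) ->
     g t <= g (j%:R * (2 * pi / N%:R)) + e) ->
  rmean g <= N%:R^-1 * \sum_(j < N) g (j%:R * (2 * pi / N%:R)) + e.
Proof.
move=> cg N0; have N0' : (0 : R) < N%:R by rewrite ltr0n.
set h := 2 * pi / N%:R => H.
have h0 : 0 < h by rewrite divr_gt0.
have Ik k : (k <= N)%N -> \int[mu]_(t in `[0, k%:R * h]) g t <=
   \sum_(j < k) (g (j%:R * h) + e) * h.
  elim: k => [_|k IH kN].
    by rewrite mul0r set_itv1 Rintegral_set1 big_ord0.
  rewrite big_ord_recr /=; have {}IH := IH (ltnW kN).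
  have kh : k%:R * h <= k.+1%:R * h by rewrite ler_pM2r // ler_nat.
  have kh0 : 0 <= k%:R * h by rewrite mulr_ge0 // ltW.
  have := @Rintegral_itvB _ g (BLeft 0) (BRight (k.+1%:R * h)) (k%:R * h).
  rewrite !bnd_simp => /(_ _ kh0 kh) E.
  have {}E := E (@integrable_itv g _ 0 (k.+1%:R * h) cg (@subset_refl _ _)).
  suff: \int[mu]_(t in `]k%:R * h, k.+1%:R * h]) g t <= (g (k%:R * h) + e) * h.
    by rewrite -E; lra.
  have -> : (g (k%:R * h) + e) * h =
     \int[mu]_(t in `]k%:R * h, k.+1%:R * h]) (g (k%:R * h) + e).
    rewrite Rintegral_cst //= lebesgue_measure_itv /= lte_fin ltr_pM2r // ltr_nat ltnSn /=.
    by rewrite -mulrBl -natr1 addrAC subrr add0r mul1r.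
  apply: le_Rintegral => //.
  - by apply: (@integrable_itv _ _ (k%:R * h) (k.+1%:R * h)) => //; exact: subset_itv_oc_cc.
  - apply: (@integrable_itv _ _ (k%:R * h) (k.+1%:R * h)); last by exact: subset_itv_oc_cc.
    by move=> ?; exact: cvg_cst.
  - by move=> t /=; rewrite in_itv /= => /andP[/ltW ? ?]; apply: H => //; apply/andP.
have Nh : N%:R * h = 2 * pi by rewrite /h; field; rewrite gt_eqF.
have := Ik N (leqnn _); rewrite Nh => {}Ik.
rewrite /rmean.
have -> : N%:R^-1 * (\sum_(j < N) g (j%:R * h)) + e =
  (2 * pi)^-1 * (\sum_(j < N) (g (j%:R * h) + e) * h).
  rewrite -mulr_suml big_split /= sumr_const card_ord -(mulr_natl e).
  have n0 : N%:R != 0 :> R by rewrite gt_eqF.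
  rewrite /h; move: (2 * pi) (lt0r_neq0 pi2) => P P0; field; by apply/andP.
by rewrite ler_pM2l // invr_gt0.
Qed.

End Mean.

(** * Continuous plurisubharmonic and pluriharmonic functions *)

Section Psh.
Variable R : realType.

Definition circ (r t : R) : R[i] := r * cos t +i* (r * sin t).

Lemma normc_circ r t : 0 <= r -> `|circ r t| = r%:C.
Proof.
move=> r0; rewrite normc_def /=; congr _%:C.
by rewrite !exprMn -mulrDr cos2Dsin2 mulr1 sqrtr_sqr ger0_norm.
Qed.

Lemma normc_ge0 (z : R[i]) : 0 <= ComplexField.Normc.normc z.
Proof. by case: z => a b; exact: sqrtr_ge0. Qed.

Lemma enormZ n (z : R[i]) (x : 'rV[R[i]]_n) :
  enorm (z *: x) = ComplexField.Normc.normc z * enorm x.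
Proof.
apply/eqP; rewrite -(@eqrXn2 _ 2) ?mulr_ge0 ?enorm_ge0 ?normc_ge0 //.
rewrite sqr_enormZ exprMn; move: (enorm x ^+ 2) => e; case: z => a b /=.
by rewrite sqr_sqrtr // addr_ge0 ?sqr_ge0.
Qed.

Lemma enorm_circ n r t (b : 'rV[R[i]]_n) : 0 <= r ->
  enorm (circ r t *: b) = r * enorm b.
Proof.
move=> r0; apply/eqP; rewrite -(@eqrXn2 _ 2) ?mulr_ge0 ?enorm_ge0 //.
by rewrite sqr_enormZ /= !exprMn -mulrDr cos2Dsin2 mulr1.
Qed.

Lemma circ_continuous n (h : 'rV[R[i]]_n -> R) a b c r :
  (forall t, econt h (a + (c + circ r t) *: b)) ->
  continuous (fun t : R => h (a + (c + circ r t) *: b)).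
Proof.
move=> ch t; pose w (t : R) := a + (c + circ r t) *: b.
suff cw : w s @[s --> t] --> w t.
  by apply: (@continuous_comp _ _ _ w h t) => //; apply/econtP/ch.
move=> A /nbhs_enormP [e e0 HA].
pose K := 2 * (`|r| * enorm b) + 1.
have K0 : 0 < K by rewrite ltr_wpDl ?mulr_ge0 ?enorm_ge0.
have d0 : 0 < e / K by rewrite divr_gt0.
have nc : \forall s \near t, `|cos t - cos s| < e / K.
  by have := @continuous_cos R t; move/cvgrPdist_lt => /(_ _ d0).
have ns : \forall s \near t, `|sin t - sin s| < e / K.
  by have := @continuous_sin R t; move/cvgrPdist_lt => /(_ _ d0).
suff : \forall s \near t, A (w s) by [].
near=> s; apply: HA; rewrite /w opprD addrACA subrr add0r -scalerBl.
have Hc : `|cos t - cos s| < e / K by near: s.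
have Hs : `|sin t - sin s| < e / K by near: s.
rewrite opprD addrACA subrr add0r.
have -> : circ r s - circ r t = (r * (cos s - cos t)) +i* (r * (sin s - sin t)).
  by apply/eqP; rewrite eq_complex /= !mulrBr !eqxx.
rewrite complexZE /=; apply: (le_lt_trans (ler_enormD _ _)).
rewrite !enorm_realZ enorm_iZ !normrM (distrC (cos s)) (distrC (sin s)).
have B0 : 0 <= `|r| * enorm b by rewrite mulr_ge0 ?enorm_ge0.
apply: (@le_lt_trans _ _ (2 * (`|r| * enorm b) * (e / K))).
  have := ler_wpM2l B0 (ltW Hc); have := ler_wpM2l B0 (ltW Hs); lra.
rewrite (mulrA _ e) ltr_pdivrMr // (mulrC _ e) ltr_pM2l // /K; lra.
Unshelve. all: by end_near. Qed.

(** For continuous functions, plurisubharmonicity is the submean value inequality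
on discs in complex lines. *)
Lemma pshP n (V : set 'rV[R[i]]_n) (h : 'rV[R[i]]_n -> R) : open V ->
  (forall x, V x -> econt h x) ->
  plurisubharmonic V (fun z => (h z)%:E) <->
  forall a b c r, 0 < r -> (forall z : R[i], `|z - c| <= r%:C -> V (a + z *: b)) ->
    h (a + c *: b) <= rmean (fun t => h (a + (c + circ r t) *: b)).
Proof.
move=> oV ch.
have cc a b c r : 0 < r -> (forall z : R[i], `|z - c| <= r%:C -> V (a + z *: b)) ->
   continuous (fun t => h (a + (c + circ r t) *: b)).
  move=> r0 dV; apply: circ_continuous => t; apply: ch; apply: dV.
  by rewrite addrAC subrr add0r normc_circ // ltW.
split.
  move=> [_ H] a b c r r0 dV; have [_ /(_ c r r0 dV)] := H a b.
  by rewrite (circle_meanE (v := fun z => h (a + z *: b))) ?lee_fin //; apply: cc.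
move=> H; split.
  move=> x Vx; rewrite ltry; split => // e; rewrite lte_fin => hx.
  apply: cvg_within; have [|d d0 Hd] := ch x Vx (e - h x); first by rewrite subr_gt0.
  by apply/nbhs_enormP; exists d => // y /Hd; rewrite lte_fin => /ltr_normlW; lra.
move=> a b; split.
  move=> x /= Vx; rewrite ltry; split => // e; rewrite lte_fin => hx.
  apply: cvg_within; have [|d d0 Hd] := ch _ Vx (e - h (a + x *: b)); first by rewrite subr_gt0.
  have K0 : 0 < enorm b + 1 by rewrite ltr_wpDl ?enorm_ge0.
  apply/nbhs_normcP; exists (d / (enorm b + 1)); first by rewrite divr_gt0.
  move=> y; rewrite ltr_pdivlMr // => yx; rewrite lte_fin.
  suff /Hd /ltr_normlW : enorm ((a + y *: b) - (a + x *: b)) < d by lra.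
  rewrite opprD addrACA subrr add0r -scalerBl.
  rewrite enormZ; apply: le_lt_trans yx; rewrite ler_wpM2l ?lerDl //.
  exact: normc_ge0.
move=> c r r0 dV; rewrite (circle_meanE (v := fun z => h (a + z *: b))).
  by rewrite lee_fin; apply: H.
exact: cc.
Qed.

Lemma psh_comp n m (V : set 'rV[R[i]]_n) (h : 'rV[R[i]]_n -> R) (a0 : 'rV[R[i]]_n)
  (M : 'M[R[i]]_(m, n)) :
  open V -> (forall x, V x -> econt h x) ->
  open [set y | V (a0 + y *m M)] ->
  (forall y, V (a0 + y *m M) -> econt (fun y => h (a0 + y *m M)) y) ->
  plurisubharmonic V (fun z => (h z)%:E) ->
  plurisubharmonic [set y | V (a0 + y *m M)] (fun y => (h (a0 + y *m M))%:E).
Proof.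
move=> oV ch oV' ch' /pshP - /(_ oV ch) H; apply/pshP => // a b c r r0 dV.
have E z : a0 + (a + z *: b) *m M = (a0 + a *m M) + z *: (b *m M).
  by rewrite mulmxDl addrA scalemxAl.
have -> : (fun t => h (a0 + (a + (c + circ r t) *: b) *m M)) =
   (fun t => h ((a0 + a *m M) + (c + circ r t) *: (b *m M))).
  by apply/funext => t; rewrite E.
by rewrite E; apply: H => // z /dV /=; rewrite E.
Qed.

Lemma econtD n (f g : 'rV[R[i]]_n -> R) x : econt f x -> econt g x ->
  econt (fun y => f y + g y) x.
Proof.
move=> /(econtP f x).2 cf /(econtP g x).2 cg; apply/(econtP (fun y => f y + g y) x).1.
exact: (@cvgD _ _ _ _ _ f g _ _ cf cg).
Qed.

Lemma econtM n (f g : 'rV[R[i]]_n -> R) x : econt f x -> econt g x ->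
  econt (fun y => f y * g y) x.
Proof.
move=> /(econtP f x).2 cf /(econtP g x).2 cg; apply/(econtP (fun y => f y * g y) x).1.
exact: (@cvgM _ _ _ _ f g _ _ cf cg).
Qed.

Lemma econt_cst n k (x : 'rV[R[i]]_n) : econt (fun=> k) x.
Proof. by move=> e e0; exists 1 => // y _; rewrite subrr normr0. Qed.

Lemma econtZ n k (f : 'rV[R[i]]_n -> R) x : econt f x ->
  econt (fun y => k * f y) x.
Proof. by move=> cf; apply: econtM => //; exact: econt_cst. Qed.

Lemma econt_rdot n (b : 'rV[R[i]]_n) x : econt (fun y => rdot y b) x.
Proof.
move=> e e0; have K0 : 0 < enorm b + 1 by rewrite ltr_wpDl ?enorm_ge0.
exists (e / (enorm b + 1)); first by rewrite divr_gt0.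
move=> y; rewrite ltr_pdivlMr // -rdotBl => H.
apply: le_lt_trans (rdot_CS _ _) _; apply: le_lt_trans H.
by rewrite ler_wpM2l ?enorm_ge0 // lerDl.
Qed.

Lemma econt_enorm n (a x : 'rV[R[i]]_n) : econt (fun y => enorm (y - a)) x.
Proof.
move=> e e0; exists e => // y H; apply: le_lt_trans H.
have := ler_enormB x y a; have := ler_enormB y x a.
by rewrite (enorm_distC x y) ler_norml => ? ?; apply/andP; lra.
Qed.

Lemma econt_comp n m (f : 'rV[R[i]]_m -> R) (p : 'rV[R[i]]_n -> 'rV[R[i]]_m) x K :
  (forall y, enorm (p y - p x) <= K * enorm (y - x)) -> econt f (p x) ->
  econt (fun y => f (p y)) x.
Proof.
move=> HK cf e e0; have [d d0 Hd] := cf e e0.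
have K0 : 0 < `|K| + 1 by rewrite ltr_wpDl.
exists (d / (`|K| + 1)); first by rewrite divr_gt0.
move=> y; rewrite ltr_pdivlMr // => H; apply: Hd.
apply: le_lt_trans (HK y) _; apply: le_lt_trans H.
have := enorm_ge0 (y - x); have := ler_norm K; nra.
Qed.

Lemma pshZ n (V : set 'rV[R[i]]_n) (h : 'rV[R[i]]_n -> R) k : 0 <= k -> open V ->
  (forall x, V x -> econt h x) ->
  plurisubharmonic V (fun z => (h z)%:E) ->
  plurisubharmonic V (fun z => (k * h z)%:E).
Proof.
move=> k0 oV ch /pshP - /(_ oV ch) H; apply/pshP => //.
  by move=> x Vx; apply: econtZ; apply: ch.
move=> a b c r r0 dV; rewrite rmeanZ ?ler_wpM2l //; first exact: H.
apply: circ_continuous => t; apply: ch; apply: dV.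
by rewrite addrAC subrr add0r normc_circ // ltW.
Qed.

(** A function that is the real part of a complex polynomial of degree 2 on every
complex line. Pluriharmonic polynomials of degree 2 are of this kind, and the
mean value property can be read off at once. *)
Definition plh n (p : 'rV[R[i]]_n -> R) := forall a b, exists (k : R) (u v : R[i]),
  forall z : R[i], p (a + z *: b) = k + complex.Re (u * z) + complex.Re (v * (z * z)).

Lemma plhD n (p q : 'rV[R[i]]_n -> R) : plh p -> plh q -> plh (fun x => p x + q x).
Proof.
move=> Hp Hq a b; have [k [u [v E]]] := Hp a b; have [k' [u' [v' E']]] := Hq a b.
by exists (k + k'), (u + u'), (v + v') => z; rewrite E E' !mulrDl !cReD; ring.
Qed.

Lemma plhZ n s (p : 'rV[R[i]]_n -> R) : plh p -> plh (fun x => s * p x).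
Proof.
move=> Hp a b; have [k [u [v E]]] := Hp a b.
by exists (s * k), (s%:C * u), (s%:C * v) => z; rewrite E -!mulrA !(cReM s%:C) /=; ring.
Qed.

Lemma plh_comp n m (p : 'rV[R[i]]_n -> R) (a0 : 'rV[R[i]]_n) (M : 'M[R[i]]_(m, n)) :
  plh p -> plh (fun y => p (a0 + y *m M)).
Proof.
move=> Hp a b; have [k [u [v E]]] := Hp (a0 + a *m M) (b *m M).
by exists k, u, v => z; rewrite mulmxDl addrA -scalemxAl E.
Qed.

Lemma plh_rdot n (b : 'rV[R[i]]_n) : plh (fun y => rdot y b).
Proof.
move=> x y; exists (rdot x b), (rdot y b +i* - rdot ('i *: y) b), 0 => z.
rewrite mul0r /= addr0 rdotDl; congr (_ + _).
by rewrite complexZE rdotDl !rdot_realZl cReM /=; ring.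
Qed.

(** After translation to the centre of the circle, the polynomial is a constant
plus a combination of trigonometric functions of mean zero. *)
Lemma plh_mean n (p : 'rV[R[i]]_n -> R) a b c r : plh p ->
  rmean (fun t => p (a + (c + circ r t) *: b)) = p (a + c *: b).
Proof.
move=> /(_ a b) [k [u [v E]]].
pose C0 := p (a + c *: b).
pose u' := u + v * c + v * c.
have -> : (fun t => p (a + (c + circ r t) *: b)) = (fun t => C0 +
  ((r * complex.Re u') * cos t + (- r * complex.Im u') * sin t +
   (r ^+ 2 * complex.Re v) * (cos t * cos t - sin t * sin t) +
   (- 2 * r ^+ 2 * complex.Im v) * (cos t * sin t))).
  apply/funext => t; rewrite /C0 !E /u' !(cReM, cReD, cImD, cImM) /=; ring.
rewrite rmeanD ?rmean_trig ?rmean_cst ?addr0 //; first by move=> ?; exact: cvg_cst.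
move=> t; apply: cvgD; first apply: cvgD; first apply: cvgD.
- by apply: cvgM; [exact: cvg_cst|exact: continuous_cos].
- by apply: cvgM; [exact: cvg_cst|exact: continuous_sin].
- apply: cvgM; first exact: cvg_cst.
  by apply: cvgB; apply: cvgM; (exact: continuous_cos || exact: continuous_sin).
- by apply: cvgM; [exact: cvg_cst|apply: cvgM;[exact: continuous_cos|exact: continuous_sin]].
Qed.

(** Adding a pluriharmonic quadratic polynomial to a test function is how second
order information is turned against the maximum principle. *)
Lemma psh_addplh n (V : set 'rV[R[i]]_n) (h p : 'rV[R[i]]_n -> R) : open V ->
  (forall x, V x -> econt h x) -> (forall x, econt p x) -> plh p ->
  plurisubharmonic V (fun z => (h z)%:E) ->
  plurisubharmonic V (fun z => (h z + p z)%:E).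
Proof.
move=> oV ch cp Hp /pshP - /(_ oV ch) H; apply/pshP => //.
  by move=> x Vx; apply: econtD => //; apply: ch.
move=> a b c r r0 dV; rewrite rmeanD.
- by rewrite (plh_mean _ _ _ _ Hp) lerD2r; apply: H.
- apply: circ_continuous => t; apply: ch; apply: dV.
  by rewrite addrAC subrr add0r normc_circ // ltW.
- by apply: circ_continuous => t; apply: cp.
Qed.

Lemma plh_psh n (V : set 'rV[R[i]]_n) (p : 'rV[R[i]]_n -> R) : open V ->
  (forall x, econt p x) -> plh p -> plurisubharmonic V (fun z => (p z)%:E).
Proof.
move=> oV cp Hp; apply/pshP => // a b c r r0 dV.
by rewrite plh_mean.
Qed.

End Psh.

(** * Distance to a closed set *)

Section Dist.
Variables (R : realType) (n : nat) (X : set 'rV[R[i]]_n).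
Hypothesis X0 : X !=set0.

Let lbX z : has_lbound [set enorm (z - x) | x in X].
Proof. by exists 0 => _ [x _ <-]; exact: enorm_ge0. Qed.

Lemma eucl_dist_le x z : X x -> eucl_dist X z <= enorm (z - x).
Proof. by move=> Xx; apply: ge_inf => //; exists x. Qed.

Lemma eucl_dist_ge c z : (forall x, X x -> c <= enorm (z - x)) -> c <= eucl_dist X z.
Proof.
move=> H; apply: lb_le_inf; last by move=> _ [x Xx <-]; exact: H.
by case: X0 => x Xx; exists (enorm (z - x)), x.
Qed.

Lemma eucl_dist_ge0 z : 0 <= eucl_dist X z.
Proof. by apply: eucl_dist_ge => x _; exact: enorm_ge0. Qed.

Lemma eucl_dist_lip y z : eucl_dist X z <= eucl_dist X y + enorm (z - y).
Proof.
rewrite -lerBlDr; apply: eucl_dist_ge => x Xx; rewrite lerBlDr addrC.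
by apply: le_trans (eucl_dist_le z Xx) _; exact: ler_enormB.
Qed.

Lemma eucl_dist0 z : X z -> eucl_dist X z = 0.
Proof.
move=> Xz; apply/eqP; rewrite eq_le eucl_dist_ge0 andbT.
by have := eucl_dist_le z Xz; rewrite subrr enorm0.
Qed.

Lemma econt_eucl_dist z : econt (eucl_dist X) z.
Proof.
move=> e e0; exists e => // y H; apply: le_lt_trans H.
have := eucl_dist_lip y z; have := eucl_dist_lip z y.
by rewrite (enorm_distC z y) ler_norml => ? ?; apply/andP; lra.
Qed.

Hypothesis Xc : closed X.

Lemma eucl_dist_attained z : exists2 x, X x & eucl_dist X z = enorm (z - x).
Proof.
have [x0 Xx0] := X0.
have [||y _|x [Xx _] H] := @real_max R n (X `&` closed_eball z (enorm (x0 - z)))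
    (fun y => -1 * enorm (y - z)).
- rewrite setIC; apply: compact_closedI => //; exact: compact_closed_eball.
- by exists x0; split => //; rewrite /closed_eball /=.
- by apply: econtZ; exact: econt_enorm.
exists x => //; apply/eqP; rewrite eq_le eucl_dist_le //=.
apply: eucl_dist_ge => y Xy; have [yx0|x0y] := leP (enorm (y - z)) (enorm (x0 - z)).
  by have := H y (conj Xy yx0); rewrite !(enorm_distC z); lra.
have := H x0 (conj Xx0 (lexx _ : closed_eball z _ x0)).
by rewrite !(enorm_distC z); lra.
Qed.

Lemma eucl_dist_gt0 z : ~ X z -> 0 < eucl_dist X z.
Proof.
move=> nXz; have [x Xx ->] := eucl_dist_attained z; apply: enorm_gt0.
by rewrite subr_eq0; apply/eqP => zx; apply: nXz; rewrite zx.
Qed.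

End Dist.

(** * Upper semi-continuous functions *)

Section Usc.
Variable R : realType.

Lemma usc_on_slice n m (U : set 'rV[R[i]]_n) (u : 'rV[R[i]]_n -> \bar R) a (A : 'M[R[i]]_(m, n)) :
  A \is unitarymx -> usc_on U u ->
  usc_on [set z : 'rV[R[i]]_m | U (a + z *m A)] (fun z => u (a + z *m A)).
Proof.
move=> uA H x /= Ux; have [H1 H2] := H _ Ux; split => // b /H2.
move=> /nbhs_enormP [e e0 He]; apply/nbhs_enormP; exists e => // y yx /= Uy.
apply: He => //; rewrite opprD addrACA subrr add0r -mulmxBl.
by rewrite enorm_unitary.
Qed.

Lemma usc_on_comp n (f : R -> \bar R) (d : 'rV[R[i]]_n -> R) : usc_on setT f ->
  (forall x, econt d x) -> usc_on setT (fun z => f (d z)).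
Proof.
move=> H cd x _; have [H1 H2] := H (d x) I; split => // a /H2 fa.
have cx : {for x, continuous d} by apply/econtP/cd.
have Hn : nbhs x (d @^-1` (fun y => setT y -> (f y < a%:E)%E)) by exact: (cx _ fa).
by move/nbhs_enormP: Hn => [e e0 He]; apply/nbhs_enormP; exists e.
Qed.

Lemma usc_on_char n (X : set 'rV[R[i]]_n) : closed X -> usc_on setT (char_fun X).
Proof.
move=> cX x _; rewrite /char_fun; split; first by case: ifP.
move=> a; case: ifPn => [_ a0|/negP xX _].
  by apply/nbhs_enormP; exists 1 => // y _ _; case: ifP => // _; rewrite ltNyr.
have nx : ~ X x by move=> Xx; apply: xX; rewrite inE.
have /nbhs_enormP [e e0 He] := open_nbhs_nbhs (conj (closed_openC cX) nx).
apply/nbhs_enormP; exists e => // y /He nXy _; rewrite ifF ?ltNyr //.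
by apply/negP; rewrite inE.
Qed.

Lemma usc_on_addcont n (K V : set 'rV[R[i]]_n) (u : 'rV[R[i]]_n -> \bar R) (h : 'rV[R[i]]_n -> R) :
  K `<=` V -> usc_on V u -> (forall x, K x -> econt h x) -> usc_on K (fun z => (u z + (h z)%:E)%E).
Proof.
move=> KV H ch x Kx; have [H1 H2] := H x (KV _ Kx).
split; first by move: H1; case: (u x) => //= r; rewrite !ltry.
move=> a ua.
have [b ub ba] : exists2 b : R, (u x < b%:E)%E & b + h x < a.
  move: H1 ua; case: (u x) => [r _|//|_ _]; last first.
    by exists (a - h x - 1); rewrite ?ltNyr //; lra.
  rewrite -EFinD lte_fin => ra; exists ((r + (a - h x)) / 2); rewrite ?lte_fin; lra.
have [d d0 Hd] := ch x Kx (a - b - h x) (ltac:(lra)).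
have /nbhs_enormP[e e0 He] := H2 b ub.
apply/nbhs_enormP; exists (Num.min d e); first by rewrite lt_min d0 e0.
move=> y; rewrite lt_min => /andP[yd ye] Ky.
have {}Hd := ltr_normlW (Hd _ yd); have {}He := He _ ye (KV _ Ky).
move: He; case: (u y) => [r|//|_]; last by rewrite ltNyr.
by rewrite -EFinD !lte_fin; lra.
Qed.

Lemma usc_on_sub (T : topologicalType) (K V : set T) (u : T -> \bar R) : K `<=` V -> usc_on V u -> usc_on K u.
Proof.
move=> KV H x Kx; have [H1 H2] := H x (KV _ Kx); split => // a /H2.
by rewrite !near_withinE; apply: filterS => y Hy /KV.
Qed.

Lemma esphere_nonempty m (c : 'rV[R[i]]_m.+1) (r : R) : 0 <= r -> esphere c r !=set0.
Proof.
move=> r0; exists (c + r%:C *: delta_mx 0 0); rewrite /esphere /= addrAC subrr add0r.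
rewrite enorm_realZ ger0_norm // enormE (_ : rdot _ _ = 1) ?sqrtr1 ?mulr1 //.
rewrite /rdot (bigD1 0) //= big1 ?addr0 => [|j /negPf j0]; rewrite !mxE ?eqxx ?j0 //=.
  by rewrite mulr0 addr0 mulr1.
by rewrite !mulr0 addr0.
Qed.

Lemma esphere_sub m (c : 'rV[R[i]]_m) (r : R) : esphere c r `<=` closed_eball c r.
Proof. by move=> x; rewrite /esphere /closed_eball /= => ->. Qed.

End Usc.

(** * The maximum principle for X, the characteristic function and the distance *)

Section MaxProp.
Variable R : realType.

(** The maximum principle of [X] relative to its own points: what subpluriharmonicity
of the characteristic function of [X] says once the value -oo off [X] has been
eliminated. *)
Definition max_prop n q (X : set 'rV[R[i]]_n) :=
  forall (a : 'rV[R[i]]_n) (A : 'M[R[i]]_(q.+1, n)), A \is unitarymx ->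
  forall (c : 'rV[R[i]]_q.+1) (r : R), 0 < r ->
  forall (V : set 'rV[R[i]]_q.+1) (h : 'rV[R[i]]_q.+1 -> R), open V ->
    closed_eball c r `<=` V -> (forall x, V x -> econt h x) ->
    plurisubharmonic V (fun z => (h z)%:E) ->
  forall w, closed_eball c r w -> X (a + w *m A) ->
  exists z, [/\ esphere c r z, X (a + z *m A) & h w <= h z].

(** The sum of [char_fun X] and [h] is [h] on [X] and -oo elsewhere; a maximum over
the sphere exists by upper semi-continuity. *)
Lemma PSH_char_max_prop n q (X : set 'rV[R[i]]_n) : closed X -> (q < n)%N ->
  PSH q setT (char_fun X) <-> max_prop q X.
Proof.
move=> cX qn; split.
  move=> [_ /(_ qn) H] a A uA c r r0 V h oV BV ch pshh w Bw Xw.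
  have [_ [/(_ w I)|]] := H a A uA; first by rewrite /char_fun ifT // inE.
  move=> /(_ c r r0 (fun _ _ => I) V h oV BV ((within_econtP h oV).2 ch) pshh).
  move=> [z Sz /(_ w Bw)]; rewrite {1}/char_fun ifT ?inE // add0e => hz.
  exists z; move: hz; rewrite /char_fun; case: ifP => //.
  by rewrite inE add0e lee_fin.
move=> H; split; first exact: usc_on_char.
move=> _ a A uA; split.
  exact: (@usc_on_slice R n q.+1 setT _ a A uA (usc_on_char cX)).
right => c r r0 _ V h oV BV /(within_econtP h oV) ch pshh.
have uchi := @usc_on_slice R n q.+1 setT _ a A uA (usc_on_char cX).
have [|z Sz zmax] := @usc_max _ _ (esphere c r) (fun z => char_fun X (a + z *m A) + (h z)%:E)%E
   (@compact_esphere _ _ c r) (esphere_nonempty c (ltW r0)).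
  apply: (@usc_on_addcont _ _ _ setT (fun z => char_fun X (a + z *m A))) => //.
  by move=> x Sx; apply/ch/BV/esphere_sub.
exists z => // w Bw; rewrite {1}/char_fun; case: ifPn => [|_]; last by rewrite addNye leNye.
rewrite inE => Xw; have [z' [Sz' Xz' hw]] := H a A uA c r r0 V h oV BV ch pshh w Bw Xw.
apply: le_trans (zmax z' Sz'); rewrite /char_fun ifT ?inE // !add0e lee_fin //.
Qed.

Lemma ereal_neg_bound (t : \bar R) : (t < 0)%E ->
  exists2 dl : R, 0 < dl & (t <= (- dl)%:E)%E.
Proof.
case: t => [m|//|_]; last by exists 1 => //; rewrite leNye.
by rewrite lte_fin => m0; exists (- m); rewrite ?oppr_gt0 ?opprK.
Qed.

Section FDist.
Variables (n q : nat) (f : R -> \bar R) (X : set 'rV[R[i]]_n).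
Hypotheses (f_usc : usc_on setT f)
    (f_decr : forall s t : R, s <= t -> (f t <= f s)%E)
    (f0 : f 0 = 0%E)
    (f_neg : forall t : R, 0 < t -> (f t < 0)%E)
    (X0 : X !=set0) (Xc : closed X).

Let usc_fd : usc_on setT (fun z => f (eucl_dist X z)).
Proof. by apply: usc_on_comp => // x; apply: econt_eucl_dist. Qed.

(** The slice through [w] is moved by [v], from [w] to a nearest point of [X]. The
maximum principle on the moved slice yields a point [z'] of the sphere within
[|v| = dist w] of [X], where [f o dist] is at least its value at [w]. *)
Lemma max_prop_fdist : max_prop q X -> PSH q setT (fun z => f (eucl_dist X z)).
Proof.
move=> H; split=> // qn a A uA.
have uslice := @usc_on_slice R n q.+1 setT _ a A uA usc_fd.
split => //; right => c r r0 _ V h oV BV /(within_econtP h oV) ch pshh.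
have [|z Sz zmax] := @usc_max _ _ (esphere c r) (fun z => f (eucl_dist X (a + z *m A)) + (h z)%:E)%E
   (@compact_esphere _ _ c r) (esphere_nonempty c (ltW r0)).
  apply: (@usc_on_addcont _ _ _ setT (fun z => f (eucl_dist X (a + z *m A)))) => //.
  by move=> x Sx; apply/ch/BV/esphere_sub.
exists z => // w Bw.
have [x Xx dx] := eucl_dist_attained X0 Xc (a + w *m A).
pose v := x - (a + w *m A).
have [|z' [Sz' Xz' hw]] := H (a + v) A uA c r r0 V h oV BV ch pshh w Bw.
  by rewrite addrAC /v addrC subrK.
apply: le_trans (zmax z' Sz'); apply: leeD; last by rewrite lee_fin.
apply: f_decr; rewrite dx enorm_distC -/v.
apply: le_trans (eucl_dist_le _ Xz') _.
by rewrite (addrAC a v) opprD addrA subrr sub0r enormN.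
Qed.

(** If [h w <= h z] held at no point [z] of [X] on the sphere, then [f o dist] would
be at most [- dl < 0] on the compact set where it holds, and [k h] with [k] small
would make [f o dist + k h] larger at [w], where [f o dist] is 0, than on the
whole sphere. *)
Lemma fdist_max_prop : (q < n)%N -> PSH q setT (fun z => f (eucl_dist X z)) -> max_prop q X.
Proof.
move=> qn [_ /(_ qn) H] a A uA c r r0 V h oV BV ch pshh w Bw Xw.
have f_le0 x : (f (eucl_dist X x) <= 0)%E by rewrite -f0; apply: f_decr; exact: eucl_dist_ge0.
apply: contrapT => nE.
have {}nE z : esphere c r z -> h w <= h z -> ~ X (a + z *m A).
  by move=> Sz hwz Xz; apply: nE; exists z.
pose K := esphere c r `&` [set z | h w <= h z].
have cK : compact K.
  apply: (@subclosed_compact _ _ (esphere c r)); [|exact: compact_esphere|by move=> ? []].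
  by apply: closed_superlevel => [|x Sx]; [exact: closed_esphere|exact/ch/BV/esphere_sub].
have [dl dl0 Hdl] : exists2 dl : R, 0 < dl & forall z, K z -> (f (eucl_dist X (a + z *m A)) <= (- dl)%:E)%E.
  have [K0|] := pselect (K !=set0); last first.
    by move=> K0; exists 1 => // z Kz; case: K0; exists z.
  have [|z [Sz hz] zmax] := @usc_max _ _ K (fun z => f (eucl_dist X (a + z *m A))) cK K0.
    exact: (@usc_on_sub _ _ K setT _ _ (@usc_on_slice R n q.+1 setT _ a A uA usc_fd)).
  have [dl dl0 Hdl] := ereal_neg_bound (f_neg (eucl_dist_gt0 X0 Xc (nE z Sz hz))).
  exists dl; [exact: dl0|move=> z' Kz'; exact: (le_trans (zmax z' Kz') Hdl)].
have [|M' _ HM] := real_max (@compact_closed_eball R _ c r) (ex_intro _ w Bw) (f := h).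
  by move=> x /BV; exact: ch.
(* [M] bounds [h] on the ball, so that [k * (M - h w) < dl]. *)
pose M := h M'; pose k := dl / (M - h w + 1).
have Mw : h w <= M by exact: HM.
have k0 : 0 < k by rewrite divr_gt0 //; lra.
have [_ [/(_ w I)|]] := H a A uA.
  by rewrite eucl_dist0 // f0.
move=> /(_ c r r0 (fun _ _ => I) V (fun z => k * h z) oV BV).
case; first by apply/within_econtP => // x Vx; apply: econtZ; apply: ch.
  by apply: pshZ => //; exact: ltW.
move=> z Sz /(_ w Bw); rewrite eucl_dist0 // f0 add0e => Hz.
have hwz : h w <= h z.
  rewrite -(ler_pM2l k0) -lee_fin; apply: le_trans Hz _.
  by rewrite -[leRHS]add0e leeD2r.
have H1 : k * h w <= - dl + k * h z.
  rewrite -lee_fin EFinD; apply: le_trans Hz _.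
  by rewrite leeD2r //; exact: (Hdl z (conj Sz hwz)).
have hzM : h z <= M by apply: HM; exact: esphere_sub.
have : k * (M - h w + 1) = dl by rewrite /k divfK // gt_eqF //; lra.
nra.
Qed.

End FDist.
End MaxProp.

(** * Second order expansion of the logarithm *)

Section LogTaylor.
Variable R : realType.
Implicit Types x y a b : R.

(** Concavity of the logarithm. *)
Lemma lnB_le x y : 0 < x -> 0 < y -> ln y - ln x <= (y - x) / x.
Proof.
move=> x0 y0; rewrite -ln_div ?posrE // mulrBl divff ?gt_eqF //.
have := @le_ln1Dx R (y / x - 1); rewrite (addrC 1) subrK; apply.
by rewrite ltrBrDr addNr divr_gt0.
Qed.

(** The difference of the two sides vanishes at 0 and has derivative
[t^3 / (1 + t)], which has the sign of [t]. *)
Lemma ln_le_cubic x : -1 < x -> ln (1 + x) <= x - x ^+ 2 / 2 + x ^+ 3 / 3.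
Proof.
move=> x1.
pose F (t : R) : R := t - t ^+ 2 / 2 + t ^+ 3 / 3 - ln (1 + t).
have dF (t : R) : -1 < t -> is_derive t (1 : R) F (t ^+ 3 / (1 + t)).
  move=> t1; have t1' : 0 < 1 + t by lra.
  have dln : is_derive t (1 : R) (fun t : R => ln (1 + t)) ((1 + t)^-1).
    have := @is_derive1_comp R (@ln R) (fun t : R => 1 + t) t _ _ (is_derive1_ln t1') _.
    move=> /(_ 1); rewrite mulr1; apply.
    by apply: is_derive_eq; rewrite mulr1 add0r.
  apply: is_derive_eq; rewrite /GRing.scale /=; field; lra.
suff : 0 <= F x by rewrite /F; lra.
have F0 : F 0 = 0 by rewrite /F addr0 ln1 expr0n /= expr0n /=; lra.
have cF a b : -1 < a -> {within `[a, b], continuous F}.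
  move=> a1; apply: continuous_in_subspaceT => t; rewrite inE /= in_itv /= => /andP[ta _].
  apply: differentiable_continuous; apply/derivable1_diffP.
  by have /(_ (lt_le_trans a1 ta)) [] := dF t.
have [x0|x0|->] := ltgtP x 0; last by rewrite F0.
- have [t|t|t tx] := @MVT _ F (fun t => t ^+ 3 / (1 + t)) x 0 x0.
  + by rewrite in_itv /= => /andP[xt _]; apply: dF; apply: lt_trans xt.
  + exact: cF.
  rewrite F0 => E; have -> : F x = t ^+ 3 * x / (1 + t) by lra.
  move: tx; rewrite in_itv /= => /andP[? ?]; apply: divr_ge0; last lra.
  rewrite (_ : t ^+ 3 * x = t ^+ 2 * (t * x)); last by ring.
  by rewrite mulr_ge0 ?sqr_ge0 // mulr_le0 // ltW.
- have [t|t|t tx] := @MVT _ F (fun t => t ^+ 3 / (1 + t)) 0 x x0.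
  + by rewrite in_itv /= => /andP[xt _]; apply: dF; apply: lt_trans xt; lra.
  + by apply: cF; lra.
  rewrite F0 => E; have -> : F x = t ^+ 3 * x / (1 + t) by lra.
  move: tx; rewrite in_itv /= => /andP[? ?]; apply: divr_ge0; last lra.
  by rewrite mulr_ge0 ?exprn_ge0 ?ltW.
Qed.

(** The quadratic part of [ln |1 + (a + ib)|] is [- Re ((a + ib)^2) / 2]. *)
Lemma ln_norm_taylor (e : R) : 0 < e -> exists2 d : R, 0 < d & forall a b,
  a ^+ 2 + b ^+ 2 <= d ^+ 2 ->
  ln (Num.sqrt ((1 + a) ^+ 2 + b ^+ 2)) <= a - (a ^+ 2 - b ^+ 2) / 2 + e * (a ^+ 2 + b ^+ 2).
Proof.
move=> e0; pose d := Num.min (1 / 2) (e / 6).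
have d0 : 0 < d by rewrite lt_min; apply/andP; lra.
have d2 : d <= 1 / 2 by rewrite ge_min lexx.
have d6 : d <= e / 6 by rewrite ge_min lexx orbT.
exists d => // a b; set s := a ^+ 2 + b ^+ 2 => sd.
have s0 : 0 <= s by rewrite addr_ge0 ?sqr_ge0.
have as_ : a ^+ 2 <= s by rewrite lerDl sqr_ge0.
have ad : `|a| <= d.
  rewrite -(@ler_pXn2r _ 2) ?nnegrE ?(ltW d0) // -normrX ger0_norm ?sqr_ge0 //.
  exact: le_trans sd.
have {}ad : - d <= a <= d by rewrite -ler_norml.
have [ad1 ad2] : - d <= a /\ a <= d by apply/andP.
set x := 2 * a + s.
have xE : (1 + a) ^+ 2 + b ^+ 2 = 1 + x by rewrite /x /s; ring.
have x1 : -1 < x by rewrite /x; nra.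
have -> : ln (Num.sqrt ((1 + a) ^+ 2 + b ^+ 2)) = ln (1 + x) / 2.
  rewrite xE; have x10 : 0 < 1 + x by lra.
  rewrite -[in RHS](sqr_sqrtr (ltW x10)) lnXn ?sqrtr_gt0 //.
  by rewrite -mulr_natr; field.
have := ln_le_cubic x1.
have sd2 : s <= d by apply: le_trans sd _; rewrite expr2; nra.
have sds : s ^+ 2 <= d * s by rewrite expr2 ler_wpM2r.
have x2 : x ^+ 2 <= 9 * s.
  have : a * s <= s by rewrite -[leRHS]mul1r ler_wpM2r //; lra.
  by rewrite /x; nra.
have xd : x <= 3 * d by rewrite /x; lra.
have x3 : x ^+ 3 <= 27 * d * s.
  apply: (@le_trans _ _ (3 * d * x ^+ 2)).
    by rewrite exprS ler_wpM2r ?sqr_ge0.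
  have d30 : 0 <= 3 * d by lra.
  by have := ler_wpM2l d30 x2; lra.
have has : - (a * s) <= d * s by rewrite -mulNr ler_wpM2r //; lra.
have eq2 : x - x ^+ 2 / 2 = 2 * a - (a ^+ 2 - b ^+ 2) - 2 * (a * s) - s ^+ 2 / 2.
  by rewrite /x /s; field.
have es : 6 * d * s <= e * s by rewrite ler_wpM2r //; lra.
have := sqr_ge0 s; lra.
Qed.

End LogTaylor.

Section Coord.
Variable R : realType.

Lemma econt_Re n j (x : 'rV[R[i]]_n) : econt (fun y => complex.Re (y 0 j)) x.
Proof.
move=> e e0; exists e => // y H; apply: le_lt_trans H.
by have := norm_Re_le (y - x) j; rewrite !mxE cReD cReN.
Qed.

Lemma econt_Im n j (x : 'rV[R[i]]_n) : econt (fun y => complex.Im (y 0 j)) x.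
Proof.
move=> e e0; exists e => // y H; apply: le_lt_trans H.
by have := norm_Im_le (y - x) j; rewrite !mxE cImD cImN.
Qed.

Lemma econt_normc n j (x : 'rV[R[i]]_n) : econt (fun y => ComplexField.Normc.normc (y 0 j)) x.
Proof.
move=> e e0; exists e => // y H; apply: le_lt_trans H.
apply: le_trans (normc_le_enorm _ j); rewrite !mxE.
have t (u v : R[i]) : ComplexField.Normc.normc u <= ComplexField.Normc.normc (u - v) + ComplexField.Normc.normc v.
  by have := le_normcD (u - v) v; rewrite subrK.
have := t (y 0 j) (x 0 j); have := t (x 0 j) (y 0 j).
rewrite -(normcN (x 0 j - y 0 j)) opprB.
by rewrite ler_norml => ? ?; apply/andP; lra.
Qed.

Lemma econt_ln n (f : 'rV[R[i]]_n -> R) x : 0 < f x -> econt f x -> econt (fun y => ln (f y)) x.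
Proof.
move=> f0 /(econtP f x).2 cf; apply/(econtP (fun y => ln (f y)) x).1.
by apply: (@continuous_comp _ _ _ f (@ln R) x) => //; exact: continuous_ln.
Qed.

(** Second order Taylor polynomial of [ln |y_j|] at [y_j = k] without its constant
term: the real part of [s - s^2 / 2] with [s = (y_j - k) / k]. *)
Definition ln_taylor n (j : 'I_n) (k : R[i]) (y : 'rV[R[i]]_n) : R :=
  let s := (y 0 j - k) / k in complex.Re s - complex.Re (s * s) / 2.

Lemma plh_ln_taylor n (j : 'I_n) k : plh (ln_taylor j k).
Proof.
move=> a b; set s := (a 0 j - k) / k; set t := b 0 j / k.
exists (complex.Re s - complex.Re (s * s) / 2), (t - s * t), (- (2^-1)%:C * (t * t)) => z.
rewrite /ln_taylor !mxE; have -> : (a 0 j + z * b 0 j - k) / k = s + z * t.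
  by rewrite /s /t; ring.
by rewrite !(cReD, cReN, cReM, cImN, cImM, cImD) /=; field.
Qed.

Lemma econt_ln_taylor n (j : 'I_n) k x : econt (ln_taylor j k) x.
Proof.
have cRe : econt (fun y => complex.Re ((y 0 j - k) / k)) x.
  have -> : (fun y : 'rV[R[i]]_n => complex.Re ((y 0 j - k) / k)) =
    (fun y => complex.Re k^-1 * (complex.Re (y 0 j) + - complex.Re k) +
              (- complex.Im k^-1) * (complex.Im (y 0 j) + - complex.Im k)).
    by apply/funext => y; rewrite cReM cReD cReN cImD cImN; ring.
  by apply: econtD; apply: econtZ; apply: econtD; try exact: econt_cst;
    [exact: econt_Re|exact: econt_Im].
have cIm : econt (fun y => complex.Im ((y 0 j - k) / k)) x.
  have -> : (fun y : 'rV[R[i]]_n => complex.Im ((y 0 j - k) / k)) =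
    (fun y => complex.Im k^-1 * (complex.Re (y 0 j) + - complex.Re k) +
              (complex.Re k^-1) * (complex.Im (y 0 j) + - complex.Im k)).
    by apply/funext => y; rewrite cImM cReD cReN cImD cImN; ring.
  by apply: econtD; apply: econtZ; apply: econtD; try exact: econt_cst;
    [exact: econt_Re|exact: econt_Im].
have -> : ln_taylor j k = (fun y => complex.Re ((y 0 j - k) / k) + (- 2^-1) *
  (complex.Re ((y 0 j - k) / k) * complex.Re ((y 0 j - k) / k) +
   -1 * (complex.Im ((y 0 j - k) / k) * complex.Im ((y 0 j - k) / k)))).
  by apply/funext => y; rewrite /ln_taylor; move: (_ / k) => s; rewrite cReM; ring.
apply: econtD => //; apply: econtZ; apply: econtD; first exact: econtM.
by apply: econtZ; exact: econtM.
Qed.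

(** The error of the pluriharmonic polynomial is smaller than any given quadratic
term, which a strict maximum absorbs. *)
Lemma ln_normc_taylor n (j : 'I_n) (p : 'rV[R[i]]_n) (e : R) : p 0 j != 0 -> 0 < e ->
  exists2 d : R, 0 < d & forall y, enorm (y - p) <= d -> y 0 j != 0 /\
  ln (ComplexField.Normc.normc (y 0 j)) - ln (ComplexField.Normc.normc (p 0 j))
    <= ln_taylor j (p 0 j) y + e * enorm (y - p) ^+ 2.
Proof.
set k := p 0 j => k0 e0; pose N := ComplexField.Normc.normc k.
have N0 : 0 < N.
  rewrite lt_neqAle normc_ge0 andbT eq_sym; apply: contra k0 => /eqP.
  by move/ComplexField.Normc.eq0_normc => ->.
have [d0 d00 Hd0] := ln_norm_taylor (mulr_gt0 e0 (exprn_gt0 2 N0)).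
pose d := Num.min d0 (1 / 2).
have d_gt0 : 0 < d by rewrite lt_min d00; lra.
exists (d * N); first by rewrite mulr_gt0.
move=> y yp; set s := (y 0 j - k) / k.
have ns : ComplexField.Normc.normc s * N <= enorm (y - p).
  rewrite /N -ComplexField.Normc.normcM /s divfK //.
  by have := normc_le_enorm (y - p) j; rewrite !mxE.
have nsd : ComplexField.Normc.normc s <= d.
  by rewrite -(ler_pM2r N0); exact: le_trans ns yp.
have yE : y 0 j = k * (1 + s) by rewrite /s mulrDr mulr1 mulrCA mulfV // mulr1 addrC subrK.
have s2E : complex.Re s ^+ 2 + complex.Im s ^+ 2 = ComplexField.Normc.normc s ^+ 2.
  by case: (s) => u v /=; rewrite sqr_sqrtr // addr_ge0 ?sqr_ge0.
have sd : complex.Re s ^+ 2 + complex.Im s ^+ 2 <= d ^+ 2.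
  by rewrite s2E ler_pXn2r ?nnegrE ?normc_ge0 // ltW.
have n1s : ComplexField.Normc.normc (1 + s) = Num.sqrt ((1 + complex.Re s) ^+ 2 + complex.Im s ^+ 2).
  by case: (s) => u v /=; rewrite add0r.
have n1s0 : 0 < ComplexField.Normc.normc (1 + s).
  rewrite n1s sqrtr_gt0 ltr_wpDr ?sqr_ge0 // exprn_gt0 //.
  have : d <= 1 / 2 by rewrite ge_min lexx orbT.
  have := sqr_ge0 (complex.Im s); nra.
split.
  rewrite yE mulf_neq0 //; apply/eqP => s10; move: n1s0.
  by rewrite s10 ComplexField.Normc.normc0 ltxx.
rewrite yE ComplexField.Normc.normcM lnM ?posrE // addrAC subrr add0r n1s.
have sd0 : complex.Re s ^+ 2 + complex.Im s ^+ 2 <= d0 ^+ 2.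
  apply: le_trans sd _; rewrite ler_pXn2r ?nnegrE ?(ltW d_gt0) ?(ltW d00) //.
  by rewrite ge_min lexx.
apply: le_trans (Hd0 _ _ sd0) _; rewrite /ln_taylor -/k -/s; apply: lerD.
  by rewrite cReM !expr2.
rewrite s2E -mulrA ler_wpM2l ?(ltW e0) // -exprMn mulrC.
by rewrite ler_pXn2r ?nnegrE ?mulr_ge0 ?normc_ge0 ?enorm_ge0 // ltW.
Qed.

End Coord.

(** * From the maximum principle to pseudoconvexity *)

Section Hartogs.
Variable R : realType.
Notation normc := (@ComplexField.Normc.normc R).

Lemma mul_tr_row n (e : 'rV[R[i]]_n) : e *m e ^t* = ((enorm e ^+ 2)%:C)%:M.
Proof.
apply/matrixP => i j; rewrite !ord1 mxE sqr_enorm /rdot !mxE eqxx mulr1n.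
rewrite rmorph_sum /=; apply: eq_bigr => k _; rewrite !mxE.
case: (e 0 k) => u v /=; apply/eqP; rewrite eq_complex /=.
by apply/andP; split; apply/eqP; ring.
Qed.

Lemma col_mx_unitary n m (e : 'rV[R[i]]_n) (A : 'M[R[i]]_(m, n)) :
  A \is unitarymx -> e *m A ^t* = 0 -> enorm e = 1 -> col_mx e A \is unitarymx.
Proof.
move=> uA eA e1; apply/unitarymxP.
rewrite tr_col_mx map_row_mx mul_col_row mul_tr_row e1 expr1n eA.
have -> : A *m e ^t* = 0.
  by rewrite -[LHS]trmxCK trmx_mul map_mxM trmxCK eA trmx0 map_mx0.
by rewrite (elimT unitarymxP uA) [RHS]scalar_mx_block.
Qed.

Local Opaque eucl_dist enorm rdot.

Lemma unit_orthogonal n k (M : 'M[R[i]]_(k, n)) : (k < n)%N ->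
  exists e : 'rV[R[i]]_n, enorm e = 1 /\ e *m M ^t* = 0.
Proof.
move=> kn; have : kermx (M ^t*) != 0.
  rewrite -mxrank_eq0 mxrank_ker subn_eq0 -ltnNge.
  by apply: leq_ltn_trans (rank_leq_col _) kn.
move=> /rowV0Pn [u /sub_kermxP uM u0]; have nu := enorm_gt0 u0.
exists ((enorm u)^-1%:C *: u); split; last by rewrite -scalemxAl uM scaler0.
by rewrite enorm_realZ ger0_norm ?invr_ge0 ?enorm_ge0 // mulVf // gt_eqF.
Qed.

(** The component of [v] across the slice, as a nonnegative multiple of a unit
vector; when it vanishes any unit normal will do, which exists because the slice
is not the whole space. *)
Lemma unit_normal n m (A : 'M[R[i]]_(m, n)) (v : 'rV[R[i]]_n) :
  A \is unitarymx -> (m < n)%N ->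
  exists (e : 'rV[R[i]]_n) (mu : R), [/\ e *m A ^t* = 0, enorm e = 1, 0 <= mu &
    v = v *m A ^t* *m A + mu%:C *: e].
Proof.
move=> uA mn; pose u := v - v *m A ^t* *m A.
have uA0 : u *m A ^t* = 0 by rewrite mulmxBl mulmxtVK // subrr.
have [u0|u0] := eqVneq u 0; last first.
  have nu := enorm_gt0 u0.
  exists ((enorm u)^-1%:C *: u), (enorm u); split.
  - by rewrite -scalemxAl uA0 scaler0.
  - by rewrite enorm_realZ ger0_norm ?invr_ge0 ?enorm_ge0 // mulVf // gt_eqF.
  - exact: enorm_ge0.
  - by rewrite scalerA -rmorphM /= mulfV ?gt_eqF // scale1r /u addrC subrK.
have [e [e1 eA]] := unit_orthogonal A mn.
exists e, 0; split => //.
by rewrite scale0r addr0; apply/eqP; rewrite -subr_eq0 -/u u0.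
Qed.

Lemma closed_econt_le n (f : 'rV[R[i]]_n -> R) k : (forall x, econt f x) ->
  closed [set x | f x <= k].
Proof.
move=> cf; apply/closed_enormP => x H /=; rewrite leNgt; apply/negP => kf.
have [|d d0 Hd] := cf x (f x - k); first by rewrite subr_gt0.
by have [y /= yk /Hd] := H d d0; rewrite ltr_norml => /andP[]; lra.
Qed.

(** Applied to the isometric embedding of a slice. *)
Lemma closed_lip n m (X : set 'rV[R[i]]_n) (g : 'rV[R[i]]_m -> 'rV[R[i]]_n) K :
  closed X -> (forall x y, enorm (g y - g x) <= K * enorm (y - x)) ->
  closed [set y | X (g y)].
Proof.
move=> /closed_enormP cX Hg; apply/closed_enormP => x H /=; apply: cX => e e0.
have K0 : 0 < `|K| + 1 by rewrite ltr_wpDl.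
have [|y Xy yx] := H (e / (`|K| + 1)); first by rewrite divr_gt0.
exists (g y) => //; apply: le_lt_trans (Hg _ _) _.
move: yx; rewrite ltr_pdivlMr //; have := enorm_ge0 (y - x); have := ler_norm K; nra.
Qed.

Lemma slice_lip n m a (A : 'M[R[i]]_(m, n)) : A \is unitarymx -> forall x y,
  enorm ((a + y *m A) - (a + x *m A)) <= 1 * enorm (y - x).
Proof.
by move=> uA x y; rewrite opprD addrACA subrr add0r -mulmxBl enorm_unitary // mul1r.
Qed.

Lemma enorm_sqrD n (x y : 'rV[R[i]]_n) :
  enorm y ^+ 2 = enorm x ^+ 2 + 2 * rdot (y - x) x + enorm (y - x) ^+ 2.
Proof.
by rewrite !sqr_enorm !(rdotBl, rdotBr) (rdotC x y); ring.
Qed.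

Lemma mulmx_lip n m (M : 'M[R[i]]_(m, n)) : exists2 K : R, 0 < K &
  forall y, enorm (y *m M) <= K * enorm y.
Proof.
exists (\sum_(k < m) enorm (row k M) + 1); first by rewrite ltr_wpDl // sumr_ge0 // => k _; exact: enorm_ge0.
move=> y; rewrite mulmx_sum_row.
apply: (@le_trans _ _ (\sum_(k < m) enorm (row k M) * enorm y)); last first.
  by rewrite -mulr_suml ler_wpM2r ?enorm_ge0 // lerDl.
apply: (big_ind2 (fun (u : 'rV[R[i]]_n) t => enorm u <= t)).
- by rewrite enorm0.
- by move=> u t u' t' H H'; apply: le_trans (ler_enormD _ _) _; exact: lerD.
- by move=> k _; rewrite enormZ mulrC ler_wpM2l ?enorm_ge0 // normc_le_enorm.
Qed.

Lemma mulmx_distr_lip n m (M : 'M[R[i]]_(m, n)) : exists2 K : R, 0 < K &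
  forall x y, enorm (y *m M - x *m M) <= K * enorm (y - x).
Proof.
by have [K K0 HK] := mulmx_lip M; exists K => // x y; rewrite -mulmxBl.
Qed.

(** Let [z = y M] be linear coordinates and [y_j] a further one. The function
[h(z) - ln |y_j|] on [X] satisfies the maximum principle over the part of a
cylinder where [|y_j|] is small: after adding [ep |y|^2] to make a maximum point
[p] strict, [- ln |y_j|] may be replaced near [p] by a pluriharmonic polynomial
and [|y|^2] by its linear part at [p], up to an error below [ep |y - p|^2]; the
resulting test function contradicts the maximum principle on a small ball about
[p]. *)
Lemma log_coord_max n m (X : set 'rV[R[i]]_n) (b : 'rV[R[i]]_n)
    (A : 'M[R[i]]_(m.+1, n)) (M : 'M[R[i]]_(m.+1, m)) (j : 'I_m.+1)
    (c : 'rV[R[i]]_m) (r L L' Rb s : R)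
    (V : set 'rV[R[i]]_m) (h : 'rV[R[i]]_m -> R) :
  closed X -> max_prop m X -> A \is unitarymx ->
  open V -> closed_eball c r `<=` V -> (forall x, V x -> econt h x) ->
  plurisubharmonic V (fun z => (h z)%:E) ->
  L < L' ->
  (forall y, X (b + y *m A) -> closed_eball c r (y *m M) -> y 0 j != 0) ->
  (forall y, X (b + y *m A) -> closed_eball c r (y *m M) ->
     normc (y 0 j) <= L' -> enorm y <= Rb) ->
  (forall y, X (b + y *m A) -> esphere c r (y *m M) ->
     h (y *m M) - ln (normc (y 0 j)) <= s) ->
  (forall y, X (b + y *m A) -> closed_eball c r (y *m M) -> L <= normc (y 0 j) ->
     h (y *m M) - ln (normc (y 0 j)) <= s) ->
  forall y, X (b + y *m A) -> closed_eball c r (y *m M) -> normc (y 0 j) <= L' ->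
     h (y *m M) - ln (normc (y 0 j)) <= s.
Proof.
move=> Xc HX uA oV BV ch pshh LL' Hnz HRb C1 C2 yx Xyx Byx Lyx.
rewrite leNgt; apply/negP => gap.
have [KM KM0 zcL] := mulmx_distr_lip M.
have [zc zcM] : {zc : 'rV[R[i]]_m.+1 -> 'rV[R[i]]_m | forall y, y *m M = zc y}.
  by exists (fun y => y *m M).
have [lam lamE] : {lam : 'rV[R[i]]_m.+1 -> R | forall y : 'rV[R[i]]_m.+1, normc (y 0 j) = lam y}.
  by exists (fun y : 'rV[R[i]]_m.+1 => normc (y 0 j)).
have [Phi PhiE] : {Phi | forall y, h (zc y) - ln (lam y) = Phi y}.
  by exists (fun y => h (zc y) - ln (lam y)).
have [Y YE] : {Y : 'rV[R[i]]_m.+1 -> Prop | forall y, X (b + y *m A) = Y y} by exists (fun y : 'rV[R[i]]_m.+1 => X (b + y *m A)).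
have cY : closed [set y | Y y].
  have := closed_lip Xc (slice_lip b uA).
  by rewrite (_ : [set y | X (b + y *m A)] = [set y | Y y]) //; apply/seteqP; split => y /=; rewrite YE.
rewrite zcM lamE PhiE in gap; rewrite YE in Xyx; rewrite zcM in Byx; rewrite lamE in Lyx.
have {}C1 y : Y y -> enorm (zc y - c) = r -> Phi y <= s.
  by have := C1 y; rewrite YE zcM lamE PhiE.
have {}C2 y : Y y -> enorm (zc y - c) <= r -> L <= lam y -> Phi y <= s.
  by have := C2 y; rewrite YE zcM lamE PhiE.
have {}HRb y : Y y -> enorm (zc y - c) <= r -> lam y <= L' -> enorm y <= Rb.
  by have := HRb y; rewrite YE zcM lamE.
have {}Hnz y : Y y -> enorm (zc y - c) <= r -> y 0 j != 0.
  by have := Hnz y; rewrite YE zcM.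
have lam_gt0 y : Y y -> enorm (zc y - c) <= r -> 0 < lam y.
  move=> Yy By; rewrite -lamE lt_neqAle normc_ge0 andbT eq_sym.
  by apply: contra (Hnz y Yy By) => /eqP /ComplexField.Normc.eq0_normc ->.
have {}zcL y y' : enorm (zc y' - zc y) <= KM * enorm (y' - y) by rewrite -!zcM.
have cz y : econt (fun y : 'rV[R[i]]_m.+1 => enorm (zc y - c)) y.
  by apply: (@econt_comp _ _ _ (fun z => enorm (z - c)) zc y KM) => //; exact: econt_enorm.
have clam y : econt lam y.
  have -> : lam = (fun y : 'rV[R[i]]_m.+1 => normc (y 0 j)) by apply/funext => y0; rewrite lamE.
  exact: econt_normc.
pose K := [set y | Y y] `&` ([set y | enorm (zc y - c) <= r] `&` [set y | lam y <= L']).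
have KB y : K y -> enorm y <= Rb by move=> [? [? ?]]; exact: HRb.
have cK : compact K.
  apply: (@subclosed_compact _ _ (closed_eball 0 Rb)); last 2 first.
  - exact: compact_closed_eball.
  - by move=> y /KB; rewrite /closed_eball /= subr0.
  by apply: closedI => //; apply: closedI; exact: closed_econt_le.
have Kyx : K yx by split.
have chz y : V (zc y) -> econt (fun y => h (zc y)) y.
  by move=> Vy; apply: (@econt_comp _ _ _ h zc y KM); [|exact: ch].
have Rb1 : 0 < Rb ^+ 2 + 1 by rewrite ltr_wpDl ?sqr_ge0.
pose ep := (Phi yx - s) / (2 * (Rb ^+ 2 + 1)).
have ep0 : 0 < ep by rewrite divr_gt0 ?subr_gt0 // mulr_gt0.
have epR : ep * Rb ^+ 2 < Phi yx - s.
  rewrite /ep mulrAC ltr_pdivrMr ?mulr_gt0 // ltr_pM2l ?subr_gt0 //.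
  by move: Rb1; clear; lra.
have [G GE] : {G | forall y, Phi y + ep * enorm y ^+ 2 = G y}.
  by exists (fun y => Phi y + ep * enorm y ^+ 2).
have cG y : K y -> econt G y.
  move=> [Yy [By _]].
  have -> : G = (fun y => (h (zc y) + -1 * ln (lam y)) + ep * (enorm (y - 0) * enorm (y - 0))).
    by apply/funext => y0; rewrite -GE -PhiE mulN1r subr0 expr2.
  apply: econtD; first apply: econtD.
  - exact/chz/BV.
  - by apply: econtZ; apply: econt_ln => //; exact: lam_gt0.
  - by apply: econtZ; apply: econtM; exact: econt_enorm.
have [p Kp Hp] := real_max cK (ex_intro _ yx Kyx) cG.
have [Yp [Bp Lp]] := Kp; rewrite /= in Yp Bp Lp.
have sp : s < Phi p.
  have H1 : enorm p ^+ 2 <= Rb ^+ 2.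
    by rewrite ler_pXn2r ?nnegrE ?enorm_ge0 ?KB //; exact: le_trans (enorm_ge0 p) (KB _ Kp).
  have H2 : 0 <= ep * enorm yx ^+ 2 by rewrite mulr_ge0 ?sqr_ge0 // ltW.
  have := Hp _ Kyx; have := ler_wpM2l (ltW ep0) H1; rewrite -!GE.
  by move: H2 epR; clear; lra.
have lp0 := lam_gt0 _ Yp Bp.
have zp : enorm (zc p - c) < r.
  rewrite lt_neqAle Bp andbT; apply/eqP => E.
  by have := C1 p Yp E; rewrite leNgt sp.
have lp : lam p < L.
  by rewrite ltNge; apply/negP => E; have := C2 p Yp Bp E; rewrite leNgt sp.
have p0 := Hnz _ Yp Bp.
have ep20 : 0 < ep / 2 by rewrite divr_gt0.
have [dl dl0 Hdl] := ln_normc_taylor p0 ep20.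
have [d1 d10 Hd1] := cz p (r - enorm (zc p - c)) (ltac:(by rewrite subr_gt0)).
have [d2 d20 Hd2] := clam p (L - lam p) (ltac:(by rewrite subr_gt0)).
pose rho := Num.min dl (Num.min (d1 / 2) (d2 / 2)).
have rho0 : 0 < rho by rewrite !lt_min dl0 !divr_gt0.
have rho1 : rho <= dl by rewrite ge_min lexx.
have rho2 : rho < d1.
  apply: (@le_lt_trans _ _ (d1 / 2)); first by rewrite !ge_min lexx ?orbT.
  by move: d10; clear; lra.
have rho3 : rho < d2.
  apply: (@le_lt_trans _ _ (d2 / 2)); first by rewrite !ge_min lexx ?orbT.
  by move: d20; clear; lra.
have near_p y : enorm (y - p) <= rho -> enorm (zc y - c) <= r /\ lam y <= L'.
  move=> yp; have /Hd1/ltr_normlW H1 : enorm (y - p) < d1 by exact: le_lt_trans rho2.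
  have /Hd2/ltr_normlW H2 : enorm (y - p) < d2 by exact: le_lt_trans rho3.
  by move: H1 H2 LL'; clear; split; lra.
(* [P] replaces [- ln |y_j| + ep |y|^2] near [p]; both are compared up to a constant. *)
pose P y := -1 * ln_taylor j (p 0 j) y + (2 * ep) * rdot y p.
have oV' : open [set y | V (0 + y *m M)].
  apply/open_enormP => y /= Vy; rewrite add0r zcM in Vy.
  have [ee ee0 Hee] := (open_enormP V).1 oV _ Vy.
  exists (ee / KM); first by rewrite divr_gt0.
  move=> y' yy'; rewrite add0r zcM; apply: Hee; apply: le_lt_trans (zcL _ _) _.
  by rewrite mulrC -ltr_pdivlMr.
have chz0 y : V (0 + y *m M) -> econt (fun y => h (0 + y *m M)) y.
  have -> : (fun y => h (0 + y *m M)) = (fun y => h (zc y)) by apply/funext => y0; rewrite add0r zcM.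
  by rewrite add0r zcM; exact: chz.
have cP y : econt P y.
  by apply: econtD; apply: econtZ; [exact: econt_ln_taylor|exact: econt_rdot].
have plhP : plh P by apply: plhD; apply: plhZ; [exact: plh_ln_taylor|exact: plh_rdot].
have Bp' : closed_eball p rho p by rewrite /closed_eball /= subrr enorm0 ltW.
have BV' : closed_eball p rho `<=` [set y | V (0 + y *m M)].
  by move=> y By /=; rewrite add0r zcM; apply: BV; have [] := near_p y By.
have cV' y : V (0 + y *m M) -> econt (fun y => h (0 + y *m M) + P y) y.
  by move=> Vy; apply: econtD => //; exact: chz0.
have psh' : plurisubharmonic [set y | V (0 + y *m M)] (fun y => (h (0 + y *m M) + P y)%:E).
  by apply: psh_addplh => //; exact: psh_comp.
have := HX b A uA p rho rho0 _ _ oV' BV' cV' psh' p Bp'.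
rewrite YE => /(_ Yp) [y1 [Sy1]]; rewrite YE !add0r !zcM /P => Yy1 Hy1.
rewrite /esphere /= in Sy1.
have [By1 Ly1] := near_p y1 (ltac:(by rewrite Sy1)).
have Ky1 : K y1 by split.
have := Hp _ Ky1; rewrite -!GE -!PhiE.
have [_] := Hdl y1 (ltac:(by rewrite Sy1)).
have T0 : ln_taylor j (p 0 j) p = 0 by rewrite /ln_taylor subrr mul0r mul0r /= mul0r subr0.
have := enorm_sqrD p y1; rewrite Sy1 rdotBl => ->; rewrite T0 in Hy1.
have := mulr_gt0 ep0 (exprn_gt0 2 rho0); rewrite !lamE.
by move: Hy1; clear; lra.
Qed.

(** The slice [a + z A] is enlarged by the unit normal [e] for which the vector [v]
from [a + w A] to a nearest point of [X] is [al A + mu e]. The points of the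
larger slice are written [b + z A + (y_0 / mu') v']: for such a point of [X],
[|y_0| / mu' * |v'|] is at least [dist z] up to [tau], with equality up to [tau]
at [w]. So [- ln |y_0|] stands in for [- ln dist], and [log_coord_max] applies. *)
Lemma log_dist_max n m (X : set 'rV[R[i]]_n) : X !=set0 -> closed X -> (m < n)%N ->
  max_prop m X ->
  forall (a : 'rV[R[i]]_n) (A : 'M[R[i]]_(m, n)), A \is unitarymx ->
  forall (c : 'rV[R[i]]_m) (r : R),
  (forall z, closed_eball c r z -> ~ X (a + z *m A)) ->
  forall (V : set 'rV[R[i]]_m) (h : 'rV[R[i]]_m -> R), open V ->
    closed_eball c r `<=` V -> (forall x, V x -> econt h x) ->
    plurisubharmonic V (fun z => (h z)%:E) ->
  forall m0, (forall z, esphere c r z -> h z - ln (eucl_dist X (a + z *m A)) <= m0) ->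
  forall w, closed_eball c r w -> h w - ln (eucl_dist X (a + w *m A)) <= m0.
Proof.
move=> X0 Xc mn HX a A uA c r BX V h oV BV ch pshh m0 Hm0 w Bw.
have [D DE] : {D | forall z, eucl_dist X (a + z *m A) = D z}.
  by exists (fun z => eucl_dist X (a + z *m A)).
have {}Hm0 z : esphere c r z -> h z - ln (D z) <= m0 by rewrite -DE; exact: Hm0.
rewrite leNgt DE; apply/negP => gap0.
have cD z : econt D z.
  have -> : D = fun z => eucl_dist X (a + z *m A) by apply/funext => y0; rewrite DE.
  apply: (@econt_comp _ _ _ (eucl_dist X) (fun z => a + z *m A) z 1).
    by move=> y; exact: slice_lip.
  exact: econt_eucl_dist.
have Dpos z : closed_eball c r z -> 0 < D z by move=> /BX; rewrite -DE; exact: eucl_dist_gt0.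
have [zm Bzm Hzm] := real_max (@compact_closed_eball R _ c r) (ex_intro _ w Bw)
   (fun x _ => @econtZ _ _ (-1) _ x (cD x)).
have [dm dm0 Dge] : exists2 dm : R, 0 < dm & forall z, closed_eball c r z -> dm <= D z.
  by exists (D zm); [exact: Dpos|move=> z /Hzm; clear; lra].
have [d0 d0E] : {d0 | D w = d0} by exists (D w).
have dmd0 : dm <= d0 by rewrite -d0E; exact: Dge.
have d00 : 0 < d0 by exact: lt_le_trans dm0 dmd0.
have [gap gapE] : exists gap, gap = h w - ln d0 - m0 by exists (h w - ln d0 - m0).
have {}gap0 : 0 < gap by rewrite gapE subr_gt0 -d0E.
(* The base point is moved by [tau e] since [mu] may be 0; [tau] is so small that
     [ln dist] changes by less than the gap. *)
have [tau [tau0 tau1 tau2]] : exists tau, [/\ 0 < tau, tau <= dm / 2 & tau <= dm * gap / 4].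
  exists (Num.min (dm / 2) (dm * gap / 4)); rewrite lt_min !divr_gt0 ?mulr_gt0 //.
  by rewrite !ge_min !lexx orbT.
have [x Xx xd] := eucl_dist_attained X0 Xc (a + w *m A).
pose v := x - (a + w *m A).
have vd : enorm v = d0 by rewrite /v enorm_distC -xd DE.
have [e [mu [eA e1 mu0 vE]]] := unit_normal v uA mn.
have [mu' mu'E] : exists mu', mu' = mu + tau by exists (mu + tau).
have mu'0 : 0 < mu' by rewrite mu'E ltr_wpDl.
pose al := v *m A ^t*.
pose b := a - tau%:C *: e.
pose A' : 'M[R[i]]_(m.+1, n) := col_mx e A.
have uA' : A' \is unitarymx by exact: col_mx_unitary.
(* [y M] is the parameter [z] of the foot point [b + z A]. *)
pose M : 'M[R[i]]_(m.+1, m) := (col_mx (- (mu'^-1%:C *: al)) 1%:M : 'M[R[i]]_(1 + m, m)).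
pose j0 : 'I_m.+1 := (lshift m (0 : 'I_1) : 'I_(1 + m)).
pose v' := v + tau%:C *: e.
have v'E : v' = al *m A + mu'%:C *: e.
  by rewrite /v' {1}vE -addrA -scalerDl -rmorphD mu'E.
have v'd : enorm v' <= d0 + tau.
  by apply: le_trans (ler_enormD _ _) _; rewrite vd enorm_realZ e1 mulr1 gtr0_norm.
have yE (y : 'rV[R[i]]_(1 + m)) : y = row_mx (y 0 j0)%:M (rsubmx y).
  by rewrite -[LHS]hsubmxK [lsubmx y]mx11_scalar mxE.
have zcE (y : 'rV[R[i]]_(1 + m)) : y *m M = rsubmx y - (y 0 j0 / mu'%:C) *: al.
  rewrite {1}[y]yE mul_row_col mulmx1 mul_scalar_mx scalerN scalerA addrC.
  by rewrite fmorphV.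
have mu'C : mu'%:C != 0 :> R[i].
  by apply/eqP => -[]; apply/eqP; rewrite gt_eqF.
have key (y : 'rV[R[i]]_(1 + m)) :
    y *m A' = (y *m M) *m A + (y 0 j0 / mu'%:C) *: v'.
  rewrite zcE {1}[y]yE mul_row_col mul_scalar_mx mulmxBl -scalemxAl v'E scalerDr.
  set u := _ / _; have uE : u * mu'%:C = y 0 j0 by rewrite /u divfK.
  by rewrite scalerA uE addrA (addrNK (u *: (al *m A))) addrC.
have lamE (y : 'rV[R[i]]_(1 + m)) : normc (y 0 j0 / mu'%:C) = normc (y 0 j0) / mu'.
  rewrite ComplexField.Normc.normcM ComplexField.Normc.normcV; congr (_ / _).
  by rewrite /= expr0n /= addr0 sqrtr_sqr gtr0_norm.
have dt0 : 0 < d0 + tau by rewrite addr_gt0.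
have K1 (y : 'rV[R[i]]_(1 + m)) : X (b + y *m A') ->
    D (y *m M) - tau <= normc (y 0 j0) / mu' * (d0 + tau).
  move=> Xy; have H1 := eucl_dist_lip X0 (b + y *m M *m A) (a + y *m M *m A).
  have H2 := eucl_dist_le (b + y *m M *m A) Xy.
  have H3 : enorm (b + y *m M *m A - (b + y *m A')) = normc (y 0 j0) / mu' * enorm v'.
    by rewrite key addrA opprD addrA subrr sub0r enormN enormZ lamE.
  have H4 : enorm (a + y *m M *m A - (b + y *m M *m A)) = tau.
    rewrite opprD addrACA subrr addr0 /b opprB addrC subrK.
    by rewrite enorm_realZ e1 mulr1 gtr0_norm.
  have H5 : normc (y 0 j0) / mu' * enorm v' <= normc (y 0 j0) / mu' * (d0 + tau).
    by rewrite ler_wpM2l // divr_ge0 ?normc_ge0 // ltW.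
  move: H1 H2 H5; rewrite H3 H4 DE.
  move: (eucl_dist X _) (D _) (_ * enorm v') (_ * (d0 + tau)) => t1 t2 t3 t4.
  by clear; lra.
pose yx : 'rV[R[i]]_(1 + m) := row_mx (mu'%:C)%:M (w + al).
have yx0 : yx 0 j0 = mu'%:C by rewrite /yx row_mxEl mxE eqxx mulr1n.
have zyx : yx *m M = w by rewrite zcE yx0 divff // scale1r /yx row_mxKr addrK.
have nyx : normc (yx 0 j0) = mu'.
  by rewrite yx0 /= expr0n /= addr0 sqrtr_sqr gtr0_norm.
have Xyx : X (b + yx *m A').
  rewrite key zyx yx0 divff // scale1r /b /v' /v.
  suff zmodE (V' : zmodType) (a1 t w1 x1 : V') : (a1 - t) + (w1 + ((x1 - (a1 + w1)) + t)) = x1.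
    by rewrite zmodE.
  by rewrite [x1 - _ + t]addrC [w1 + _]addrCA (addrA (a1 - t)) subrK addrA addrC subrK.
have y_gt0 (y : 'rV[R[i]]_(1 + m)) : X (b + y *m A') -> closed_eball c r (y *m M) ->
    0 < normc (y 0 j0).
  move=> /K1 H /Dge H2.
  have : 0 < normc (y 0 j0) / mu' * (d0 + tau) by move: H H2 dm0 tau1; clear; lra.
  by rewrite pmulr_lgt0 // pmulr_lgt0 // invr_gt0.
have [zM BzM HzM] := real_max (@compact_closed_eball R _ c r) (ex_intro _ w Bw)
   (fun x Bx => ch x (BV x Bx)).
(* The value of [h(z) - ln |y_0|] at [yx] is [s + gap / 4], and [s] bounds it on
   the sphere as well as for [|y_0| >= L]. *)
have [s sE] : exists s, s = h w - ln mu' - gap / 4 by exists (h w - ln mu' - gap / 4).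
pose L := expR (h zM - s).
have L0 : 0 < L by exact: expR_gt0.
pose L' := Num.max (L + 1) mu'.
suff : h (yx *m M) - ln (normc (yx 0 j0)) <= s.
  by rewrite zyx nyx; move: sE gap0; clear; lra.
apply: (@log_coord_max n m X b A' M j0 c r L L' (enorm c + r + L' / mu' * (d0 + tau)) s V h
  Xc HX uA' oV BV ch pshh).
- by rewrite lt_max ltrDl ltr01.
- move=> y Xy By; apply/eqP => y00; have := y_gt0 y Xy By.
  by rewrite y00 ComplexField.Normc.normc0 ltxx.
- move=> y Xy By Ly; rewrite -(enorm_unitary _ uA') key.
  apply: le_trans (ler_enormD _ _) _; apply: lerD.
    rewrite enorm_unitary // -[X in enorm X](subrK c) addrC (le_trans (ler_enormD _ _)) //.
    by rewrite lerD2l.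
  rewrite enormZ lamE; apply: ler_pM => //.
  + by rewrite divr_ge0 ?normc_ge0 // ltW.
  + exact: enorm_ge0.
  + by rewrite ler_pM2r ?invr_gt0.
- move=> y Xy Sy; have By := esphere_sub Sy; have y0 := y_gt0 y Xy By.
  have H0 := K1 y Xy; have H1 := Dge _ By; have H2 := Hm0 _ Sy; have H8 := Dpos _ By.
  move: (y *m M) H0 H1 H2 H8 => z H0 H1 H2 H8; move: (normc (y 0 j0)) y0 H0 => t t0 H0.
  have Dt : 0 < D z - tau by move: H1 tau1 dm0; clear; lra.
  have H3 : ln (D z - tau) <= ln t - ln mu' + ln (d0 + tau).
    by rewrite -ln_div ?posrE // -lnM ?posrE ?divr_gt0 // ler_ln ?posrE // mulr_gt0 // divr_gt0.
  have H4 := lnB_le Dt H8.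
  have H5 := lnB_le d00 dt0.
  have H6 : (D z - (D z - tau)) / (D z - tau) <= gap / 2.
    rewrite ler_pdivrMr //; apply: (@le_trans _ _ (gap / 2 * (dm / 2))).
      by move: tau2; clear; lra.
    by rewrite ler_wpM2l //; move: gap0 H1 tau1; clear; lra.
  have H7 : (d0 + tau - d0) / d0 <= gap / 4.
    rewrite ler_pdivrMr //; apply: (@le_trans _ _ (gap / 4 * dm)).
      by move: tau2; clear; lra.
    by rewrite ler_wpM2l //; move: gap0; clear; lra.
  by move: H2 H3 H4 H5 H6 H7 sE gapE; clear; lra.
- move=> y Xy By Ly; have y0 := y_gt0 y Xy By.
  have : ln L <= ln (normc (y 0 j0)) by rewrite ler_ln ?posrE.
  have := HzM _ By; rewrite /L expRK; move: (h (y *m M)) (ln _) => t1 t2.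
  by clear; lra.
- exact: Xyx.
- by rewrite zyx.
- by rewrite nyx le_max lexx orbT.
Qed.

Lemma le_EFinD (a b c d : R) : b - a <= d - c -> 
  ((- a)%:E + b%:E <= (- c)%:E + d%:E)%E.
Proof. by rewrite -!EFinD lee_fin addrC (addrC (- c)). Qed.

Lemma le_mulN1r (a b c d : R) : a + -1 * b <= c + -1 * d -> a - b <= c - d.
Proof. by rewrite !mulN1r. Qed.

Lemma max_prop_pseudoconvex n p (X : set 'rV[R[i]]_n) :
  X !=set0 -> closed X -> (p.+1 < n)%N -> max_prop p.+1 X -> pseudoconvex p (~` X).
Proof.
move=> X0 Xc pn HX; rewrite /pseudoconvex setCK; split => //; first exact: closed_openC.
have cu x : (~` X) x -> econt (fun z => -1 * ln (eucl_dist X z)) x.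
  move=> nX; apply: econtZ; apply: econt_ln; first exact: eucl_dist_gt0.
  exact: econt_eucl_dist.
have usc : usc_on (~` X) (fun z => (- ln (eucl_dist X z))%:E).
  move=> x Xx; rewrite ltry; split => // s; rewrite lte_fin => us.
  have [|d d0 Hd] := cu x Xx (s + ln (eucl_dist X x)); first by lra.
  apply/nbhs_enormP; exists d => // y /Hd /ltr_normlW H _; rewrite lte_fin; lra.
split => // _ a A uA; have uslice := @usc_on_slice R n p.+1 _ _ a A uA usc.
split => //; right => c r r0 BU V h oV BV /(within_econtP h oV) ch pshh.
have [||z|z Sz Hz] := @real_max R _ (esphere c r)
   (fun z => h z + -1 * ln (eucl_dist X (a + z *m A))).
- exact: compact_esphere.
- exact: esphere_nonempty (ltW r0).
- move=> Sz; have Bz := esphere_sub Sz; apply: econtD; first exact/ch/BV.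
  apply: (@econt_comp _ _ _ (fun x => -1 * ln (eucl_dist X x)) (fun z => a + z *m A) z 1).
    by move=> y; exact: slice_lip.
  by apply: cu; exact: BU.
exists z; first exact: Sz.
move=> w Bw; apply: le_EFinD.
apply: (log_dist_max X0 Xc pn HX uA BU oV BV ch pshh _ Bw) => z' Sz'.
exact: le_mulN1r (Hz z' Sz').
Qed.

End Hartogs.

(** * An invariant mean on bounded functions *)

Section InvariantMean.
Variables (R : realType) (V : zmodType).
Implicit Types (f g : V -> R) (s v x : V) (C : R).

Definition bounded_by C f := forall x, `|f x| <= C.

Definition step_avg s (N : nat) f x : R := N.+1%:R^-1 * \sum_(j < N.+1) f (x + s *+ j).

(** Averages along the arithmetic progressions of step [s], for all [s] in the list. *)
Fixpoint multi_avg (l : seq V) (N : nat) f : V -> R :=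
  if l is s :: l' then step_avg s N (multi_avg l' N f) else f.

Lemma step_avg_bound s N f C : bounded_by C f -> bounded_by C (step_avg s N f).
Proof.
move=> fC x; rewrite /step_avg normrM ger0_norm ?invr_ge0 //.
rewrite ler_pdivrMl //; apply: le_trans (ler_norm_sum _ _ _) _.
apply: (@le_trans _ _ (\sum_(j < N.+1) C)); first by apply: ler_sum => j _.
by rewrite sumr_const card_ord mulr_natl.
Qed.

Lemma multi_avg_bound l N f C : bounded_by C f -> bounded_by C (multi_avg l N f).
Proof. by move=> fC; elim: l => //= s l IH; exact: step_avg_bound. Qed.

Lemma multi_avgD l N f g x :
  multi_avg l N (fun t => f t + g t) x = multi_avg l N f x + multi_avg l N g x.
Proof.
elim: l x => //= s l IH x; rewrite /step_avg -mulrDr -big_split; congr (_ * _).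
by apply: eq_bigr => j _; rewrite IH.
Qed.

Lemma multi_avgZ l N a f x : multi_avg l N (fun t => a * f t) x = a * multi_avg l N f x.
Proof.
elim: l x => //= s l IH x; rewrite /step_avg [RHS]mulrCA; congr (_ * _); rewrite mulr_sumr.
by apply: eq_bigr => j _; rewrite IH.
Qed.

Lemma multi_avg_ge0 l N f x : (forall t, 0 <= f t) -> 0 <= multi_avg l N f x.
Proof.
move=> f0; elim: l x => //= s l IH x; rewrite /step_avg mulr_ge0 ?invr_ge0 //.
by apply: sumr_ge0 => j _.
Qed.

Lemma multi_avg_cst l N c x : multi_avg l N (fun=> c) x = c.
Proof.
elim: l x => //= s l IH x; rewrite /step_avg.
rewrite (eq_bigr (fun=> c)) => [|j _]; last by rewrite IH.
by rewrite sumr_const card_ord -(mulr_natl c) mulrA mulVf ?mul1r.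
Qed.

Lemma multi_avg_shift l N f v x : multi_avg l N (fun t => f (t + v)) x = multi_avg l N f (x + v).
Proof.
elim: l x => //= s l IH x; rewrite /step_avg; congr (_ * _).
by apply: eq_bigr => j _; rewrite IH addrAC.
Qed.

(** Averaging along [v] makes the translate by [v] almost invisible, since the sum
telescopes. *)
Lemma multi_avg_almost_inv l N f C v : bounded_by C f -> v \in l ->
  bounded_by (2 * C / N.+1%:R) (multi_avg l N (fun t => f (t + v) - f t)).
Proof.
move=> fC; elim: l => // s l IH; rewrite inE => /orP[/eqP <-|vl]; last first.
  exact: step_avg_bound (IH vl).
move=> x /=; rewrite /step_avg.
have -> : \sum_(j < N.+1) multi_avg l N (fun t => f (t + v) - f t) (x + v *+ j) =
    multi_avg l N f (x + v *+ N.+1) - multi_avg l N f x.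
  rewrite -[X in _ - multi_avg _ _ _ X](addr0 x) -(mulr0n v).
  rewrite -(telescope_sumr (fun j => multi_avg l N f (x + v *+ j))) // big_mkord.
  apply: eq_bigr => j _; have -> : (fun t => f (t + v) - f t) = (fun t => f (t + v) + -1 * f t).
    by apply/funext => t; rewrite mulN1r.
  by rewrite multi_avgD multi_avgZ mulN1r multi_avg_shift -addrA -mulrSr.
rewrite normrM ger0_norm ?invr_ge0 // mulrC ler_pM2r ?invr_gt0 //.
have B := multi_avg_bound l N fC; apply: le_trans (ler_normB _ _) _.
by have := B (x + v *+ N.+1); have := B x; lra.
Qed.

Let base : set (seq V * nat) := setT.
Let tails (i : seq V * nat) : set (seq V * nat) :=
  [set i' : seq V * nat | {subset i.1 <= i'.1} /\ (i.2 <= i'.2)%N].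

Let tails_filter : ProperFilter (filter_from base tails).
Proof.
apply: filter_from_proper; last by move=> i _; exists i; split.
apply: filter_from_filter; first by exists ([::], 0%N).
move=> [l N] [l' N'] _ _; exists (l ++ l', maxn N N') => // -[l'' N''] /= [H].
rewrite geq_max => /andP[H1 H2]; split; split => //= t tl; apply: H; rewrite mem_cat tl ?orbT //.
Qed.

(** With this, bounded families converge along an ultrafilter. *)
Lemma ultra_fmap (T U : Type) (G : set_system T) (u : T -> U) :
  UltraFilter G -> UltraFilter (u @ G).
Proof.
move=> UG; have PG := @ultra_proper _ _ UG.
split => [|H PH GH]; first exact: fmap_proper_filter.
apply/seteqP; split => // A HA.
have [//|nA] := in_ultra_setVsetC (u @^-1` A) UG.
have HnA : H (~` A) by apply: GH.
have := @filterI _ _ PH _ _ HA HnA; rewrite setICr => H0.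
by case: (@filter_not_empty _ _ PH).
Qed.

(** An abelian group is amenable. The limit of the averages at 0 along an
ultrafilter finer than the tails: lists that contain a given [v] and large
numbers of terms, so that invariance under [v] holds in the limit. *)
Theorem invariant_mean : exists m : (V -> R) -> R,
  [/\ forall f g C, bounded_by C f -> bounded_by C g -> m (fun t => f t + g t) = m f + m g,
      forall a f C, bounded_by C f -> m (fun t => a * f t) = a * m f,
      forall f C, bounded_by C f -> (forall t, 0 <= f t) -> 0 <= m f,
      forall c, m (fun=> c) = c &
      forall f v C, bounded_by C f -> m (fun t => f (t + v)) = m f].
Proof.
have [G [UG sFG]] := ultraFilterLemma tails_filter.
have PG := @ultra_proper _ _ UG.
pose u f (i : seq V * nat) := multi_avg i.1 i.2 f 0.
have cvu f C : bounded_by C f -> cvg (u f @ G).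
  move=> fC; have := @segment_compact R (- C) C; rewrite compact_ultra => H.
  have [|p [_ cp]] := H (u f @ G) (ultra_fmap (u f) UG).
    apply: (@filterS _ G _ setT); last exact: filterT.
    by move=> i _; rewrite /= in_itv /= -ler_norml; exact: multi_avg_bound.
  by apply/cvg_ex; exists p.
exists (fun f => lim (u f @ G)); split.
- move=> f g C fC gC; apply/cvg_lim => //.
  have -> : u (fun t => f t + g t) = u f \+ u g by apply/funext => i; exact: multi_avgD.
  by apply: cvgD; exact: cvu.
- move=> a f C fC; apply/cvg_lim => //.
  have -> : u (fun t => a * f t) = (fun i => a * u f i) by apply/funext => i; exact: multi_avgZ.
  by apply: cvgM; [exact: cvg_cst|exact: cvu].
- move=> f C fC f0; apply: (limr_ge (cvu f C fC)).
  by apply: nearW => i; exact: multi_avg_ge0.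
- move=> c; apply/cvg_lim => //.
  have -> : u (fun=> c) = fun=> c by apply/funext => i; exact: multi_avg_cst.
  exact: cvg_cst.
- move=> f v C fC; apply/cvg_lim => //.
  have -> : u (fun t => f (t + v)) = (fun i => u f i + u (fun t => f (t + v) - f t) i).
    apply/funext => i; rewrite /u -multi_avgD; congr (multi_avg _ _ _ _).
    by apply/funext => t; rewrite [RHS]addrC subrK.
  rewrite -[X in _ --> X]addr0; apply: cvgD; first exact: cvu fC.
  apply/cvgrPdist_le => e e0.
  have C0 : 0 <= C by exact: le_trans (normr_ge0 _) (fC 0).
  pose N := Num.truncn (2 * C / e).
  have HG : G (tails ([:: v], N)) by apply: sFG; exists ([:: v], N).
  apply: filterS HG => -[l n] /= [vl Nn]; rewrite sub0r normrN /u /=.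
  have vl' : v \in l by apply: vl; rewrite inE.
  apply: le_trans (multi_avg_almost_inv n fC vl' 0) _.
  rewrite ler_pdivrMr // (mulrC e) -ler_pdivrMr //.
  have : 2 * C / e < N.+1%:R by apply: truncnS_gt.
  move=> /ltW H; apply: le_trans H _; rewrite ler_nat; exact: Nn.
Qed.

End InvariantMean.

(** * A local translation invariant functional on C^m *)

Section Functional.
Variable R : realType.

(** The representative of [a] modulo 1 closest to 0. *)
Definition wrap (a : R) : R := a - (Num.floor (a + 1 / 2))%:~R.

Lemma wrap_itv (a : R) : - (1 / 2) <= wrap a < 1 / 2.
Proof.
have := Num.Theory.floor_itv (a + 1 / 2); rewrite /wrap intrD => /andP[H1 H2].
by apply/andP; move: H1 H2; move: (_%:~R) => k; lra.
Qed.

Lemma wrap_unique (a b : R) (k : int) : a - b = k%:~R -> - (1 / 2) <= a < 1 / 2 ->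
  - (1 / 2) <= b < 1 / 2 -> a = b.
Proof.
move=> E /andP[a1 a2] /andP[b1 b2].
have : (-1 : int)%:~R < k%:~R :> R by rewrite -E mulrN1z; lra.
have : k%:~R < (1 : int)%:~R :> R by rewrite -E; lra.
rewrite !ltr_int => k1 k2; have k0 : k = 0 by lia.
by apply/eqP; rewrite -subr_eq0 E k0.
Qed.

Lemma wrap_shift (a b : R) (k := (Num.floor (a + b + 1 / 2) - Num.floor (a + 1 / 2))%R) :
  wrap a + b - wrap (a + b) = k%:~R.
Proof. by rewrite /wrap /k intrB; lra. Qed.

Lemma wrapD (a b : R) : - (1 / 2) <= wrap a + b < 1 / 2 -> wrap (a + b) = wrap a + b.
Proof.
by move=> H; apply/esym/(wrap_unique (wrap_shift a b)) => //; exact: wrap_itv.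
Qed.

(** Where reduction does not commute with a small shift, the values on either side
are close to the boundary of the fundamental interval; functions supported near
0 do not see this. *)
Lemma wrap_far (a b : R) : `|b| <= 1 / 8 -> ~ (- (1 / 2) <= wrap a + b < 1 / 2) ->
  1 / 2 <= `|wrap a + b| /\ 3 / 8 <= `|wrap (a + b)|.
Proof.
rewrite ler_norml => /andP[b1 b2] /negP; rewrite negb_and -ltNge -leNgt => H.
have /andP[a1 a2] := wrap_itv a; have /andP[c1 c2] := wrap_itv (a + b).
have := wrap_shift a b; set k := (_ - _)%R => E.
have H1 : 1 / 2 <= `|wrap a + b|.
  by case/orP: H => H; [rewrite ler0_norm|rewrite ger0_norm]; lra.
split => //.
case/orP: H => H.
  have : k%:~R < (0 : int)%:~R :> R by rewrite -E; lra.
  rewrite ltr_int => k0; have : k%:~R <= (-1 : int)%:~R :> R by rewrite ler_int; lia.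
  by rewrite -E mulrN1z => H2; rewrite ger0_norm; lra.
have : (0 : int)%:~R < k%:~R :> R by rewrite -E; lra.
rewrite ltr_int => k0; have : (1 : int)%:~R <= k%:~R :> R by rewrite ler_int; lia.
by rewrite -E => H2; rewrite ler0_norm; lra.
Qed.

Variable m : nat.
Implicit Types (t x y z : 'rV[R[i]]_m).

(** The representative modulo the lattice Z[i]^m in the unit box centred at 0. *)
Definition red t : 'rV[R[i]]_m :=
  \row_j (wrap (complex.Re (t 0 j)) +i* wrap (complex.Im (t 0 j))).

Lemma red_shift t y : enorm y <= 1 / 8 ->
  red (t + y) = red t + y \/ (3 / 8 <= enorm (red t + y) /\ 3 / 8 <= enorm (red (t + y))).
Proof.
move=> y8.
have yR j : `|complex.Re (y 0 j)| <= 1 / 8 by exact: le_trans (norm_Re_le y j) y8.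
have yI j : `|complex.Im (y 0 j)| <= 1 / 8 by exact: le_trans (norm_Im_le y j) y8.
pose P j := (- (1 / 2) <= wrap (complex.Re (t 0 j)) + complex.Re (y 0 j) < 1 / 2) &&
            (- (1 / 2) <= wrap (complex.Im (t 0 j)) + complex.Im (y 0 j) < 1 / 2).
have [/forallP H|] := boolP [forall j, P j].
  left; apply/rowP => j; rewrite !mxE cReD cImD.
  have /andP[H1 H2] := H j; rewrite (wrapD H1) (wrapD H2).
  by case: (y 0 j) => u v.
rewrite negb_forall => /existsP [j /negP Pj]; right.
have [R1|/wrap_far] := pselect (- (1 / 2) <= wrap (complex.Re (t 0 j)) + complex.Re (y 0 j) < 1 / 2).
  have I1 : ~ (- (1 / 2) <= wrap (complex.Im (t 0 j)) + complex.Im (y 0 j) < 1 / 2).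
    by move=> I1; apply: Pj; rewrite /P R1 I1.
  have [H1 H2] := wrap_far (yI j) I1; split.
    apply: (@le_trans _ _ (1 / 2)); first lra.
    by apply: le_trans H1 _; have := norm_Im_le (red t + y) j; rewrite !mxE cImD.
  by apply: le_trans H2 _; have := norm_Im_le (red (t + y)) j; rewrite !mxE cImD.
move=> /(_ (yR j)) [H1 H2]; split.
  apply: (@le_trans _ _ (1 / 2)); first lra.
  by apply: le_trans H1 _; have := norm_Re_le (red t + y) j; rewrite !mxE cReD.
by apply: le_trans H2 _; have := norm_Re_le (red (t + y)) j; rewrite !mxE cReD.
Qed.

Lemma red_small t x : enorm (red t - x) <= 3 / 8 -> red (t - x) = red t - x.
Proof.
move=> H; apply/rowP => j; rewrite !mxE.
have HR := le_trans (norm_Re_le _ j) H; have HI := le_trans (norm_Im_le _ j) H.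
rewrite !mxE !(cReD, cImD, cReN, cImN) /= in HR HI.
move: HR HI; rewrite !ler_norml => /andP[R1 R2] /andP[I1 I2].
rewrite cReD cImD cReN cImN !wrapD; last by apply/andP; lra.
  by case: (x 0 j).
by apply/andP; lra.
Qed.

Definition pos_part (a : R) : R := Num.max 0 a.

Lemma pos_part_ge0 a : 0 <= pos_part a.
Proof. by rewrite /pos_part le_max lexx. Qed.

(** The third power makes the function twice differentiable with a cubic remainder
([pos_part_cube]) while it stays elementary. *)
Definition bumpf x : R := pos_part (1 / 16 - rdot x x) ^+ 3.

Lemma bumpf_ge0 x : 0 <= bumpf x.
Proof. by rewrite /bumpf exprn_ge0 ?pos_part_ge0. Qed.

Lemma bumpf_le1 x : bumpf x <= 1.
Proof.
rewrite /bumpf exprn_ile1 ?pos_part_ge0 // /pos_part ge_max.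
by have := rdot_ge0 x; move: (rdot x x); clear => r ?; apply/andP; lra.
Qed.

Lemma bumpf_eq0 x : 1 / 4 <= enorm x -> bumpf x = 0.
Proof.
move=> H; rewrite /bumpf /pos_part max_l ?expr0n //.
rewrite -sqr_enorm; have : 0 <= enorm x by exact: enorm_ge0.
by move: (enorm x) H; clear => r; nra.
Qed.

Lemma bumpf_ge x : enorm x <= 1 / 8 -> (1 / 32) ^+ 3 <= bumpf x.
Proof.
have c0 : 0 <= 1 / 32 :> R by lra.
move=> H; rewrite /bumpf ler_pXn2r ?nnegrE ?pos_part_ge0 ?c0 //.
rewrite /pos_part le_max; apply/orP; right; rewrite -sqr_enorm.
have : 0 <= enorm x by exact: enorm_ge0.
by move: (enorm x) H; clear => r; nra.
Qed.

(** The functional below reads a function only on the ball of radius 3/8, which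
contains the support of the bump (radius 1/4) moved by vectors of length at most
1/8, and lies in the unit box. *)
Definition bounded_in (F : 'rV[R[i]]_m -> R) := exists C, forall x, enorm x <= 3 / 8 -> `|F x| <= C.

Lemma red_cover : exists l : seq 'rV[R[i]]_m, forall t, exists2 x, x \in l & enorm (red t - x) <= 1 / 8.
Proof.
pose K : set 'rV[R[i]]_m := [set v | forall j,
   (- 1 <= complex.Re (v 0 j) <= 1) && (- 1 <= complex.Im (v 0 j) <= 1)].
have cK : compact K := @rV_compact R[i] m (fun=> _) (fun=> @compact_boxc R 1).
have Kred t : K (red t).
  move=> j; rewrite !mxE /=.
  have /andP[? ?] := wrap_itv (complex.Re (t 0 j)); have /andP[? ?] := wrap_itv (complex.Im (t 0 j)).
  by apply/andP; split; apply/andP; lra.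
have cK' := cK; rewrite compact_cover in cK'.
have [x _||D _ KD] := cK' 'rV[R[i]]_m setT (fun x => [set y | enorm (y - x) < 1 / 8]).
- apply/open_enormP => y /= yx; exists (1 / 8 - enorm (y - x)); first by rewrite subr_gt0.
  by move=> z zy /=; have := ler_enormB z y x; lra.
- by move=> x _; exists x => //=; rewrite subrr enorm0.
exists (finmap.enum_fset D) => t; have [x xD /ltW tx] := KD _ (Kred t).
by exists x.
Qed.

(** Plays the part of integration over the torus: the mean of the function
[t |-> F (red t)], normalised so that the bump has mass 1. That the bump
has positive mean follows from compactness: finitely many of its translates
cover the torus. *)
Lemma bump_functional : exists Lam : ('rV[R[i]]_m -> R) -> R,
  [/\ forall F G, bounded_in F -> bounded_in G -> Lam (fun x => F x + G x) = Lam F + Lam G,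
      forall a F, bounded_in F -> Lam (fun x => a * F x) = a * Lam F,
      forall F, bounded_in F -> (forall x, enorm x <= 3 / 8 -> 0 <= F x) -> 0 <= Lam F,
      Lam bumpf = 1 &
      forall F y C, bounded_by C F -> (forall z, 3 / 8 <= enorm z -> F z = 0 /\ F (z + y) = 0) ->
        enorm y <= 1 / 8 -> Lam (fun x => F (x + y)) = Lam F].
Proof.
have [M [MD MZ M0 M1 MT]] := invariant_mean R 'rV[R[i]]_m.
(* Bounded functions on the ball of radius 3/8 become bounded periodic functions. *)
pose cut (F : 'rV[R[i]]_m -> R) t : R := if enorm (red t) <= 3 / 8 then F (red t) else 0.
have cut_bnd F : bounded_in F -> exists C, bounded_by C (cut F).
  move=> [C HC]; exists `|C| => t; rewrite /cut; case: ifP => [H|_].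
    by apply: le_trans (HC _ H) _; exact: ler_norm.
  by rewrite normr0.
have cutE F : (forall z, 3 / 8 <= enorm z -> F z = 0) -> cut F = (fun t => F (red t)).
  move=> H; apply/funext => t; rewrite /cut; case: ifPn => //; rewrite -ltNge => /ltW.
  by move=> /H ->.
have bump0 z : 3 / 8 <= enorm z -> bumpf z = 0.
  by move=> H; apply: bumpf_eq0; apply: le_trans H; lra.
have bump_bnd : bounded_by 1 (fun t => bumpf (red t)).
  by move=> t; rewrite ger0_norm ?bumpf_ge0 ?bumpf_le1.
have [l Hl] := red_cover.
have K0 : 0 < M (cut bumpf).
  rewrite (cutE bumpf bump0).
  have bs x : bounded_by 1 (fun t => bumpf (red (t - x))).
    by move=> t; rewrite ger0_norm ?bumpf_ge0 ?bumpf_le1.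
  have MS (s : seq 'rV[R[i]]_m) : M (fun t => \sum_(x <- s) bumpf (red (t - x))) =
       (size s)%:R * M (fun t => bumpf (red t)) /\
       bounded_by (size s)%:R (fun t => \sum_(x <- s) bumpf (red (t - x))).
    elim: s => [|x s [IH1 IH2]].
      split; last by move=> t; rewrite big_nil normr0.
      under eq_fun do rewrite big_nil; by rewrite M1 mul0r.
    split.
      under eq_fun do rewrite big_cons.
      rewrite (MD _ _ (1 + (size s)%:R)).
      + by rewrite IH1 (MT (fun t => bumpf (red t)) (- x) 1) //= -natr1 mulrDl mul1r addrC.
      + by move=> t; apply: le_trans (bs x t) _; rewrite lerDl.
      + by move=> t; apply: le_trans (IH2 t) _; rewrite lerDr.
    move=> t; rewrite big_cons -natr1 addrC; apply: le_trans (ler_normD _ _) _.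
    by apply: lerD; [exact: IH2|exact: bs].
  have [E1 E2] := MS l.
  have cst1 : `|-1 * (1 / 32) ^+ 3| <= 1 :> R.
    by rewrite mulN1r normrN ger0_norm ?exprn_ge0 // ?exprn_ile1 //; lra.
  have : (1 / 32) ^+ 3 <= (size l)%:R * M (fun t => bumpf (red t)).
    rewrite -E1 -subr_ge0 -(M1 ((1 / 32) ^+ 3)).
    have -> : M (fun t => \sum_(x <- l) bumpf (red (t - x))) - M (fun=> (1 / 32) ^+ 3) =
       M (fun t => \sum_(x <- l) bumpf (red (t - x)) + -1 * (1 / 32) ^+ 3).
      rewrite (MD _ _ ((size l)%:R + 1)) //.
      + by rewrite !M1 mulN1r.
      + by move=> t; apply: le_trans (E2 t) _; rewrite lerDl.
      + by move=> t; apply: le_trans cst1 _; rewrite lerDr.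
    apply: (M0 _ ((size l)%:R + 1)).
      move=> t; apply: le_trans (ler_normD _ _) _; apply: lerD; first exact: E2.
      exact: cst1.
    move=> t; rewrite mulN1r subr_ge0.
    have [x xl tx] := Hl t; apply: le_trans (bumpf_ge tx) _.
    rewrite -(red_small (t := t) (x := x)); last by apply: le_trans tx _; lra.
    rewrite (big_rem x xl) /= lerDl sumr_ge0 // => y _; exact: bumpf_ge0.
  rewrite ltNge => H; apply/negP => N.
  have : (size l)%:R * M (fun t => bumpf (red t)) <= 0 by rewrite mulr_ge0_le0.
  by move: (_ * M _) H; clear => r; lra.
exists (fun F => M (cut F) / M (cut bumpf)); split.
- move=> F G bF bG; have [C1 HC1] := cut_bnd F bF; have [C2 HC2] := cut_bnd G bG.
  have -> : cut (fun x => F x + G x) = (fun t => cut F t + cut G t).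
    by apply/funext => t; rewrite /cut; case: ifP => // _; rewrite addr0.
  rewrite (MD _ _ (`|C1| + `|C2|)) ?mulrDl //.
    move=> t; apply: le_trans (HC1 t) _; have := ler_norm C1; have := normr_ge0 C2; lra.
  move=> t; apply: le_trans (HC2 t) _; have := ler_norm C2; have := normr_ge0 C1; lra.
- move=> a F bF; have [C1 HC1] := cut_bnd F bF.
  have -> : cut (fun x => a * F x) = (fun t => a * cut F t).
    by apply/funext => t; rewrite /cut; case: ifP => // _; rewrite mulr0.
  by rewrite (MZ _ _ C1) // mulrA.
- move=> F bF F0; have [C1 HC1] := cut_bnd F bF.
  apply: divr_ge0; last exact: ltW.
  by apply: (M0 _ C1) => // t; rewrite /cut; case: ifP => // H; exact: F0.
- by rewrite divff // gt_eqF.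
- move=> F y C bF F0 y8; congr (_ / _).
  rewrite (cutE F (fun z Hz => (F0 z Hz).1)) (cutE (fun x => F (x + y)) (fun z Hz => (F0 z Hz).2)).
  rewrite -(MT (fun t => F (red t)) y C); last by move=> t; exact: bF.
  congr (M _); apply/funext => t.
  have [->//|[H1 H2]] := red_shift t y8.
  by rewrite (F0 _ H1).1 (F0 _ H2).1.
Qed.

End Functional.

(** * Second order expansion of smoothed functions *)

(** Taylor expansion of the third power of the positive part; its second derivative
is Lipschitz across the kink. *)
Lemma pos_part_cube (R : realType) (a s : R) :
  `|pos_part (a + s) ^+ 3 - (pos_part a ^+ 3 + 3 * pos_part a ^+ 2 * s + 3 * pos_part a * s ^+ 2)|
   <= `|s| ^+ 3.
Proof.
rewrite /pos_part -normrX; case: (leP 0 (a + s)) => as0; case: (leP 0 a) => a0.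
- by rewrite (_ : _ - _ = s ^+ 3) //; ring.
- have s0 : 0 < s by lra.
  rewrite !expr0n /= !(mulr0, mul0r, addr0) subr0 !ger0_norm ?exprn_ge0 ?(ltW s0) //.
  by rewrite ler_pXn2r ?nnegrE ?(ltW s0) //; lra.
- have s0 : s < 0 by lra.
  rewrite expr0n /= sub0r normrN.
  have -> : a ^+ 3 + 3 * a ^+ 2 * s + 3 * a * s ^+ 2 = (a + s) ^+ 3 - s ^+ 3 by ring.
  have -> : (a + s) ^+ 3 - s ^+ 3 = a * ((a + s) ^+ 2 + (a + s) * s + s ^+ 2) by ring.
  have q0 : 0 <= (a + s) ^+ 2 + (a + s) * s + s ^+ 2.
    by apply: addr_ge0; [apply: addr_ge0|]; rewrite ?sqr_ge0 // mulr_le0 // ltW.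
  rewrite ger0_norm ?mulr_ge0 // ler0_norm; last first.
    by rewrite exprS mulr_le0_ge0 ?sqr_ge0 // ltW.
  have -> : a * ((a + s) ^+ 2 + (a + s) * s + s ^+ 2) = - s ^+ 3 - (- (a + s)) ^+ 3 by ring.
  rewrite lerBlDr lerDl exprn_ge0 //; lra.
- rewrite !expr0n /= !(mulr0, mul0r, addr0) subr0 normr0; exact: normr_ge0.
Qed.

Section Forms.
Variable R : realType.

Definition rlin m (l : 'rV[R[i]]_m -> R) :=
  forall (s : R) x y, l (s%:C *: x + y) = s * l x + l y.

(** The symmetric real bilinear forms with [b (i x, i x) = - b (x, x)]; these are the
real parts of complex quadratic forms, so [b (x, x)] is pluriharmonic. *)
Definition plform m (b : 'rV[R[i]]_m -> 'rV[R[i]]_m -> R) :=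
  [/\ forall z, rlin (b z), forall x y, b x y = b y x,
      forall x y, b ('i *: x) ('i *: y) = - b x y &
      exists2 C : R, 0 <= C & forall x y, `|b x y| <= C * (enorm x * enorm y)].

Lemma rlin0 m (l : 'rV[R[i]]_m -> R) : rlin l -> l 0 = 0.
Proof. by move=> /(_ (-1) 0 0); rewrite scaler0 addr0; move: (l 0) => t; lra. Qed.

Lemma rlinD m (l : 'rV[R[i]]_m -> R) x y : rlin l -> l (x + y) = l x + l y.
Proof. by move=> /(_ 1 x y); rewrite scale1r mul1r. Qed.

Lemma rlinZ m (l : 'rV[R[i]]_m -> R) s x : rlin l -> l (s%:C *: x) = s * l x.
Proof. by move=> H; have := H s x 0; rewrite addr0 (rlin0 H) addr0. Qed.

Lemma rlinN m (l : 'rV[R[i]]_m -> R) x : rlin l -> l (- x) = - l x.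
Proof.
by move=> H; have := rlinZ (-1) x H; rewrite rmorphN1 scaleN1r mulN1r.
Qed.

End Forms.

Section Expansion.
Variables (R : realType) (m : nat) (Lam : ('rV[R[i]]_m -> R) -> R).
Hypothesis LamD : forall F G, bounded_in F -> bounded_in G ->
  Lam (fun x => F x + G x) = Lam F + Lam G.
Hypothesis LamZ : forall a F, bounded_in F -> Lam (fun x => a * F x) = a * Lam F.
Hypothesis Lam_ge0 : forall F, bounded_in F ->
  (forall x, enorm x <= 3 / 8 -> 0 <= F x) -> 0 <= Lam F.
Hypothesis Lam_bump : Lam (fun x => bumpf x) = 1.
Hypothesis Lam_shift : forall F y C, bounded_by C F ->
  (forall z, 3 / 8 <= enorm z -> F z = 0 /\ F (z + y) = 0) ->
  enorm y <= 1 / 8 -> Lam (fun x => F (x + y)) = Lam F.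
Implicit Types (F G : 'rV[R[i]]_m -> R) (x y z : 'rV[R[i]]_m).

Lemma bounded_inD F G : bounded_in F -> bounded_in G -> bounded_in (fun x => F x + G x).
Proof.
move=> [C HC] [D HD]; exists (C + D) => x Hx.
by apply: le_trans (ler_normD _ _) _; rewrite lerD ?HC ?HD.
Qed.

Lemma bounded_inM F G : bounded_in F -> bounded_in G -> bounded_in (fun x => F x * G x).
Proof.
move=> [C HC] [D HD]; exists (C * D) => x Hx.
by rewrite normrM ler_pM // ?HC ?HD.
Qed.

Lemma bounded_in_cst a : bounded_in (fun _ : 'rV[R[i]]_m => a).
Proof. by exists `|a|. Qed.

Lemma bounded_inZ a F : bounded_in F -> bounded_in (fun x => a * F x).
Proof. by apply: bounded_inM; exact: bounded_in_cst. Qed.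

Lemma bounded_in_rdot y : bounded_in (fun x => rdot x y).
Proof.
exists (3 / 8 * enorm y) => x Hx; apply: le_trans (rdot_CS _ _) _.
by rewrite ler_wpM2r ?enorm_ge0.
Qed.

Let U x : R := pos_part (1 / 16 - rdot x x).

Lemma pos_part_bound x : 0 <= U x <= 1 / 16.
Proof.
rewrite /U pos_part_ge0 /= /pos_part ge_max.
by have := rdot_ge0 x; move: (rdot x x) => r ?; apply/andP; lra.
Qed.

Lemma bounded_in_U : bounded_in U.
Proof. by exists (1 / 16) => x _; have /andP[? ?] := pos_part_bound x; rewrite ger0_norm. Qed.

Lemma bounded_in_bump : bounded_in (fun x => bumpf x).
Proof. by exists 1 => x _; rewrite ger0_norm ?bumpf_ge0 ?bumpf_le1. Qed.

Lemma Lam_le F G : bounded_in F -> bounded_in G ->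
  (forall x, enorm x <= 3 / 8 -> F x <= G x) -> Lam F <= Lam G.
Proof.
move=> bF bG FG; rewrite -subr_ge0 -mulN1r -LamZ // -LamD //; last exact: bounded_inZ.
apply: Lam_ge0; first by apply: bounded_inD => //; exact: bounded_inZ.
by move=> x /FG; rewrite mulN1r subr_ge0.
Qed.

Let Lam1 := Lam (fun=> 1).

Lemma Lam1_ge0 : 0 <= Lam1.
Proof. by apply: Lam_ge0 => //; exact: bounded_in_cst. Qed.

Lemma Lam_norm_le F K : bounded_in F -> (forall x, enorm x <= 3 / 8 -> `|F x| <= K) ->
  `|Lam F| <= K * Lam1.
Proof.
move=> bF FK.
have E a : Lam (fun=> a) = a * Lam1.
  have := LamZ a (bounded_in_cst 1); rewrite -/Lam1 => <-.
  by congr (Lam _); apply/funext => x; rewrite mulr1.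
rewrite ler_norml -mulNr -!E; apply/andP; split; apply: Lam_le => //; try exact: bounded_in_cst.
  by move=> x /FK; rewrite ler_norml => /andP[].
by move=> x /FK; rewrite ler_norml => /andP[].
Qed.

Lemma Lam_sum (N : nat) (F : nat -> 'rV[R[i]]_m -> R) : (forall j, bounded_in (F j)) ->
  Lam (fun x => \sum_(j < N) F j x) = \sum_(j < N) Lam (F j) /\
  bounded_in (fun x => \sum_(j < N) F j x).
Proof.
move=> bF; elim: N => [|N [IH1 IH2]].
  split.
    under eq_fun do rewrite big_ord0.
    rewrite big_ord0 -[RHS](mul0r (Lam (fun=> 0))) -(LamZ 0 (bounded_in_cst 0)).
    by congr (Lam _); apply/funext => x; rewrite mul0r.
  by under eq_fun do rewrite big_ord0; exact: bounded_in_cst.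
split; under eq_fun do rewrite big_ord_recr.
  by rewrite LamD // IH1 big_ord_recr.
exact: bounded_inD.
Qed.

Variables (H : 'rV[R[i]]_m -> R) (CH : R).
Hypothesis H_bound : forall z, enorm z <= 1 / 2 -> `|H z| <= CH.

Let CH0 : 0 <= CH.
Proof. by apply: le_trans (normr_ge0 _) (@H_bound 0 _); rewrite enorm0. Qed.

Lemma bounded_in_shift y : enorm y <= 1 / 8 -> bounded_in (fun x => H (x + y)).
Proof.
move=> y8; exists CH => x Hx; apply: H_bound; apply: le_trans (ler_enormD _ _) _.
by move: Hx y8; lra.
Qed.

Let bounded_in_H : bounded_in H.
Proof. by have := @bounded_in_shift 0; rewrite enorm0; under eq_fun do rewrite addr0; apply. Qed.

(** Convolution with the bump, and the first and second order terms at 0 of its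
Taylor expansion: all derivatives fall on the bump. *)
Definition smooth y : R := Lam (fun x => H (x + y) * bumpf x).
Definition smooth_lin y : R := Lam (fun z => H z * (6 * U z ^+ 2 * rdot z y)).
Definition smooth_bil x y : R :=
  Lam (fun z => H z * (- 3 * U z ^+ 2 * rdot x y + 12 * U z * (rdot z x * rdot z y))).

Let bounded_in_U2 a : bounded_in (fun z => a * U z ^+ 2).
Proof. by apply: bounded_inZ; under eq_fun do rewrite expr2; apply: bounded_inM; exact: bounded_in_U. Qed.

Let bounded_in_lin y : bounded_in (fun z => H z * (6 * U z ^+ 2 * rdot z y)).
Proof. by apply: bounded_inM => //; apply: bounded_inM => //; exact: bounded_in_rdot. Qed.

Let bounded_in_bil x y : bounded_in
  (fun z => H z * (- 3 * U z ^+ 2 * rdot x y + 12 * U z * (rdot z x * rdot z y))).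
Proof.
apply: bounded_inM => //; apply: bounded_inD.
  by apply: bounded_inM => //; exact: bounded_in_cst.
apply: bounded_inM; first by apply: bounded_inZ; exact: bounded_in_U.
by apply: bounded_inM; exact: bounded_in_rdot.
Qed.

Lemma rlin_smooth_lin : rlin smooth_lin.
Proof.
move=> s x y; rewrite /smooth_lin -LamZ // -LamD //; last exact: bounded_inZ.
by congr (Lam _); apply/funext => z; rewrite rdotDr rdot_realZr; ring.
Qed.

Lemma rlin_smooth_bil x : rlin (smooth_bil x).
Proof.
move=> s y y'; rewrite /smooth_bil -LamZ // -LamD //; last exact: bounded_inZ.
by congr (Lam _); apply/funext => z; rewrite !rdotDr !rdot_realZr; ring.
Qed.

Lemma smooth_bilC x y : smooth_bil x y = smooth_bil y x.
Proof.
by congr (Lam _); apply/funext => z; rewrite (rdotC x y) (mulrC (rdot z x)).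
Qed.

Lemma smooth_bil_bound x y : `|smooth_bil x y| <= 5 * CH * Lam1 * (enorm x * enorm y).
Proof.
rewrite mulrAC; apply: Lam_norm_le => // z Hz.
rewrite normrM (mulrC 5) -[leRHS]mulrA; apply: ler_pM => //.
  by apply: H_bound; move: Hz; lra.
have /andP[u0 u1] := pos_part_bound z.
have xy0 : 0 <= enorm x * enorm y by rewrite mulr_ge0 ?enorm_ge0.
have Un : `|U z| = U z by rewrite ger0_norm.
apply: le_trans (ler_normD _ _) _.
have -> : `|- 3 * U z ^+ 2 * rdot x y| = 3 * U z ^+ 2 * `|rdot x y|.
  by rewrite !normrM normrN normr_nat Un.
have -> : `|12 * U z * (rdot z x * rdot z y)| = 12 * U z * (`|rdot z x| * `|rdot z y|).
  by rewrite !normrM normr_nat Un.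
have H1 : 3 * U z ^+ 2 * `|rdot x y| <= 1 * (enorm x * enorm y).
  by apply: ler_pM => //; [rewrite mulr_ge0 ?sqr_ge0|nra|exact: rdot_CS].
have H2 : 12 * U z * (`|rdot z x| * `|rdot z y|) <= 1 * (enorm x * enorm y).
  apply: ler_pM; [lra|exact: mulr_ge0|lra|].
  apply: ler_pM => //; apply: le_trans (rdot_CS _ _) _.
    by rewrite -[leRHS]mul1r ler_wpM2r ?enorm_ge0 //; move: Hz; lra.
  by rewrite -[leRHS]mul1r ler_wpM2r ?enorm_ge0 //; move: Hz; lra.
by move: H1 H2 xy0; lra.
Qed.

(** By invariance the shift moves from [H] to the bump, where [pos_part_cube] applies
with increment [s = 2 <z, y> - |y|^2]. The terms of [s^2] beyond [<z, y>^2] join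
the cubic error. *)
Lemma smooth_taylor y : enorm y <= 1 / 8 ->
  `|smooth y - (smooth 0 + smooth_lin y + smooth_bil y y)| <= 2 * CH * Lam1 * enorm y ^+ 3.
Proof.
move=> y8; pose F z := H z * bumpf (z - y).
have F0 z : 1 / 4 <= enorm (z - y) -> F z = 0 by move=> /bumpf_eq0; rewrite /F => ->; rewrite mulr0.
have far z : 3 / 8 <= enorm z -> 1 / 4 <= enorm (z - y).
  have := ler_enormD (z - y) y; rewrite subrK; move: y8; lra.
have -> : smooth y = Lam F.
  rewrite -(@Lam_shift F y CH) //.
  - by congr (Lam _); apply/funext => x; rewrite /F addrK.
  - move=> z; have [z8|z8] := leP (3 / 8) (enorm z); first by rewrite F0 ?far // normr0.
    rewrite /F normrM -[leRHS]mulr1; apply: ler_pM => //.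
      by apply: H_bound; move: z8; lra.
    by rewrite ger0_norm ?bumpf_ge0 ?bumpf_le1.
  - move=> z z8; split; apply: F0; first exact: far.
    by rewrite addrK; move: z8; lra.
have bF : bounded_in F.
  exists CH => z z8; rewrite /F normrM -[leRHS]mulr1; apply: ler_pM => //.
    by apply: H_bound; move: z8; lra.
  by rewrite ger0_norm ?bumpf_ge0 ?bumpf_le1.
pose Q z := H z * bumpf z + H z * (6 * U z ^+ 2 * rdot z y) +
  H z * (- 3 * U z ^+ 2 * rdot y y + 12 * U z * (rdot z y * rdot z y)).
have bHb : bounded_in (fun z => H z * bumpf z).
  by apply: bounded_inM => //; exact: bounded_in_bump.
have b2 : bounded_in (fun z => H z * bumpf z + H z * (6 * U z ^+ 2 * rdot z y)).
  exact: bounded_inD.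
have bQ : bounded_in Q by apply: bounded_inD.
have -> : smooth 0 + smooth_lin y + smooth_bil y y = Lam Q.
  rewrite /Q LamD // LamD //; congr (_ + _ + _).
  by congr (Lam _); apply/funext => x; rewrite addr0.
rewrite -mulN1r -LamZ // -LamD //; last exact: bounded_inZ.
rewrite mulrAC; apply: Lam_norm_le; first by apply: bounded_inD => //; exact: bounded_inZ.
move=> z Hz; rewrite mulN1r.
have -> : F z - Q z = H z * (bumpf (z - y) - (bumpf z + 6 * U z ^+ 2 * rdot z y +
    (- 3 * U z ^+ 2 * rdot y y + 12 * U z * (rdot z y * rdot z y)))).
  by rewrite /F /Q; ring.
rewrite normrM (mulrC 2) -[leRHS]mulrA; apply: ler_pM => //.
  by apply: H_bound; move: Hz; lra.
pose s := 2 * rdot z y - rdot y y.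
have -> : bumpf (z - y) = pos_part ((1 / 16 - rdot z z) + s) ^+ 3.
  rewrite /bumpf /s rdotBl !rdotBr (rdotC y z); congr (pos_part _ ^+ 3); ring.
have := pos_part_cube (1 / 16 - rdot z z) s; rewrite -/(bumpf z) -/(U z).
have /andP[u0 u1] := pos_part_bound z.
have zy : `|rdot z y| <= 3 / 8 * enorm y.
  by apply: le_trans (rdot_CS _ _) _; rewrite ler_wpM2r ?enorm_ge0.
have yy := sqr_enorm y; have y0 := enorm_ge0 y.
have s1 : `|s| <= enorm y.
  apply: le_trans (ler_normB _ _) _; rewrite normrM normr_nat -yy (ger0_norm (sqr_ge0 _)).
  have : enorm y ^+ 2 <= 1 / 8 * enorm y by rewrite expr2 ler_wpM2r.
  by move: zy; lra.
have s3 : `|s| ^+ 3 <= enorm y ^+ 3 by rewrite ler_pXn2r ?nnegrE.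
have small : `|3 * U z * (- 4 * (rdot z y * rdot y y) + rdot y y ^+ 2)| <= enorm y ^+ 3.
  rewrite normrM ger0_norm ?mulr_ge0 // -yy.
  have H1 : `|- 4 * (rdot z y * enorm y ^+ 2) + (enorm y ^+ 2) ^+ 2| <= 2 * enorm y ^+ 3.
    apply: le_trans (ler_normD _ _) _.
    have -> : `|- 4 * (rdot z y * enorm y ^+ 2)| = 4 * (`|rdot z y| * enorm y ^+ 2).
      by rewrite !normrM normrN normr_nat (ger0_norm y0).
    rewrite (ger0_norm (sqr_ge0 _)).
    have H2 : `|rdot z y| * enorm y ^+ 2 <= 3 / 8 * enorm y ^+ 3.
      rewrite (_ : 3 / 8 * _ = 3 / 8 * enorm y * enorm y ^+ 2); last by ring.
      by rewrite ler_wpM2r ?sqr_ge0.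
    have H3 : (enorm y ^+ 2) ^+ 2 <= 1 / 8 * enorm y ^+ 3.
      have -> : (enorm y ^+ 2) ^+ 2 = enorm y * enorm y ^+ 3 by ring.
      by rewrite ler_wpM2r ?exprn_ge0.
    have : 0 <= enorm y ^+ 3 by rewrite exprn_ge0.
    by move: H2 H3; lra.
  have : 0 <= enorm y ^+ 3 by rewrite exprn_ge0.
  move: H1 u0 u1; move: (`|_|) (enorm y ^+ 3) (U z) => n1 n2 n3 H1 H2 H3 H4.
  by nra.
set P1 := pos_part _ ^+ 3; set P2 := bumpf z => c1.
have -> : P1 - (P2 + 6 * U z ^+ 2 * rdot z y +
    (- 3 * U z ^+ 2 * rdot y y + 12 * U z * (rdot z y * rdot z y))) =
  (P1 - (P2 + 3 * U z ^+ 2 * s + 3 * U z * s ^+ 2)) +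
  3 * U z * (- 4 * (rdot z y * rdot y y) + rdot y y ^+ 2).
  by rewrite /s; ring.
apply: le_trans (ler_normD _ _) _.
have := le_trans c1 s3; move: small; lra.
Qed.

End Expansion.

(** * Positivity of the Levi form *)

Section Levi.
Variable R : realType.

Lemma rlin_iZ m (l : 'rV[R[i]]_m -> R) : rlin l -> rlin (fun x => l ('i *: x)).
Proof.
by move=> H s x y; rewrite scalerDr scalerA mulrC -scalerA H.
Qed.

(** Twice the hermitian part of [B] is invariant under complex numbers of modulus 1. *)
Lemma levi_circ m (B : 'rV[R[i]]_m -> 'rV[R[i]]_m -> R) (t : R) y :
  (forall x, rlin (B x)) -> (forall x y, B x y = B y x) ->
  let w := circ 1 t *: y in
  B w w + B ('i *: w) ('i *: w) = B y y + B ('i *: y) ('i *: y).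
Proof.
move=> lB sB /=; set a := cos t; set b := sin t.
have ab : a ^+ 2 + b ^+ 2 = 1 by exact: cos2Dsin2.
have wE : circ 1 t *: y = a%:C *: y + b%:C *: ('i *: y).
  by rewrite complexZE /= !mul1r.
have iwE : 'i *: (circ 1 t *: y) = a%:C *: ('i *: y) + b%:C *: (- y).
  have sw (c : R[i]) (z : 'rV[R[i]]_m) : 'i *: (c *: z) = c *: ('i *: z).
    by rewrite scalerA mulrC -scalerA.
  by rewrite wE scalerDr !sw scaler_ii.
have Dr x u v : B x (u + v) = B x u + B x v by exact: rlinD.
have Zr x c u : B x (c%:C *: u) = c * B x u by exact: rlinZ.
have Dl x u v : B (u + v) x = B u x + B v x by rewrite !(sB _ x) Dr.
have Zl x c u : B (c%:C *: u) x = c * B u x by rewrite !(sB _ x) Zr.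
have ext u v c d : B (c%:C *: u + d%:C *: v) (c%:C *: u + d%:C *: v) =
   c ^+ 2 * B u u + 2 * c * d * B u v + d ^+ 2 * B v v.
  rewrite !(Dr, Dl, Zr, Zl) (sB v u); ring.
rewrite iwE wE !ext (rlinN _ (lB _)) (rlinN _ (lB _)) (sB (- y)) (rlinN _ (lB _)) (sB ('i *: y) y).
have -> : B y y + B ('i *: y) ('i *: y) = (a ^+ 2 + b ^+ 2) * (B y y + B ('i *: y) ('i *: y)).
  by rewrite ab mul1r.
ring.
Qed.

(** A function with a second order expansion and the submean value property has a
positive Levi form. Adding the inequality for [y], [iy], [-y] and [-iy] removes
the linear term and leaves the Levi form of each point of the circle, which by
[levi_circ] equals that of [y]; then [y] is scaled down to beat the cubic
error. *)
Lemma levi_ge0 m (G : 'rV[R[i]]_m -> R) (l : 'rV[R[i]]_m -> R)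
    (B : 'rV[R[i]]_m -> 'rV[R[i]]_m -> R) (K : R) :
  0 <= K -> rlin l -> (forall x, rlin (B x)) -> (forall x y, B x y = B y x) ->
  (forall y, enorm y <= 1 / 8 -> G y <= G 0 + l y + B y y + K * enorm y ^+ 3) ->
  (forall e : R, 0 < e -> exists2 N : nat, (0 < N)%N & forall y, enorm y <= 1 / 8 ->
     G 0 <= N%:R^-1 * (\sum_(j < N) G (circ 1 (j%:R * (2 * pi / N%:R)) *: y)) + e) ->
  forall y, 0 <= B y y + B ('i *: y) ('i *: y).
Proof.
move=> K0 ll lB sB taylor npoint.
pose L y := B y y + B ('i *: y) ('i *: y).
have step1 y : enorm y <= 1 / 8 -> 0 <= 2 * L y + 4 * K * enorm y ^+ 3.
  move=> y8; rewrite leNgt; apply/negP => neg.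
  pose e := - (2 * L y + 4 * K * enorm y ^+ 3) / 8.
  have e0 : 0 < e by rewrite divr_gt0 // oppr_gt0.
  have [N N0 HN] := npoint e e0.
  have N0' : (0 : R) < N%:R by rewrite ltr0n.
  pose w (j : nat) := circ 1 (j%:R * (2 * pi / N%:R)) *: y.
  have wy j : enorm (w j) = enorm y by rewrite enorm_circ // mul1r.
  have four j : G (w j) + G ('i *: w j) + (G (- w j) + G ('i *: (- w j))) <=
      4 * G 0 + (2 * L y + 4 * K * enorm y ^+ 3).
    have T z : enorm z = enorm y -> G z <= G 0 + l z + B z z + K * enorm y ^+ 3.
      by move=> zy; rewrite -zy; apply: taylor; rewrite zy.
    have := T (w j) (wy j); have := T ('i *: w j) (etrans (enorm_iZ _) (wy j)).
    have := T (- w j) (etrans (enormN _) (wy j)).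
    have := T ('i *: (- w j)) (etrans (enorm_iZ _) (etrans (enormN _) (wy j))).
    have := levi_circ (j%:R * (2 * pi / N%:R)) y lB sB; rewrite /= -/(w j) -/(L y).
    have lN z : l (- z) = - l z by exact: rlinN.
    have BN z : B (- z) (- z) = B z z.
      by rewrite (rlinN _ (lB _)) sB (rlinN _ (lB _)) opprK.
    rewrite scalerN !lN !BN; move: (w j) => z.
    rewrite -/(L y); move: (enorm y ^+ 3) (L y) => t1 t2.
    by clear; lra.
  have yi8 : enorm ('i *: y) <= 1 / 8 by rewrite enorm_iZ.
  have yN8 : enorm (- y) <= 1 / 8 by rewrite enormN.
  have yNi8 : enorm ('i *: (- y)) <= 1 / 8 by rewrite enorm_iZ enormN.
  have swi (c : R[i]) (z : 'rV[R[i]]_m) : c *: ('i *: z) = 'i *: (c *: z).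
    by rewrite scalerA mulrC -scalerA.
  have [S SE] : {S | forall u, \sum_(j < N) G (circ 1 (j%:R * (2 * pi / N%:R)) *: u) = S u}.
    by exists (fun u => \sum_(j < N) G (circ 1 (j%:R * (2 * pi / N%:R)) *: u)).
  have sum4 : N%:R^-1 * (S y + S ('i *: y) + (S (- y) + S ('i *: (- y))))
     <= 4 * G 0 + (2 * L y + 4 * K * enorm y ^+ 3).
    rewrite ler_pdivrMl // (mulr_natl _ N) -!SE -!big_split /=.
    apply: le_trans (_ : \sum_(j < N) (4 * G 0 + (2 * L y + 4 * K * enorm y ^+ 3)) <= _).
      by apply: ler_sum => j _; rewrite !swi scalerN; exact: four.
    by rewrite sumr_const card_ord.
  have := HN y y8; have := HN _ yi8; have := HN _ yN8; have := HN _ yNi8.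
  move: sum4 neg e0; rewrite /e !SE !mulrDr.
  by move: (4 * K * _) => t; clear; lra.
move=> y; rewrite leNgt -/(L y); apply/negP => neg.
have LZ (s : R) : L (s%:C *: y) = s ^+ 2 * L y.
  have BZ z : B (s%:C *: z) (s%:C *: z) = s ^+ 2 * B z z.
    by rewrite (rlinZ _ _ (lB _)) sB (rlinZ _ _ (lB _)) mulrA expr2.
  have si : 'i *: (s%:C *: y) = s%:C *: ('i *: y) by rewrite scalerA mulrC -scalerA.
  by rewrite /L si !BZ mulrDr.
pose Y := enorm y; have Y0 : 0 <= Y by exact: enorm_ge0.
pose D := 2 * K * Y ^+ 3 + 1.
have D0 : 0 < D by rewrite ltr_wpDl // mulr_ge0 ?exprn_ge0 // mulr_ge0.
(* [s y] stays in the domain of the expansion, and [4 K (s Y)^3] is less than [- 2 s^2 L y]. *)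
pose s := Num.min (1 / (8 * (Y + 1))) (- L y / (2 * D)).
have Y1 : 0 < Y + 1 by rewrite ltr_wpDl.
have s0 : 0 < s by rewrite lt_min !divr_gt0 ?mulr_gt0 ?oppr_gt0.
have s1 : s * (8 * (Y + 1)) <= 1 by rewrite -ler_pdivlMr ?mulr_gt0 // ge_min lexx.
have s2 : s * (2 * D) <= - L y by rewrite -ler_pdivlMr ?mulr_gt0 // ge_min lexx orbT.
have := step1 (s%:C *: y); rewrite LZ enorm_realZ (gtr0_norm s0) -/Y => /(_ _).
have H8 : s * Y <= 1 / 8 by move: s1 s0; clear; nra.
move=> /(_ H8).
have -> : 2 * (s ^+ 2 * L y) + 4 * K * (s * Y) ^+ 3 = (2 * s ^+ 2) * (L y + s * (D - 1)).
  by rewrite /D; ring.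
rewrite pmulr_rge0; last by rewrite mulr_gt0 ?exprn_gt0.
by move: s2 s0 neg D0; clear; nra.
Qed.

End Levi.

(** * Smoothing of plurisubharmonic functions *)

Section CircleSums.
Variable R : realType.

Lemma cos_sin_lip (s t : R) : s <= t -> `|cos t - cos s| <= t - s /\ `|sin t - sin s| <= t - s.
Proof.
rewrite le_eqVlt => /predU1P[->|st]; first by rewrite !subrr normr0.
split.
  have [|c _ ->] := @MVT R cos (fun c => - sin c) s t st.
  - by apply: continuous_subspaceT; exact: continuous_cos.
  rewrite normrM (gtr0_norm (_ : 0 < t - s)) ?subr_gt0 //.
  by rewrite -[leRHS]mul1r ler_wpM2r ?subr_ge0 ?(ltW st) // normrN ler_norml sin_geN1 sin_le1.
have [|c _ ->] := @MVT R sin cos s t st.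
- by apply: continuous_subspaceT; exact: continuous_sin.
rewrite normrM (gtr0_norm (_ : 0 < t - s)) ?subr_gt0 //.
by rewrite -[leRHS]mul1r ler_wpM2r ?subr_ge0 ?(ltW st) // ler_norml cos_geN1 cos_le1.
Qed.

Lemma circ_lip n (s t : R) (b : 'rV[R[i]]_n) : s <= t ->
  enorm (circ 1 t *: b - circ 1 s *: b) <= 2 * (t - s) * enorm b.
Proof.
move=> st; have [H1 H2] := cos_sin_lip st.
rewrite -scalerBl complexZE; apply: le_trans (ler_enormD _ _) _.
rewrite !enorm_realZ enorm_iZ -mulrDl ler_wpM2r ?enorm_ge0 //.
rewrite /= !mul1r; move: H1 H2; clear; lra.
Qed.

(** The submean value inequality with finite sums, with a number of points that does
not depend on the centre: this makes it compatible with a functional that is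
additive but not continuous. *)
Lemma psh_circle_sum n (V : set 'rV[R[i]]_n) (h : 'rV[R[i]]_n -> R) (p : 'rV[R[i]]_n) (d : R) :
  open V -> 0 < d -> closed_eball p (d / 2) `<=` V -> (forall x, V x -> econt h x) ->
  plurisubharmonic V (fun z => (h z)%:E) ->
  forall e : R, 0 < e -> exists2 N : nat, (0 < N)%N & forall x y,
    enorm x <= 3 / 8 -> enorm y <= 1 / 8 ->
    h (p + d%:C *: x) <= N%:R^-1 *
      (\sum_(j < N) h (p + d%:C *: (x + circ 1 (j%:R * (2 * pi / N%:R)) *: y))) + e.
Proof.
move=> oV d0 BV ch /(pshP oV ch) H e e0.
have [dl dl0 Hdl] := unif_cont (@compact_closed_eball R n p (d / 2)) (fun x Bx => ch x (BV x Bx)) e0.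
pose P : R := 2 * pi; have P0 : 0 < P by rewrite mulr_gt0 // pi_gt0.
pose N := (Num.truncn (P * d / dl)).+1.
have N0 : (0 : R) < N%:R by rewrite ltr0n.
have HN : P / N%:R * d < dl.
  rewrite mulrAC ltr_pdivrMr // (mulrC dl) -ltr_pdivrMr //.
  by rewrite /N truncnS_gt.
exists N => // x y x8 y8; rewrite -/P.
have d_ge0 := ltW d0.
have ball_ok (z : R[i]) : `|z| <= 1%:C -> closed_eball p (d / 2) (p + d%:C *: x + z *: (d%:C *: y)).
  rewrite [ `|z|]/(_%:C) lecR => z1.
  rewrite /closed_eball /= (addrAC _ _ (- p)) (addrAC p) subrr add0r.
  rewrite scalerA mulrC -scalerA -scalerDr enorm_realZ ger0_norm //.
  rewrite ler_pM2l //.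
  apply: le_trans (ler_enormD _ _) _; rewrite enormZ.
  have : ComplexField.Normc.normc z * enorm y <= 1 * (1 / 8).
    by apply: ler_pM => //; [exact: normc_ge0|exact: enorm_ge0].
  by move: x8; clear; lra.
have circ1 t : `|circ 1 t| <= 1%:C :> R[i] by rewrite normc_circ.
have E t : d%:C *: (x + circ 1 t *: y) = d%:C *: x + (0 + circ 1 t) *: (d%:C *: y).
  by rewrite add0r scalerDr !scalerA (mulrC d%:C).
have := H (p + d%:C *: x) (d%:C *: y) 0 1 ltr01.
rewrite scale0r addr0 => /(_ _) H1.
apply: le_trans (H1 _) _.
  by move=> z; rewrite subr0 => z1; apply/BV/ball_ok.
apply: le_trans (rmean_le_sum (N := N) (e := e) _ _ _) _ => //.
- apply: circ_continuous => t; apply/ch/BV; rewrite add0r; apply: ball_ok; exact: circ1.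
- move=> j t jN /andP[jt tj]; rewrite -/P in jt tj *; rewrite -lerBlDl.
  apply/ltW/ltr_normlW/Hdl; first by rewrite add0r; apply: ball_ok; exact: circ1.
  rewrite opprD addrACA subrr !add0r; apply: le_lt_trans (circ_lip _ jt) _.
  rewrite enorm_realZ ger0_norm //; apply: le_lt_trans HN.
  have H2 : t - j%:R * (P / N%:R) <= P / N%:R.
    by move: tj; rewrite -natr1 mulrDl mul1r; clear; lra.
  have H3 : 0 <= t - j%:R * (P / N%:R) by rewrite subr_ge0.
  have H4 : 2 * (d * enorm y) <= d.
    have := ler_wpM2l d_ge0 y8; move: d_ge0; clear; lra.
  have comm3 (u v : R) : 2 * u * v = u * (2 * v) by ring.
  rewrite comm3.
  by apply: ler_pM => //; rewrite mulr_ge0 // mulr_ge0 // enorm_ge0.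
- rewrite lerD2r ler_wpM2l ?invr_ge0 ?(ltW N0) //.
  by apply: ler_sum => j _; rewrite E addrA.
Qed.

End CircleSums.

Section Smoothing.
Variable R : realType.

(** Turns the distance from a compact set to the complement of an open one into a
case of uniform continuity. *)
Lemma econt_indic n (V : set 'rV[R[i]]_n) x : open V -> V x ->
  econt (fun y => if y \in V then 1 else 0 : R) x.
Proof.
move=> /open_enormP oV Vx e e0; have [d d0 Hd] := oV x Vx.
by exists d => // y /Hd Vy; rewrite !ifT ?inE // subrr normr0.
Qed.

Lemma compact_margin n (V : set 'rV[R[i]]_n) (K : set 'rV[R[i]]_n) : open V -> compact K ->
  K `<=` V -> exists2 d : R, 0 < d & forall x y, K x -> enorm (y - x) < d -> V y.
Proof.
move=> oV cK KV.
have [d d0 Hd] := unif_cont cK (fun x Kx => econt_indic oV (KV x Kx)) (@ltr01 R).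
exists d => // x y Kx /(Hd x y Kx); rewrite (mem_set (KV x Kx)).
by case: ifPn => [|_]; [rewrite inE|rewrite sub0r normrN normr1 ltxx].
Qed.

(** Convolution at scale [d]. The quadratic part [B] of the expansion at [p] is the
sum of the form [b (x, y) = (B (x, y) - B (ix, iy)) / 2] and of half the Levi
form; dropping the latter, which is nonnegative by [levi_ge0], leaves a minorant
with pluriharmonic quadratic part. *)
Lemma psh_smoothing n (c : 'rV[R[i]]_n) (r : R) (V : set 'rV[R[i]]_n) (h : 'rV[R[i]]_n -> R) :
  open V -> closed_eball c r `<=` V -> (forall x, V x -> econt h x) ->
  plurisubharmonic V (fun z => (h z)%:E) -> forall eta : R, 0 < eta ->
  exists g : 'rV[R[i]]_n -> R, [/\ forall p, closed_eball c r p -> `|g p - h p| <= eta,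
    forall p, closed_eball c r p -> econt g p &
    forall p, closed_eball c r p -> exists l b (C rho : R),
      [/\ rlin l, plform b, 0 <= C, 0 < rho & forall y, enorm y <= rho ->
        g p + l y + b y y - C * enorm y ^+ 3 <= g (p + y)]].
Proof.
move=> oV BV ch pshh eta eta0.
have cB := @compact_closed_eball R n c r.
have [d1 d10 Hd1] := compact_margin oV cB BV.
have [d2 d20 Hd2] := unif_cont cB (fun x Bx => ch x (BV x Bx)) eta0.
have [d [d0 dd1 dd2]] : exists d : R, [/\ 0 < d, d < d1 & d < d2].
  exists (Num.min d1 d2 / 2).
  have m0 : 0 < Num.min d1 d2 by rewrite lt_min d10.
  have m1 : Num.min d1 d2 <= d1 by rewrite ge_min lexx.
  have m2 : Num.min d1 d2 <= d2 by rewrite ge_min lexx orbT.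
  by move: m0 m1 m2; clear; split; lra.
have d_ge0 := ltW d0.
have dC : d%:C != 0 :> R[i] by apply/eqP => -[]; apply/eqP; rewrite gt_eqF.
have BV2 p : closed_eball c r p -> closed_eball p d `<=` V.
  by move=> Bp y yp; apply: (Hd1 p) => //; exact: le_lt_trans yp dd1.
have BV3 p : closed_eball c r p -> closed_eball p (d / 2) `<=` V.
  move=> Bp y yp; apply: (BV2 p Bp); rewrite /closed_eball /= in yp *.
  by move: yp d0; clear; lra.
have scale_le x : enorm (d%:C *: x) = d * enorm x by rewrite enorm_realZ ger0_norm.
have osc p z : closed_eball c r p -> enorm z <= 1 / 2 -> `|h (p + d%:C *: z) - h p| <= eta.
  move=> Bp z2; apply/ltW/Hd2 => //; rewrite addrAC subrr add0r scale_le.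
  apply: le_lt_trans dd2; rewrite -[leRHS]mulr1 ler_wpM2l //.
  by move: z2; clear; lra.
have [Lam [LamD LamZ Lam0 Lam1 LamT]] := @bump_functional R n.
pose g q := Lam (fun x => h (q + d%:C *: x) * bumpf x).
have bbump := @bounded_in_bump R n.
have bh p : closed_eball c r p -> bounded_in (fun x => h (p + d%:C *: x)).
  move=> Bp; exists (`|h p| + eta) => x x8.
  have x2 : enorm x <= 1 / 2 by move: x8; clear; lra.
  rewrite -[h (p + _)](subrK (h p)) addrC; apply: le_trans (ler_normD _ _) _.
  by rewrite lerD2l osc.
have Lcst a : Lam (fun x => a * bumpf x) = a by rewrite LamZ // Lam1 mulr1.
have bcst a : bounded_in (fun x : 'rV[R[i]]_n => a * bumpf x) by exact: bounded_inZ.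
have Lle := Lam_le LamD LamZ Lam0.
have bump_mono (a b : R) (x : 'rV[R[i]]_n) : a <= b -> a * bumpf x <= b * bumpf x.
  by move=> ab; rewrite ler_wpM2r // bumpf_ge0.
exists g; split.
- move=> p Bp; have bhp := bounded_inM (bh p Bp) bbump.
  suff [H1 H2] : h p - eta <= g p /\ g p <= h p + eta.
    by rewrite ler_norml; move: H1 H2; clear => *; apply/andP; lra.
  split.
    rewrite -[leLHS]Lcst /g; apply: Lle => // x x8; apply: bump_mono.
    have x2 : enorm x <= 1 / 2 by move: x8; clear; lra.
    by have := osc p x Bp x2; rewrite ler_norml => /andP[]; clear; lra.
  rewrite -[leRHS]Lcst /g; apply: Lle => // x x8; apply: bump_mono.
  have x2 : enorm x <= 1 / 2 by move: x8; clear; lra.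
  by have := osc p x Bp x2; rewrite ler_norml => /andP[]; clear; lra.
- move=> p Bp e e0; have e20 : 0 < e / 2 by rewrite divr_gt0.
  have [d3 d30 Hd3] := unif_cont (@compact_closed_eball R n p (d / 2))
    (fun x Bx => ch x (BV3 p Bp x Bx)) e20.
  exists d3 => // q qp.
  have close x : enorm x <= 3 / 8 -> `|h (q + d%:C *: x) - h (p + d%:C *: x)| < e / 2.
    move=> x8; apply: Hd3.
      rewrite /closed_eball /= addrAC subrr add0r scale_le ler_wpM2l //.
      by move: x8; clear; lra.
    by rewrite opprD addrACA subrr addr0.
  have bhp := bounded_inM (bh p Bp) bbump.
  have bhq : bounded_in (fun x => h (q + d%:C *: x) * bumpf x).
    apply: bounded_inM => //; have [C HC] := bh p Bp; exists (C + e / 2) => x x8.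
    rewrite -[h (q + _)](subrK (h (p + d%:C *: x))) addrC; apply: le_trans (ler_normD _ _) _.
    by apply: lerD; [exact: HC|exact/ltW/close].
  have bD := bounded_inD bhp (bcst (e / 2)).
  have bD' := bounded_inD bhp (bcst (- (e / 2))).
  have H1 : g q <= g p + e / 2.
    rewrite -[X in _ <= _ + X]Lcst /g -LamD //; apply: Lle => // x x8.
    rewrite -mulrDl; apply: bump_mono.
    by have := close x x8; rewrite ltr_norml => /andP[]; clear; lra.
  have H2 : g p + - (e / 2) <= g q.
    rewrite -[X in _ + X <= _]Lcst /g -LamD //; apply: Lle => // x x8.
    rewrite -mulrDl; apply: bump_mono.
    by have := close x x8; rewrite ltr_norml => /andP[]; clear; lra.
  by rewrite ltr_norml; move: H1 H2 e0; clear => *; apply/andP; lra.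
move=> p Bp; pose H z := h (p + d%:C *: z); pose CH := `|h p| + eta.
have H_bound z : enorm z <= 1 / 2 -> `|H z| <= CH.
  move=> z2; rewrite /H -[h (p + _)](subrK (h p)) addrC; apply: le_trans (ler_normD _ _) _.
  by rewrite lerD2l osc.
have gE y : g (p + d%:C *: y) = smooth Lam H y.
  rewrite /g /smooth; congr (Lam _); apply/funext => x; rewrite /H scalerDr -addrA.
  by rewrite (addrC (d%:C *: y)).
have taylor := smooth_taylor LamD LamZ Lam0 LamT H_bound.
have llin := rlin_smooth_lin LamD LamZ H_bound.
have lbil := rlin_smooth_bil LamD LamZ H_bound.
have bound := smooth_bil_bound LamD LamZ Lam0 H_bound.
have symB := smooth_bilC Lam H.
set lin := smooth_lin Lam H in taylor llin.
set B := smooth_bil Lam H in taylor lbil bound symB.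
set L1 := Lam (fun=> 1) in taylor bound.
have L10 : 0 <= L1 by exact: Lam1_ge0 Lam0.
have CH0 : 0 <= CH by rewrite addr_ge0 // ltW.
have K0 : 0 <= 2 * CH * L1 by rewrite !mulr_ge0.
have levi := @levi_ge0 R n (smooth Lam H) lin B (2 * CH * L1) K0 llin lbil symB.
have {}levi : forall y, 0 <= B y y + B ('i *: y) ('i *: y).
  apply: levi.
    move=> y /taylor; rewrite ler_norml => /andP[_]; clear; lra.
  move=> e e0; have [N N0 HN] := psh_circle_sum oV d0 (BV3 p Bp) ch pshh e0.
  exists N => // y y8.
  have circ8 (t : R) : enorm (circ 1 t *: y) <= 1 / 8 by rewrite enorm_circ // (mul1r (enorm y)).
  have bF (j : nat) : bounded_in (fun x => H (x + circ 1 (j%:R * (2 * pi / N%:R)) *: y) * bumpf x).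
    by apply: bounded_inM => //; exact: bounded_in_shift H_bound _ (circ8 _).
  have [S1 S2] := Lam_sum LamD LamZ N bF.
  have S3 := bounded_inZ (N%:R^-1) S2.
  rewrite /smooth -S1 -LamZ // -[X in _ <= _ + X]Lcst -LamD //.
  apply: Lle; last 1 first.
  - move=> x x8; rewrite addr0 -mulr_suml mulrA -mulrDl; apply: bump_mono.
    exact: HN.
  - by apply: bounded_inM => //; apply: (bounded_in_shift H_bound); rewrite enorm0.
  - exact: bounded_inD.
pose sc (y : 'rV[R[i]]_n) := d^-1%:C *: y.
have scL (s : R) x y : sc (s%:C *: x + y) = s%:C *: sc x + sc y.
  by rewrite /sc scalerDr !scalerA mulrC.
have sc_i x : sc ('i *: x) = 'i *: sc x by rewrite /sc !scalerA mulrC.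
have nsc x : enorm (sc x) = d^-1 * enorm x by rewrite /sc enorm_realZ ger0_norm // invr_ge0.
exists (fun y => lin (sc y)), (fun x y => (B (sc x) (sc y) - B ('i *: sc x) ('i *: sc y)) / 2),
  (2 * CH * L1 * d^-1 ^+ 3), (d / 8); split.
- by move=> s x y; rewrite scL llin.
- split.
  + move=> z s x y; have E := rlin_iZ (lbil ('i *: sc z)) s (sc x) (sc y).
    by rewrite scL lbil E; move: (B _ _) (B _ _) (B _ _) (B _ _) => t1 t2 t3 t4; clear; lra.
  + by move=> x y; rewrite symB (symB ('i *: sc x)).
  + move=> x y; rewrite !sc_i !scaler_ii.
    rewrite (rlinN _ (lbil _)) (symB (- _)) (rlinN _ (lbil _)) (symB (sc y)).
    by move: (B _ _) (B _ _) => t1 t2; clear; lra.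
  + exists (5 * CH * L1 * d^-1 ^+ 2); first by rewrite !mulr_ge0 ?invr_ge0.
    move=> x y.
    have b1 := bound (sc x) (sc y); have b2 := bound ('i *: sc x) ('i *: sc y).
    rewrite !enorm_iZ in b2; rewrite !nsc in b1 b2.
    rewrite normrM (ger0_norm (_ : 0 <= 2^-1)) //.
    have := ler_normB (B (sc x) (sc y)) (B ('i *: sc x) ('i *: sc y)).
    have -> : 5 * CH * L1 * d^-1 ^+ 2 * (enorm x * enorm y) = 5 * CH * L1 * (d^-1 * enorm x * (d^-1 * enorm y)) by ring.
    by move: b1 b2; move: (_ * (_ * enorm x * _)) => t1; clear; lra.
- by rewrite mulr_ge0 // exprn_ge0 // invr_ge0.
- by rewrite divr_gt0.
- move=> y y8; have yE : y = d%:C *: sc y.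
    by rewrite /sc scalerA -rmorphM /= divff ?gt_eqF // scale1r.
  have sy8 : enorm (sc y) <= 1 / 8 by rewrite nsc mulrC ler_pdivrMr // mulrC mulrA mulr1.
  have gp : g p = smooth Lam H 0 by rewrite -gE scaler0 addr0.
  have gy : g (p + y) = smooth Lam H (sc y) by rewrite -gE -yE.
  rewrite gy gp; have := taylor (sc y) sy8; rewrite ler_norml nsc => /andP[+ _].
  have := levi (sc y).
  have -> : 2 * CH * L1 * d^-1 ^+ 3 * enorm y ^+ 3 = 2 * CH * L1 * (d^-1 * enorm y) ^+ 3 by ring.
  move: (2 * CH * L1 * _) => t1; clear; lra.
Qed.

End Smoothing.

(** * Quadratic barriers contradict pseudoconvexity *)

Section Barrier.
Variable R : realType.
Local Opaque eucl_dist enorm rdot.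

Lemma bilin_sqrD m (b : 'rV[R[i]]_m -> 'rV[R[i]]_m -> R) x y :
  (forall z, rlin (b z)) -> (forall x y, b x y = b y x) ->
  b (x + y) (x + y) = b x x + 2 * b x y + b y y.
Proof.
move=> lb sb; rewrite (rlinD _ _ (lb _)) !(sb (x + y)) !(rlinD _ _ (lb _)) (sb y x).
by move: (b _ _) (b _ _) (b _ _) => t1 t2 t3; lra.
Qed.

Lemma plform_sqrD m (b : 'rV[R[i]]_m -> 'rV[R[i]]_m -> R) x y : plform b ->
  b (x + y) (x + y) = b x x + 2 * b x y + b y y.
Proof. by move=> [lb sb _ _]; exact: bilin_sqrD. Qed.

Lemma plh_plform m (b : 'rV[R[i]]_m -> 'rV[R[i]]_m -> R) : plform b -> plh (fun x => b x x).
Proof.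
move=> pb; have [lb sb ib _] := pb => x y.
have Dr u v t : b u (v + t) = b u v + b u t by exact: rlinD.
have Zr u (c : R) v : b u (c%:C *: v) = c * b u v by exact: rlinZ.
have Dl u v t : b (v + t) u = b v u + b t u by rewrite !(sb _ u) Dr.
have Zl u (c : R) v : b (c%:C *: v) u = c * b v u by rewrite !(sb _ u) Zr.
exists (b x x), (2 * b x y +i* - (2 * b x ('i *: y))), (b y y +i* - b y ('i *: y)) => z.
rewrite plform_sqrD //; set w := z *: y.
have wE : w = (complex.Re z)%:C *: y + (complex.Im z)%:C *: ('i *: y) by exact: complexZE.
have -> : b x w = complex.Re z * b x y + complex.Im z * b x ('i *: y).
  by rewrite wE lb (rlinZ _ _ (lb x)).
have -> : b w w = complex.Re z ^+ 2 * b y y + 2 * (complex.Re z * complex.Im z) * b y ('i *: y)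
   - complex.Im z ^+ 2 * b y y.
  by rewrite wE !(Dr, Dl, Zr, Zl) ib (sb ('i *: y) y); ring.
by rewrite !(cReM, cImM) /=; ring.
Qed.

Lemma econt_bilin m (b : 'rV[R[i]]_m -> 'rV[R[i]]_m -> R) (C : R) x :
  (forall z, rlin (b z)) -> (forall x y, b x y = b y x) -> 0 <= C ->
  (forall x y, `|b x y| <= C * (enorm x * enorm y)) -> econt (fun x => b x x) x.
Proof.
move=> lb sb C0 HC e e0.
have [K KE] : exists K, K = C * (2 * enorm x + 1) + 1 by exists (C * (2 * enorm x + 1) + 1).
have x0 := enorm_ge0 x.
have K0 : 0 < K by rewrite KE ltr_wpDl // mulr_ge0 // addr_ge0 // mulr_ge0.
exists (Num.min 1 (e / K)); first by rewrite lt_min ltr01 divr_gt0.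
move=> y; rewrite lt_min => /andP[y1]; rewrite ltr_pdivlMr // => yK.
have -> : b y y - b x x = b (y - x) (y - x) + 2 * b x (y - x).
  have := bilin_sqrD x (y - x) lb sb; rewrite addrC subrK => ->.
  by move: (b _ _) (b _ _) (b _ _) => *; lra.
apply: le_lt_trans (ler_normD _ _) _; rewrite normrM normr_nat.
have := HC (y - x) (y - x); have := HC x (y - x).
move: (b _ _) (b _ _) => t1 t2; have := enorm_ge0 (y - x).
move: (enorm (y - x)) (enorm x) x0 y1 yK KE => s u u0 s1 sK KE s0 H1 H2.
apply: le_lt_trans sK; rewrite KE.
have : C * (s * s) <= C * (s * 1) by rewrite ler_wpM2l // ler_wpM2l // ltW.
lra.
Qed.

Lemma econt_plform m (b : 'rV[R[i]]_m -> 'rV[R[i]]_m -> R) x : plform b ->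
  econt (fun x => b x x) x.
Proof. by move=> [lb sb _ [C C0 HC]]; exact: (econt_bilin x lb sb C0 HC). Qed.

(** A frame of the directions orthogonal to [v], built one vector at a time. *)
Lemma unitary_orthogonal m k (v : 'rV[R[i]]_m.+1) : (k <= m)%N ->
  exists2 E : 'M[R[i]]_(k, m.+1), E \is unitarymx & E *m v ^t* = 0.
Proof.
elim: k => [_|k IH km].
  by exists 0; [apply/unitarymxP|]; apply/matrixP => -[].
have [E uE Ev] := IH (ltnW km).
have [//|e [e1 eM]] := @unit_orthogonal _ _ _ (col_mx v E : 'M[R[i]]_(1 + k, m.+1)).
move: eM; rewrite tr_col_mx map_row_mx mul_mx_row => /eqP; rewrite row_mx_eq0 => /andP[/eqP ev /eqP eE].
exists (col_mx e E : 'M[R[i]]_(1 + k, m.+1)); first exact: col_mx_unitary.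
by apply: etrans (mul_col_mx e E (v ^t*)) _; rewrite ev Ev col_mx0.
Qed.

(** [exp h <= 1 + h + 2 h^2] for small [h], stated for the logarithm. *)
Lemma ln_gt_of_quadratic (t h : R) : `|h| <= 1 / 2 -> 1 + h + 2 * h ^+ 2 < t -> h < ln t.
Proof.
rewrite ler_norml => /andP[h1 h2] ht.
have t0 : 0 < t by have := sqr_ge0 h; lra.
have := lnB_le t0 ltr01; rewrite ln1 sub0r.
have : (1 - t) / t < - h.
  rewrite ltr_pdivrMr //.
  have : 0 < (1 - h) * (t - (1 + h + 2 * h ^+ 2)) by rewrite mulr_gt0 //; lra.
  have : 0 <= h ^+ 2 * (1 - 2 * h) by rewrite mulr_ge0 ?sqr_ge0 //; lra.
  rewrite !expr2; lra.
lra.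
Qed.

(** Consider the slice of dimension p+1 through [x0 + tau N] in the directions of [A]
orthogonal to [N], and the pluriharmonic function [h(z) = b(zE, zE) / tau] on the
ball of radius [c sqrt tau]. The barrier forces
[dist >= tau (1 + h + ep |z|^2 / (2 tau) - small)]; on the sphere the quadratic
term wins and [h - ln dist < - ln tau], whereas at the centre [dist <= tau]. This
contradicts the maximum principle for [- ln dist]. *)
Lemma no_unit_quadratic_barrier n p (X : set 'rV[R[i]]_n) (A : 'M[R[i]]_(p.+2, n)) (x0 N : 'rV[R[i]]_n)
    (b : 'rV[R[i]]_p.+2 -> 'rV[R[i]]_p.+2 -> R) (ep K rho : R) :
  X !=set0 -> (p < n)%N -> pseudoconvex p (~` X) -> A \is unitarymx -> X x0 -> enorm N = 1 ->
  plform b -> 0 < ep -> 0 <= K -> 0 < rho ->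
  (forall xi, X (x0 + xi) -> enorm xi <= rho ->
    rdot xi N + b (xi *m A ^t*) (xi *m A ^t*) + ep * enorm (xi *m A ^t*) ^+ 2 <=
    K * enorm (xi - xi *m A ^t* *m A) ^+ 2) -> False.
Proof.
move=> X0 pn [_ _]; rewrite setCK => -[_ /(_ pn) HX] uA Xx0 N1 pb ep0 K0 rho0 Hq.
have [lb sb _ [C C0 HC]] := pb.
have [E uE EN] := unitary_orthogonal (N *m A ^t*) (leqnn p.+1).
have uEA : E *m A \is unitarymx by exact: mul_unitarymx.
have NE : (N *m A ^t*) *m E ^t* = 0.
  by rewrite -[LHS]trmxCK trmx_mul map_mxM trmxCK EN trmx0 map_mx0.
have [c [c0 c1 c2 c3]] : exists c : R, [/\ 0 < c, c <= 1, (C + ep) * c <= 1 / 2 & 16 * C ^+ 2 * c <= ep].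
  have Ce : 0 < C + ep by rewrite ltr_wpDl.
  have C2 : 0 < 16 * C ^+ 2 + 1 by rewrite ltr_wpDl // mulr_ge0 ?sqr_ge0.
  (* [c] makes [h] small against 1 and [h^2] small against [ep c^2]. *)
  exists (Num.min 1 (Num.min (1 / (2 * (C + ep))) (ep / (16 * C ^+ 2 + 1)))).
  set c := Num.min _ _.
  have c0 : 0 < c by rewrite !lt_min ltr01 !divr_gt0 // mulr_gt0.
  have : c <= 1 / (2 * (C + ep)) by rewrite !ge_min lexx !orbT.
  have : c <= ep / (16 * C ^+ 2 + 1) by rewrite !ge_min lexx !orbT.
  rewrite !ler_pdivlMr ?mulr_gt0 // => H1 H2.
  split => //; first by rewrite ge_min lexx.
    by move: H2; clear; lra.
  by move: H1 c0; clear; lra.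
have cc : c ^+ 2 <= c by rewrite expr2 -[leRHS]mulr1 ler_wpM2l // ltW.
pose M := 6 * C * c + 9 * C + 9 * ep + 36 * K.
have M0 : 0 <= M by rewrite /M !addr_ge0 // ?mulr_ge0 // ltW.
(* [s] is the square root of [tau]; [M s] collects the errors in the bound for [dist]. *)
have [s [s0 s1 s2 s3 s4]] : exists s : R,
    [/\ 0 < s, s <= 1, M * s <= 1 / 4, M * s <= ep * c ^+ 2 / 8 & 4 * s <= rho].
  have M1 : 0 < M + 1 by rewrite ltr_wpDl.
  have c20 : 0 < ep * c ^+ 2 by rewrite mulr_gt0 ?exprn_gt0.
  exists (Num.min 1 (Num.min (1 / (4 * (M + 1))) (Num.min (ep * c ^+ 2 / (8 * (M + 1))) (rho / 4)))).
  set s := Num.min _ _.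
  have s0 : 0 < s by rewrite !lt_min ltr01 !divr_gt0 // mulr_gt0.
  have : s <= 1 / (4 * (M + 1)) by rewrite !ge_min lexx !orbT.
  have : s <= ep * c ^+ 2 / (8 * (M + 1)) by rewrite !ge_min lexx !orbT.
  have : s <= rho / 4 by rewrite !ge_min lexx !orbT.
  rewrite !ler_pdivlMr ?mulr_gt0 // => H1 H2 H3.
  split => //; first by rewrite ge_min lexx.
  - by move: H3 s0; clear; lra.
  - by move: H2 s0; clear; lra.
  - by move: H1; clear; lra.
have [tau tauE] : exists tau, tau = s ^+ 2 by exists (s ^+ 2).
have tau0 : 0 < tau by rewrite tauE exprn_gt0.
have [h hE] : {h | forall z : 'rV[R[i]]_p.+1, h z = tau^-1 * b (z *m E) (z *m E)}.
  by exists (fun z => tau^-1 * b (z *m E) (z *m E)).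
have hplh : plh h.
  have -> : h = (fun z => tau^-1 * b (0 + z *m E) (0 + z *m E)).
    by apply/funext => z; rewrite hE add0r.
  apply: plhZ; exact: (plh_comp 0 E (plh_plform pb)).
have hcont z : econt h z.
  have -> : h = (fun z => tau^-1 * b (z *m E) (z *m E)) by apply/funext => y; rewrite hE.
  apply: econtZ; apply: (@econt_comp _ _ _ (fun x => b x x) (fun z => z *m E) z 1).
    by move=> y; rewrite -mulmxBl enorm_unitary // mul1r.
  exact: econt_plform.
have [D DE] : {D | forall z, eucl_dist X ((x0 + tau%:C *: N) + z *m (E *m A)) = D z}.
  by exists (fun z => eucl_dist X ((x0 + tau%:C *: N) + z *m (E *m A))).
have h_bound z : enorm z <= c * s -> `|h z| <= C * c ^+ 2.
  move=> zs; rewrite hE normrM ger0_norm ?invr_ge0 ?(ltW tau0) // ler_pdivrMl //.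
  apply: le_trans (HC _ _) _; rewrite enorm_unitary //.
  have : enorm z * enorm z <= (c * s) * (c * s) by apply: ler_pM => //; exact: enorm_ge0.
  by move=> /(ler_wpM2l C0); rewrite tauE !expr2; clear; lra.
have D_lower z : enorm z <= c * s ->
    tau * (1 + h z + ep * enorm z ^+ 2 / (2 * tau) - M * s) <= D z.
  move=> zs; rewrite -DE; apply: eucl_dist_ge => // x Xx.
  (* [e] joins a point [x0 + xi] of [X] to the point of the slice; only the case where
     [|e|] is below [2 tau] matters, and then [xi] is [tau N + z E A] up to [2 tau]. *)
  pose y := tau%:C *: N + z *m (E *m A); pose xi := x - x0; pose e := y - xi.
  have -> : x0 + tau%:C *: N + z *m (E *m A) - x = e.
    by rewrite /e /y /xi opprB -(addrA x0) (addrAC x0) addrC.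
  have Xxi : X (x0 + xi) by rewrite /xi addrC subrK.
  have z0 := enorm_ge0 z; have e0 := enorm_ge0 e.
  have hz := h_bound z zs; have hz' : h z <= C * c ^+ 2 by exact: le_trans (ler_norm _) hz.
  have z2 : enorm z ^+ 2 <= c ^+ 2 * tau.
    by rewrite tauE -exprMn ler_pXn2r ?nnegrE ?mulr_ge0 // ltW.
  have zt : ep * enorm z ^+ 2 / (2 * tau) <= ep * c ^+ 2 / 2.
    rewrite ler_pdivrMr ?mulr_gt0 //.
    by have := ler_wpM2l (ltW ep0) z2; clear; lra.
  have [e2|e2] := leP (2 * tau) (enorm e).
    apply: le_trans e2; rewrite [2 * tau]mulrC ler_wpM2l ?(ltW tau0) //.
    have H1 : (C + ep) * c ^+ 2 <= 1 / 2.
      by apply: le_trans c2; rewrite ler_wpM2l // addr_ge0 // ltW.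
    have H2 : 0 <= M * s by rewrite mulr_ge0 // ltW.
    have H3 : 0 <= ep * c ^+ 2 by rewrite mulr_ge0 ?sqr_ge0 // ltW.
    by move: hz' zt H1 H2 H3; clear; lra.
  have ss : tau <= s by rewrite tauE expr2 -[leRHS]mulr1 ler_wpM2l // ltW.
  have yn : enorm y <= tau + c * s.
    apply: le_trans (ler_enormD _ _) _; rewrite enorm_realZ N1 mulr1 gtr0_norm //.
    by rewrite enorm_unitary // lerD2l.
  have cs : c * s <= s by rewrite -[leRHS]mul1r ler_wpM2r // ltW.
  have xin : enorm xi <= rho.
    have -> : xi = y - e by rewrite /e opprB addrC subrK.
    apply: le_trans (ler_enormD _ _) _; rewrite enormN.
    by move: yn e2 ss cs s4; clear; lra.
  have := Hq xi Xxi xin.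
  pose w := tau%:C *: (N *m A ^t*) - e *m A ^t*.
  have zeta : xi *m A ^t* = z *m E + w.
    have -> : xi = y - e by rewrite /e opprB addrC subrK.
    by rewrite mulmxBl /y mulmxDl -scalemxAl mulmxA mulmxtVK // /w addrAC addrC.
  have wn : enorm w <= 3 * tau.
    apply: le_trans (ler_enormD _ _) _; rewrite enormN enorm_realZ gtr0_norm //.
    have H1 : enorm (N *m A ^t*) <= 1 by rewrite -N1; exact: enorm_adj_le.
    have H2 : enorm (e *m A ^t*) <= enorm e by exact: enorm_adj_le.
    have := ler_wpM2l (ltW tau0) H1; move: H2 e2; clear; lra.
  have perp (u : 'rV[R[i]]_n) : enorm (u - u *m A ^t* *m A) <= 2 * enorm u.
    apply: le_trans (ler_enormD _ _) _; rewrite enormN enorm_unitary //.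
    by have := enorm_adj_le u uA; clear; lra.
  have tN : enorm (tau%:C *: N) = tau by rewrite enorm_realZ N1 mulr1 gtr0_norm.
  have xiperp : enorm (xi - xi *m A ^t* *m A) <= 6 * tau.
    have -> : xi - xi *m A ^t* *m A = (tau%:C *: N - (tau%:C *: N) *m A ^t* *m A) - (e - e *m A ^t* *m A).
      have xiE : xi = (tau%:C *: N - e) + z *m E *m A.
        by rewrite -mulmxA addrAC -/y /e opprB addrC subrK.
      pose Pm := 1%:M - A ^t* *m A.
      have piE (u : 'rV[R[i]]_n) : u - u *m A ^t* *m A = u *m Pm.
        by rewrite mulmxBr mulmx1 mulmxA.
      have APm : A *m Pm = 0 by rewrite mulmxBr mulmx1 mulmxA (elimT unitarymxP uA) mul1mx subrr.
      by rewrite !piE xiE mulmxDl mulmxBl -(mulmxA _ A) APm mulmx0 addr0.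
    apply: le_trans (ler_enormD _ _) _; rewrite enormN.
    have H1 := perp (tau%:C *: N); have H2 := perp e.
    apply: le_trans (lerD H1 H2) _; rewrite tN; move: (enorm e) e2 => t1; clear; lra.
  have xiN : rdot xi N = tau - rdot e N.
    have -> : xi = y - e by rewrite /e opprB addrC subrK.
    rewrite rdotBl /y rdotDl rdot_realZl -sqr_enorm N1 expr1n mulr1.
    by rewrite mulmxA rdot_adj rdot_adj NE rdot0r addr0.
  have eN : rdot e N <= enorm e by have := ler_rdot e N; rewrite N1 mulr1.
  rewrite xiN zeta plform_sqrD //.
  have b1 : - (C * (c * s) * (3 * tau)) <= b (z *m E) w.
    have := HC (z *m E) w; rewrite enorm_unitary // ler_norml => /andP[H _].
    apply: le_trans H; rewrite lerN2 -mulrA ler_wpM2l //.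
    by apply: ler_pM => //; exact: enorm_ge0.
  have b2 : - (C * (3 * tau) * (3 * tau)) <= b w w.
    have := HC w w; rewrite ler_norml => /andP[H _].
    apply: le_trans H; rewrite lerN2 -mulrA ler_wpM2l //.
    by apply: ler_pM => //; exact: enorm_ge0.
  have zw : enorm z ^+ 2 <= 2 * enorm (z *m E + w) ^+ 2 + 2 * (3 * tau) ^+ 2.
    rewrite -(enorm_unitary z uE).
    have H1 : enorm (z *m E) <= enorm (z *m E + w) + 3 * tau.
      have -> : z *m E = (z *m E + w) - w by rewrite addrK.
      apply: le_trans (ler_enormD _ _) _; rewrite enormN addrK; move: wn; clear; lra.
    have H2 := enorm_ge0 (z *m E).
    have H3 : enorm (z *m E) ^+ 2 <= (enorm (z *m E + w) + 3 * tau) ^+ 2.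
      by rewrite ler_pXn2r ?nnegrE //; exact: le_trans H1.
    have := sqr_ge0 (enorm (z *m E + w) - 3 * tau).
    by move: H3; move: (enorm _) (enorm _) => t1 t2; rewrite !expr2; clear; lra.
  have p2 : enorm (xi - xi *m A ^t* *m A) ^+ 2 <= (6 * tau) ^+ 2.
    by rewrite ler_pXn2r ?nnegrE ?enorm_ge0 // mulr_ge0 // ltW.
  have {}p2 := ler_wpM2l K0 p2; have {}zw := ler_wpM2l (ltW ep0) zw.
  rewrite zeta in p2.
  have bz : b (z *m E) (z *m E) = tau * h z by rewrite hE mulrA mulfV ?mul1r // gt_eqF.
  rewrite bz.
  have -> : tau * (1 + h z + ep * enorm z ^+ 2 / (2 * tau) - M * s) =
    tau + tau * h z + ep * enorm z ^+ 2 / 2 - tau * M * s by field; rewrite gt_eqF.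
  have tt : tau ^+ 2 <= tau * s by rewrite expr2 ler_wpM2l // ltW.
  have ttC := ler_wpM2l C0 tt; have ttK := ler_wpM2l K0 tt; have tte := ler_wpM2l (ltW ep0) tt.
  move: b1 b2 zw p2 eN ttC ttK tte; rewrite /M !exprMn.
  move: (enorm (xi - _)) (enorm (z *m E + w)) (b _ _) (b _ _) (rdot e N) (enorm e) (enorm z) (h z) => a1 a2 a3 a4 a5 a6 a7 a8.
  rewrite !expr2; clear; lra.
have Dpos z : enorm z <= c * s -> 0 < D z.
  move=> zs; apply: lt_le_trans (D_lower z zs); rewrite mulr_gt0 //.
  have H1 := h_bound z zs; rewrite ler_norml in H1; have /andP[H2 _] := H1.
  have H3 : C * c ^+ 2 <= 1 / 2.
    apply: le_trans (_ : (C + ep) * c <= _) => //.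
    by apply: ler_pM => //; [exact: sqr_ge0|rewrite lerDl ltW].
  have H4 : 0 <= ep * enorm z ^+ 2 / (2 * tau).
    by apply: divr_ge0; apply: mulr_ge0; [exact: ltW|exact: sqr_ge0|by []|exact: ltW].
  by move: H2 H3 H4 s2; clear; lra.
have cs0 : 0 < c * s by rewrite mulr_gt0.
have inU z : enorm z <= c * s -> (~` X) ((x0 + tau%:C *: N) + z *m (E *m A)).
  by move=> /Dpos; rewrite -DE => /[swap] /(eucl_dist0 X0) ->; rewrite ltxx.
have [_ [Hoo|Hmax]] := HX (x0 + tau%:C *: N) (E *m A) uEA.
  by have := Hoo 0 (inU 0 _); rewrite enorm0 => /(_ (ltW cs0)).
have sub0 : closed_eball 0 (c * s) `<=` [set z | (~` X) ((x0 + tau%:C *: N) + z *m (E *m A))].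
  by move=> y; rewrite /closed_eball /= subr0; exact: inU.
have hwithin : {within [set: 'rV[R[i]]_p.+1], continuous h}.
  by apply/within_econtP; [exact: openT|move=> y _].
have hpsh : plurisubharmonic setT (fun z => (h z)%:E) by apply: plh_psh => //; exact: openT.
have [z Sz] := Hmax 0 (c * s) cs0 sub0 setT h openT (fun _ _ => I) hwithin hpsh.
move=> /(_ 0); rewrite /closed_eball /= subrr enorm0 => /(_ (ltW cs0)).
rewrite !DE -!EFinD lee_fin.
rewrite /esphere /= subr0 in Sz.
have zs : enorm z <= c * s by rewrite Sz.
have h00 : h 0 = 0.
  by rewrite hE mul0mx; have [/(_ 0) /rlin0 -> _ _ _] := pb; rewrite mulr0.
have D0 : D 0 <= tau.
  rewrite -DE; apply: le_trans (eucl_dist_le _ Xx0) _.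
  by rewrite mul0mx addr0 addrAC subrr add0r enorm_realZ N1 mulr1 gtr0_norm.
have lD0 : ln (D 0) <= ln tau by rewrite ler_ln ?posrE //; apply: Dpos; rewrite enorm0 ltW.
have H1 := h_bound z zs.
have H2 : C * c ^+ 2 <= 1 / 2.
  apply: le_trans (_ : (C + ep) * c <= _) => //.
  by apply: ler_pM => //; [exact: sqr_ge0|rewrite lerDl ltW].
have H3 : h z ^+ 2 <= C ^+ 2 * c ^+ 2 * c ^+ 2.
  have : `|h z| ^+ 2 <= (C * c ^+ 2) ^+ 2.
    by rewrite ler_pXn2r ?nnegrE // mulr_ge0 // sqr_ge0.
  by rewrite real_normK ?num_real //; congr (_ <= _); ring.
have H4 : 2 * (C ^+ 2 * c ^+ 2 * c ^+ 2) <= ep * c ^+ 2 / 8.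
  have : 16 * C ^+ 2 * c ^+ 2 <= ep.
    by apply: le_trans c3; rewrite ler_wpM2l // mulr_ge0 // sqr_ge0.
  move=> /(ler_wpM2r (sqr_ge0 c)); move: (C ^+ 2) (c ^+ 2) => t1 t2.
  by clear; lra.
have H5 := D_lower z zs.
have H6 : ep * enorm z ^+ 2 / (2 * tau) = ep * c ^+ 2 / 2.
  by rewrite Sz tauE; field; rewrite gt_eqF.
have pos : 0 < ep * c ^+ 2 by rewrite mulr_gt0 ?exprn_gt0.
set be := 1 + h z + ep * enorm z ^+ 2 / (2 * tau) - M * s in H5.
have H7 : h z < ln be.
  apply: ln_gt_of_quadratic; first exact: le_trans H2.
  by rewrite /be H6; move: H3 H4 pos s3; clear; lra.
have be0 : 0 < be.
  rewrite /be H6; move: H1 H2; rewrite ler_norml => /andP[H8 _] H2.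
  by move: H8 H2 s2 pos; clear; lra.
have : ln (tau * be) <= ln (D z).
  by rewrite ler_ln ?posrE ?mulr_gt0 //; exact: Dpos.
rewrite lnM ?posrE //; move: lD0 H7; rewrite h00; clear; lra.
Qed.

(** Dividing by [|N|] reduces to a unit vector. *)
Lemma no_quadratic_barrier n p (X : set 'rV[R[i]]_n) (A : 'M[R[i]]_(p.+2, n)) (x0 N : 'rV[R[i]]_n)
    (b : 'rV[R[i]]_p.+2 -> 'rV[R[i]]_p.+2 -> R) (ep K rho : R) :
  X !=set0 -> (p < n)%N -> pseudoconvex p (~` X) -> A \is unitarymx -> X x0 -> N != 0 ->
  plform b -> 0 < ep -> 0 <= K -> 0 < rho ->
  (forall xi, X (x0 + xi) -> enorm xi <= rho ->
    rdot xi N + b (xi *m A ^t*) (xi *m A ^t*) + ep * enorm (xi *m A ^t*) ^+ 2 <=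
    K * enorm (xi - xi *m A ^t* *m A) ^+ 2) -> False.
Proof.
move=> X0 pn HX uA Xx0 N0 pb ep0 K0 rho0 H.
have nu0 := enorm_gt0 N0; set nu := enorm N in nu0.
have [lb sb ib [C C0 HC]] := pb.
have nu_ge0 := ltW nu0.
apply: (@no_unit_quadratic_barrier n p X A x0 (nu^-1%:C *: N) (fun x y => nu^-1 * b x y)
   (nu^-1 * ep) (nu^-1 * K) rho) => //.
- by rewrite enorm_realZ ger0_norm ?invr_ge0 // mulVf // gt_eqF.
- split.
  + by move=> z s x y; rewrite lb; ring.
  + by move=> x y; rewrite sb.
  + by move=> x y; rewrite ib mulrN.
  + exists (nu^-1 * C); first by rewrite mulr_ge0 ?invr_ge0.
    by move=> x y; rewrite normrM ger0_norm ?invr_ge0 // -mulrA ler_wpM2l ?invr_ge0.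
- by rewrite mulr_gt0 ?invr_gt0.
- by rewrite mulr_ge0 ?invr_ge0.
- move=> xi Xxi /(H xi Xxi); rewrite rdot_realZr -!mulrA -!mulrDr ler_pM2l ?invr_gt0 //.
Qed.

End Barrier.

Section NoBarrier.
Variable R : realType.
Local Opaque eucl_dist enorm rdot.

(** Riesz representation, with the coordinates of [N] read off on the real basis
formed by the standard vectors and their multiples by i. *)
Lemma rlin_riesz n (l : 'rV[R[i]]_n -> R) : rlin l ->
  exists N : 'rV[R[i]]_n, forall x, l x = rdot x N.
Proof.
move=> ll; exists (\row_j (l (delta_mx 0 j) +i* l ('i *: delta_mx 0 j))) => x.
rewrite {1}(row_sum_delta x) (big_morph l (fun x y => rlinD x y ll) (rlin0 ll)).
Transparent rdot.
apply: eq_bigr => j _; rewrite !mxE /= complexZE ll (rlinZ _ _ ll).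
by [].
Qed.
Local Opaque rdot.

Section Slice.
Variables (n m : nat) (A : 'M[R[i]]_(m, n)).
Hypothesis uA : A \is unitarymx.

(** The coordinates of [x] along the slice spanned by the rows of [A], and its
component across the slice. *)
Definition tang (x : 'rV[R[i]]_n) : 'rV[R[i]]_m := x *m A ^t*.
Definition perp (x : 'rV[R[i]]_n) : 'rV[R[i]]_n := x - x *m A ^t* *m A.

Lemma tangE x : x *m A ^t* = tang x. Proof. by []. Qed.
Lemma perpE x : x - x *m A ^t* *m A = perp x. Proof. by []. Qed.
Lemma tangD x y : tang (x + y) = tang x + tang y. Proof. exact: mulmxDl. Qed.
Lemma tangZ c x : tang (c *: x) = c *: tang x. Proof. by rewrite /tang scalemxAl. Qed.
Lemma perpD x y : perp (x + y) = perp x + perp y.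
Proof. by rewrite /perp !mulmxDl opprD addrACA. Qed.
Lemma perpZ c x : perp (c *: x) = c *: perp x.
Proof. by rewrite /perp -!scalemxAl scalerBr. Qed.
Lemma tangA z : tang (z *m A) = z. Proof. exact: mulmxtVK. Qed.
Lemma perpA z : perp (z *m A) = 0. Proof. by rewrite /perp mulmxtVK // subrr. Qed.
Lemma tang_perp x : x = tang x *m A + perp x.
Proof. by rewrite /perp addrC subrK. Qed.

Lemma enorm_tang_perp x : enorm x ^+ 2 = enorm (tang x) ^+ 2 + enorm (perp x) ^+ 2.
Proof.
have tp : rdot (tang x *m A) (perp x) = 0.
  by rewrite rdot_adj /perp mulmxBl mulmxtVK // subrr rdot0r.
have E : rdot x x = rdot (tang x *m A + perp x) (tang x *m A + perp x) by rewrite -tang_perp.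
rewrite -(enorm_unitary (tang x) uA) !sqr_enorm E.
move: (tang x *m A) (perp x) tp => u v uv.
by rewrite rdotDl !rdotDr (rdotC v u) uv addr0 add0r.
Qed.

Lemma enorm_tang_le x : enorm (tang x) <= enorm x.
Proof. exact: enorm_adj_le. Qed.

Lemma enorm_perp_le x : enorm (perp x) <= enorm x.
Proof.
rewrite -(@ler_pXn2r _ 2) ?nnegrE ?enorm_ge0 // (enorm_tang_perp x) lerDr.
exact: sqr_ge0.
Qed.
End Slice.
Local Opaque tang perp.

(** Let the linear part vanish. The quadratic form
[S = b + (ep/2) |tang|^2 - (K+1) |perp|^2] is negative on [X] near [x0] except at
0, but positive somewhere, because a pluriharmonic form [b] changes sign. Choose
a small [y] with [S(y) > 0] and let [x0 + xs] maximise [S(xi - y)] over the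
points of [X] near [x0]. With [v = xs - y] one has [S(v) >= S(y) > 0], so the
linear part [2 S(v, .)] of the expansion at [xs] does not vanish, and
[no_quadratic_barrier] applies there. *)
Lemma no_barrier n p (X : set 'rV[R[i]]_n) (A : 'M[R[i]]_(p.+2, n)) (x0 : 'rV[R[i]]_n)
    (l : 'rV[R[i]]_n -> R) (b : 'rV[R[i]]_p.+2 -> 'rV[R[i]]_p.+2 -> R) (ep K rho : R) :
  X !=set0 -> closed X -> (p < n)%N -> pseudoconvex p (~` X) -> A \is unitarymx -> X x0 ->
  rlin l -> plform b -> 0 < ep -> 0 <= K -> 0 < rho ->
  (forall xi, X (x0 + xi) -> enorm xi <= rho ->
    l xi + b (tang A xi) (tang A xi) + ep * enorm (tang A xi) ^+ 2 <=
    K * enorm (perp A xi) ^+ 2) -> False.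
Proof.
move=> X0 Xc pn HX uA Xx0 ll pb ep0 K0 rho0 H.
have [N HN] := rlin_riesz ll.
have [N0|N0] := eqVneq N 0; last first.
  by apply: (no_quadratic_barrier X0 pn HX uA Xx0 N0 pb ep0 K0 rho0) => xi Xxi xr; rewrite -HN perpE tangE; exact: H.
have [lb sb ib [C C0 HC]] := pb.
pose S0 (x y : 'rV[R[i]]_n) : R := b (tang A x) (tang A y) + ep / 2 * rdot (tang A x) (tang A y)
   - (K + 1) * rdot (perp A x) (perp A y).
have [S SE] : {S | forall x y, S0 x y = S x y} by exists S0.
have lS x : rlin (S x).
  by move=> s y z; rewrite -!SE /S0 !tangD !perpD !tangZ !perpZ lb (rdotDr (s%:C *: tang A y)) (rdotDr (s%:C *: perp A y)) !rdot_realZr; ring.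
have sS x y : S x y = S y x.
  by rewrite -!SE /S0 sb (rdotC (tang A x)) (rdotC (perp A x)).
pose CS := C + ep / 2 + (K + 1).
have CS0 : 0 <= CS by rewrite !addr_ge0 // divr_ge0 // ltW.
have bS x y : `|S x y| <= CS * (enorm x * enorm y).
  have tt : enorm (tang A x) * enorm (tang A y) <= enorm x * enorm y.
    by apply: ler_pM; rewrite ?enorm_ge0 ?enorm_tang_le.
  have pp : enorm (perp A x) * enorm (perp A y) <= enorm x * enorm y.
    by apply: ler_pM; rewrite ?enorm_ge0 ?enorm_perp_le.
  rewrite -SE /S0; apply: le_trans (ler_normB _ _) _.
  have h1 := ler_normD (b (tang A x) (tang A y)) (ep / 2 * rdot (tang A x) (tang A y)).
  have h2 : `|b (tang A x) (tang A y)| <= C * (enorm x * enorm y).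
    by apply: le_trans (HC _ _) _; rewrite ler_wpM2l.
  have ep2 : 0 <= ep / 2 by rewrite divr_ge0 // ltW.
  have K1 : 0 <= K + 1 by rewrite addr_ge0.
  have h3 : `|ep / 2 * rdot (tang A x) (tang A y)| <= ep / 2 * (enorm x * enorm y).
    by rewrite normrM (ger0_norm ep2) ler_wpM2l // (le_trans (rdot_CS _ _)).
  have h4 : `|(K + 1) * rdot (perp A x) (perp A y)| <= (K + 1) * (enorm x * enorm y).
    by rewrite normrM (ger0_norm K1) ler_wpM2l // (le_trans (rdot_CS _ _)).
  apply: le_trans (lerD (le_trans h1 (lerD h2 h3)) h4) _.
  by rewrite /CS; move: (enorm x * enorm y) => t; clear; lra.
have [mu [mu0 mu1 mu2]] : exists mu : R, [/\ 0 < mu, mu <= ep / 2 & mu <= 1].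
  by exists (Num.min (ep / 2) 1); rewrite lt_min divr_gt0 // ltr01 !ge_min !lexx orbT.
have neg xi : X (x0 + xi) -> enorm xi <= rho -> S xi xi <= - (mu * enorm xi ^+ 2).
  move=> Xxi xr; have := H xi Xxi xr; rewrite HN N0 rdot0r -SE /S0 -!sqr_enorm.
  rewrite (enorm_tang_perp uA xi).
  have := ler_wpM2r (sqr_ge0 (enorm (tang A xi))) mu1.
  have := ler_wpM2r (sqr_ge0 (enorm (perp A xi))) mu2.
  move: (b _ _) (enorm (tang A xi) ^+ 2) (enorm (perp A xi) ^+ 2) => t1 t2 t3.
  by clear; lra.
have [z0 [z01 bz0]] : exists z0 : 'rV[R[i]]_p.+2, enorm z0 = 1 /\ 0 <= b z0 z0.
  have [e [e1 _]] := @unit_orthogonal R p.+2 0 0 isT.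
  have [be|be] := leP 0 (b e e); first by exists e.
  by exists ('i *: e); rewrite enorm_iZ ib oppr_ge0 ltW.
pose y1 := z0 *m A.
have y1n : enorm y1 = 1 by rewrite enorm_unitary.
have Sy1 : 0 < S y1 y1.
  rewrite -SE /S0 /y1 tangA // perpA // rdot0l mulr0 subr0 -sqr_enorm z01 expr1n mulr1.
  by rewrite ltr_wpDl // divr_gt0.
(* [y] is so short that the maximum is not attained at distance [rho]. *)
pose s := mu * rho / (2 * (CS + 1)).
have CS1 : 0 < CS + 1 by rewrite ltr_wpDl.
have s0 : 0 < s by rewrite divr_gt0 ?mulr_gt0.
have sC : 2 * CS * s < mu * rho.
  have : s * (2 * (CS + 1)) = mu * rho by rewrite /s divfK // gt_eqF // mulr_gt0.
  by move: s0; move: s (mu * rho) => t1 t2; clear; lra.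
pose y := s%:C *: y1.
have Zr x c v : S x (c%:C *: v) = c * S x v by exact: rlinZ.
have Syy : S y y = s ^+ 2 * S y1 y1.
  by rewrite /y Zr sS Zr mulrA expr2.
have Sy0 : 0 < S y y by rewrite Syy mulr_gt0 ?exprn_gt0.
have yn : enorm y = s by rewrite enorm_realZ y1n mulr1 gtr0_norm.
have SNy x : S x (- y) = - S x y by exact: rlinN.
have SNN : S (- y) (- y) = S y y by rewrite SNy sS SNy opprK.
pose Kset := [set xi | X (x0 + xi)] `&` closed_eball 0 rho.
have cK : compact Kset.
  apply: (@subclosed_compact _ _ (closed_eball 0 rho)); [|exact: compact_closed_eball|by move=> ? []].
  apply: closedI; last exact: closed_closed_eball.
  apply: (@closed_lip R n n X (fun xi => x0 + xi) 1) => // x x'.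
  by rewrite opprD addrACA subrr add0r mul1r.
have K00 : Kset 0.
  by split; rewrite /closed_eball /= ?addr0 // subrr enorm0 ltW.
have [xs Kxs Hxs] := @real_max R n Kset (fun xi => S (xi - y) (xi - y)) cK (ex_intro _ 0 K00)
  (fun x _ => @econt_comp R n n (fun x => S x x) (fun xi => xi - y) x 1
     (fun x' => ltac:(by rewrite opprB addrA subrK mul1r)) (econt_bilin _ lS sS CS0 bS)).
have [Xxs] := Kxs; rewrite /closed_eball /= subr0 => xsr.
have Smax : S y y <= S (xs - y) (xs - y).
  by have := Hxs 0 K00; rewrite sub0r SNN.
have xs_lt : enorm xs < rho.
  rewrite lt_neqAle xsr andbT; apply/eqP => E.
  have := neg xs Xxs xsr; move: Smax; rewrite bilin_sqrD // SNN SNy E.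
  have := bS xs y; rewrite E yn ler_norml => /andP[+ _].
  have := mulr_gt0 rho0 (_ : 0 < mu * rho - 2 * CS * s); rewrite subr_gt0 => /(_ sC).
  by move: (S _ _) (S _ _) (S _ _) => t1 t2 t3; rewrite expr2; clear; lra.
pose v := xs - y.
have Sv : 0 < S v v by exact: lt_le_trans Smax.
have [N' HN'] := rlin_riesz (lS v).
have N'0 : 2%:C *: N' != 0.
  apply/eqP => E; have := HN' v; have := rdot_realZr 2 N' v; rewrite E rdot0r.
  by move: Sv; move: (S v v) (rdot v N') => t1 t2; clear; lra.
have rho'0 : 0 < rho - enorm xs by rewrite subr_gt0.
have K1 : 0 <= K + 1 by rewrite addr_ge0.
have ep2 : 0 < ep / 2 by rewrite divr_gt0.
apply: (no_quadratic_barrier X0 pn HX uA Xxs N'0 pb ep2 K1 rho'0) => eta Xeta etar.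
have Keta : Kset (xs + eta).
  split; first by rewrite /= addrA.
  rewrite /closed_eball /= subr0; apply: le_trans (ler_enormD _ _) _.
  by move: etar; clear; lra.
have := Hxs _ Keta; rewrite (addrAC xs) -/v bilin_sqrD // rdot_realZr -HN'.
rewrite -[S eta eta]SE /S0 -!sqr_enorm perpE tangE.
by move: (S _ _) (S _ _) (b _ _) (enorm _ ^+ 2) (enorm _ ^+ 2) => t1 t2 t3 t4 t5; clear; lra.
Qed.

End NoBarrier.

(** * From pseudoconvexity to the maximum principle *)

Section Converse.
Variable R : realType.
Local Opaque eucl_dist enorm rdot tang perp.

(** On the compact set where [F >= s] the function [P] is bounded away from 0, so a
large multiple of it outweighs [F]. *)
Lemma penalty n (D : set 'rV[R[i]]_n) (F P : 'rV[R[i]]_n -> R) (s : R) :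
  compact D -> closed D -> (forall x, D x -> econt F x) -> (forall x, D x -> econt P x) ->
  (forall x, D x -> 0 <= P x) -> (forall x, D x -> P x = 0 -> F x < s) ->
  exists2 K : R, 0 <= K & forall x, D x -> F x - K * P x <= s.
Proof.
move=> cD D_closed cF cP P0 Fs.
pose D' := D `&` [set x | s <= F x].
have cD' : compact D'.
  by apply: (subclosed_compact (closed_superlevel D_closed cF) cD) => x [].
have [[x0 D'x0]|D'0] := pselect (D' !=set0); last first.
  exists 0 => // x Dx; rewrite mul0r subr0 leNgt; apply/negP => sF.
  by apply: D'0; exists x; split => //; exact: ltW.
have [m [Dm sm] Hm] := @real_max R n D' (fun x => -1 * P x) cD' (ex_intro _ x0 D'x0)
  (fun x (Dx : D' x) => econtZ _ (cP x Dx.1)).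
have [M D'M HM] := @real_max R n D' F cD' (ex_intro _ x0 D'x0) (fun x Dx => cF x Dx.1).
have Pm : 0 < P m.
  rewrite lt_neqAle P0 // andbT eq_sym; apply/eqP => /(Fs m Dm).
  by rewrite ltNge sm.
have [K KE] : exists K, K = (F M - s) / P m by exists ((F M - s) / P m).
have K0 : 0 <= K by rewrite KE divr_ge0 ?P0 // subr_ge0; case: D'M.
have KP : K * P m = F M - s by rewrite KE divfK // gt_eqF.
exists K => // x Dx; have [sx|sx] := leP s (F x).
  have D'x : D' x by [].
  have := HM x D'x; have := Hm x D'x => h1 h2.
  have h1' : P m <= P x by move: h1; lra.
  by have := ler_wpM2l K0 h1'; move: KP h2; lra.
have := mulr_ge0 K0 (P0 x Dx); move: sx; lra.
Qed.

(** A violation of the maximum principle on a slice is turned into a barrier for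
[no_barrier]: the sum of the smoothed test function, of [e |z - c|^2] and of
[- K |perp|^2] is maximised over the points of [X] in a cylinder about the ball.
The strict inequality on the sphere and the choice of [K] keep the maximum point
away from the boundary of the cylinder. *)
Lemma pseudoconvex_max_prop n p (X : set 'rV[R[i]]_n) :
  X !=set0 -> closed X -> (p.+1 < n)%N -> pseudoconvex p (~` X) -> max_prop p.+1 X.
Proof.
move=> X0 Xc pn HX a A uA c r r0 V h oV BV ch pshh w Bw Xw.
apply: contrapT => nE.
have {}nE z : esphere c r z -> X (a + z *m A) -> h z < h w.
  by move=> Sz Xz; rewrite ltNge; apply/negP => hwz; apply: nE; exists z.
have SB z : esphere c r z -> closed_eball c r z by exact: esphere_sub.
have [eta eta0 Heta] : exists2 eta : R, 0 < eta &
    forall z, esphere c r z -> X (a + z *m A) -> h z + 5 * eta <= h w.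
  pose S := esphere c r `&` [set z | X (a + z *m A)].
  have cS : compact S.
    apply: (@subclosed_compact _ _ (esphere c r)); [|exact: compact_esphere|by move=> ? []].
    by apply: closedI; [exact: closed_esphere|exact: (closed_lip Xc (slice_lip a uA))].
  have [[z0 Sz0]|S0] := pselect (S !=set0); last first.
    by exists 1 => // z Sz Xz; case: S0; exists z.
  have [z1 [Sz1 Xz1] Hz1] := @real_max R _ S h cS (ex_intro _ z0 Sz0)
    (fun x (Sx : S x) => ch x (BV x (SB x Sx.1))).
  have hz1 := nE z1 Sz1 Xz1.
  exists ((h w - h z1) / 5); first by rewrite divr_gt0 // subr_gt0.
  move=> z Sz Xz; have := Hz1 z (conj Sz Xz); move: (h z) (h z1) (h w) => t1 t2 t3.
  by lra.
have [g [gh cg gT]] := psh_smoothing oV BV ch pshh eta0.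
(* [e |z - c|^2] changes the values on the ball by at most [eta]. *)
have [e [e0 er]] : exists e : R, 0 < e /\ e * r ^+ 2 = eta.
  exists (eta / r ^+ 2); split; first by rewrite divr_gt0 ?exprn_gt0.
  by rewrite divfK // expf_neq0 // gt_eqF.
have [T TE] : {T | forall x, tang A (x - a) = T x} by exists (fun x => tang A (x - a)).
have [Q QE] : {Q | forall x, perp A (x - a) = Q x} by exists (fun x => perp A (x - a)).
have TD x y : T (x + y) = T x + tang A y by rewrite -!TE addrAC tangD.
have QD x y : Q (x + y) = Q x + perp A y by rewrite -!QE addrAC perpD.
have TB x y : T y - T x = tang A (y - x) by rewrite -[in T y](subrKC x y) TD addrC addKr.
have QB x y : Q y - Q x = perp A (y - x) by rewrite -[in Q y](subrKC x y) QD addrC addKr.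
have Tlip x y : enorm (T y - T x) <= 1 * enorm (y - x).
  by rewrite TB mul1r; exact: enorm_tang_le.
have Qlip x y : enorm (Q y - Q x) <= 1 * enorm (y - x).
  by rewrite QB mul1r; exact: enorm_perp_le.
have TQ x : x = a + T x *m A + Q x.
  by rewrite -TE -QE -addrA -tang_perp addrC subrK.
have Tz z : T (a + z *m A) = z by rewrite -TE addrC addKr tangA.
have Qz z : Q (a + z *m A) = 0 by rewrite -QE addrC addKr perpA.
have [k1 k1E] : {k1 | forall x, enorm (T x - c) = k1 x} by exists (fun x => enorm (T x - c)).
have [k2 k2E] : {k2 | forall x, enorm (Q x) = k2 x} by exists (fun x => enorm (Q x)).
have k20 x : 0 <= k2 x by rewrite -k2E enorm_ge0.
have ck1 x : econt k1 x.
  have := econt_comp (Tlip x) (econt_enorm c (T x)).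
  by rewrite (_ : (fun y => enorm (T y - c)) = k1) //; apply/funext => y; rewrite k1E.
have ck2 x : econt k2 x.
  have := econt_comp (Qlip x) (econt_enorm 0 (Q x)).
  by rewrite (_ : (fun y => enorm (Q y - 0)) = k2) //; apply/funext => y; rewrite subr0 k2E.
pose Kset := [set x | [/\ X x, k1 x <= r & k2 x <= 1]].
have Kset_closed : closed Kset.
  rewrite (_ : Kset = X `&` ([set x | k1 x <= r] `&` [set x | k2 x <= 1])).
    by apply: closedI => //; apply: closedI; exact: closed_econt_le.
  by apply/seteqP; split => x /= => [[? ? ?]|[? [? ?]]].
have Kset_compact : compact Kset.
  apply: (@subclosed_compact _ _ (closed_eball a (r + enorm c + 1))) => //.
    exact: compact_closed_eball.
  move=> x [_ x1 x2]; rewrite /closed_eball /=.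
  have -> : x - a = T x *m A + Q x by rewrite {1}(TQ x) addrC !addrA addNr add0r.
  apply: le_trans (ler_enormD _ _) _; rewrite enorm_unitary // k2E.
  have := ler_enormD (T x - c) c; rewrite subrK k1E.
  by move: x1 x2; move: (enorm (T x)) (enorm c) (k1 x) (k2 x) => t1 t2 t3 t4; lra.
have [G GE] : {G | forall z, g z + e * enorm (z - c) ^+ 2 = G z}.
  by exists (fun z => g z + e * enorm (z - c) ^+ 2).
have cG z : closed_eball c r z -> econt G z.
  move=> Bz; rewrite (_ : G = fun z => g z + e * (enorm (z - c) * enorm (z - c))).
    by apply: econtD; [exact: cg|apply: econtZ; apply: econtM; exact: econt_enorm].
  by apply/funext => y; rewrite -GE expr2.
have KB x : Kset x -> closed_eball c r (T x) by move=> [_ + _]; rewrite -k1E.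
have [F FE] : {F | forall x, G (T x) = F x} by exists (fun x => G (T x)).
have cF x : Kset x -> econt F x.
  move=> Kx; have := econt_comp (Tlip x) (cG _ (KB x Kx)).
  by rewrite (_ : (fun y => G (T y)) = F) //; apply/funext => y; rewrite FE.
have cP x : econt (fun y => k2 y * k2 y) x by exact: econtM.
(* The boundary of the cylinder: its side over the sphere and its ends. *)
pose Bd := (Kset `&` [set x | r <= k1 x]) `|` (Kset `&` [set x | 1 <= k2 x]).
have BdK x : Bd x -> Kset x by case=> -[].
have Bd_closed : closed Bd by apply: closedU; apply: closed_superlevel.
have Bd_compact : compact Bd by exact: subclosed_compact Kset_compact BdK.
have [||||||K K0 HK] := @penalty _ Bd F (fun y => k2 y * k2 y) (h w - 2 * eta).
- by [].
- by [].
- by move=> x /BdK/cF.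
- by move=> x _; exact: cP.
- by move=> x _; exact: mulr_ge0.
- move=> x Bx /eqP; rewrite mulf_eq0 orbb => /eqP k2x.
  have xE : x = a + T x *m A.
    by rewrite {1}(TQ x) (@enorm_eq0 _ _ (Q x)) ?addr0 // k2E.
  have [Xx k1x _] := BdK x Bx.
  have {}Bx : r <= k1 x by case: Bx => -[_ //=]; rewrite k2x ler10.
  have k1r : k1 x = r by apply/eqP; rewrite eq_le k1x.
  have Sx : esphere c r (T x) by rewrite /esphere /= k1E.
  rewrite xE in Xx; have := Heta _ Sx Xx.
  have := gh _ (SB _ Sx); rewrite ler_norml => /andP[_ +].
  rewrite -FE -GE k1E k1r er.
  by move: eta0; move: (g _) (h _) (h w) => t1 t2 t3; lra.
have KXw : Kset (a + w *m A).
  by split => //; rewrite -?k1E -?k2E ?Tz ?Qz ?enorm0.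
have [xs Kxs Hxs] := @real_max R n Kset (fun x => F x + - K * (k2 x * k2 x)) Kset_compact
   (ex_intro _ _ KXw) (fun x Kx => econtD (cF x Kx) (econtZ _ (cP x))).
have Fxs : h w - eta <= F xs - K * (k2 xs * k2 xs).
  have := Hxs _ KXw; rewrite -!FE Tz -(k2E (a + _)) Qz enorm0 mulr0 mulr0 addr0 mulNr.
  apply: le_trans; have := gh w Bw; rewrite ler_norml => /andP[+ _]; rewrite -GE.
  have := mulr_ge0 (ltW e0) (sqr_ge0 (enorm (w - c))).
  by move: (g w) (h w) (_ * _) => t1 t2 t3; lra.
have nBd : ~ Bd xs.
  by move=> /HK; move: Fxs eta0; move: (F xs - _) (h w) => t1 t2; lra.
have [Xxs k1xs k2xs] := Kxs.
have k1r : k1 xs < r by rewrite ltNge; apply/negP => H; apply: nBd; left.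
have k2r : k2 xs < 1 by rewrite ltNge; apply/negP => H; apply: nBd; right.
have [l [b [C [rho [ll pb C0 rho0 Tay]]]]] := gT _ (KB _ Kxs).
have [C1 C1e] : exists C1 : R, 0 < C1 /\ C * C1 <= e / 2.
  exists (e / 2 / (C + 1)); have C10 : 0 < C + 1 by rewrite ltr_wpDl.
  split; first by rewrite !divr_gt0.
  rewrite mulrCA ger_pMr ?divr_gt0 // ler_pdivrMr // mul1r lerDl; exact: ler01.
have [C10 C1C] := C1e.
have [d [d0 [dr1 dr2] [d1 d2]]] : exists d : R, [/\ 0 < d, d <= rho /\ d <= C1 &
    d <= r - k1 xs /\ d <= 1 - k2 xs].
  exists (Num.min (Num.min rho C1) (Num.min (r - k1 xs) (1 - k2 xs))).
  by rewrite !lt_min !subr_gt0 rho0 C10 k1r k2r !ge_min !lexx !orbT.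
pose l' xi := l (tang A xi) + 2 * e * rdot (tang A xi) (T xs - c)
  - 2 * K * rdot (perp A xi) (Q xs).
have ll' : rlin l'.
  move=> s x y; rewrite /l' tangD perpD tangZ perpZ ll (rdotDl (s%:C *: tang A x)).
  by rewrite (rdotDl (s%:C *: perp A x)) !rdot_realZl; ring.
have e2 : 0 < e / 2 by rewrite divr_gt0.
apply: (no_barrier X0 Xc (ltnW pn) HX uA Xxs ll' pb e2 K0 d0) => xi Xxi xid.
have tx := enorm_tang_le uA xi; have px := enorm_perp_le uA xi.
have Kxi : Kset (xs + xi).
  split => //.
    rewrite -k1E TD addrAC; apply: le_trans (ler_enormD _ _) _; rewrite k1E.
    by move: tx xid d1; lra.
  rewrite -k2E QD; apply: le_trans (ler_enormD _ _) _; rewrite k2E.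
  by move: px xid d2; lra.
have := Hxs _ Kxi; rewrite -!FE -!GE -!k2E TD QD.
rewrite (enorm_sqrD (T xs - c) (T xs + tang A xi - c)) -!expr2 (enorm_sqrD (Q xs) (Q xs + perp A xi)).
have -> : T xs + tang A xi - c - (T xs - c) = tang A xi by rewrite (addrAC (T xs)) addrC addrK.
have -> : Q xs + perp A xi - Q xs = perp A xi by rewrite addrC addKr.
have := Tay _ (le_trans tx (le_trans xid dr1)).
have : C * enorm (tang A xi) ^+ 3 <= e / 2 * enorm (tang A xi) ^+ 2.
  rewrite exprS mulrA ler_wpM2r ?sqr_ge0 //; apply: le_trans C1C.
  by rewrite ler_wpM2l // (le_trans tx) // (le_trans xid).
rewrite /l'; move: (g _) (g _) (l _) (b _ _) (rdot _ _) (rdot _ _) => t1 t2 t3 t4 t5 t6.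
move: (enorm _ ^+ 2) (enorm _ ^+ 2) (enorm _ ^+ 2) (enorm _ ^+ 2) (C * _) => t7 t8 t9 t10 t11.
by lra.
Qed.

End Converse.

Theorem corollary4p7 (R : realType) (n q : nat) (f : R -> \bar R)
    (X : set 'rV[R[i]]_n)
    (f_usc : usc_on setT f)
    (f_decr : forall s t : R, s <= t -> (f t <= f s)%E)
    (f0 : f 0 = 0%E)
    (f_neg : forall t : R, 0 < t -> (f t < 0)%E)
    (X_nonempty : X !=set0)
    (X_closed : closed X) :
  (PSH q setT (char_fun X) <-> PSH q setT (fun z => f (eucl_dist X z))) /\
  ((1 <= q < n)%N ->
    [<-> PSH q setT (char_fun X);
         PSH q setT (fun z => f (eucl_dist X z));
         pseudoconvex q.-1 (~` X)]).
Proof.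
have char_mp : (q < n)%N -> PSH q setT (char_fun X) <-> max_prop q X.
  exact: PSH_char_max_prop.
have mp_dist : max_prop q X -> PSH q setT (fun z => f (eucl_dist X z)).
  exact: max_prop_fdist.
have dist_mp : (q < n)%N -> PSH q setT (fun z => f (eucl_dist X z)) -> max_prop q X.
  exact: fdist_max_prop.
split.
  have [qn|nq] := ltnP q n.
    split; first by move/(char_mp qn)/mp_dist.
    by move/(dist_mp qn)/(char_mp qn).
  split=> _; split.
  - by apply: usc_on_comp => // x; exact: econt_eucl_dist.
  - by rewrite ltnNge nq.
  - exact: usc_on_char.
  - by rewrite ltnNge nq.
case: q char_mp mp_dist dist_mp => // p char_mp mp_dist dist_mp /andP[_ pn] /=.
split; first by move/(char_mp pn)/mp_dist.
split; first by move/(dist_mp pn); exact: max_prop_pseudoconvex.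
by move=> H; apply/(char_mp pn); exact: pseudoconvex_max_prop.
Qed.
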